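(* Fix a JRC node $i$ and channel $j$ with $M_c$ sub-carriers, spacing $\Delta f>0$, pulse repetition interval $T_{\rm pri}>0$ and radar noise power $\sigma_r^2>0$. For each sub-carrier $m$ let $C_3^{(m)}=T_{\rm pri}D_{bi}^{-\alpha_{bi}}p_m^{(T)}>0$ and let $C_4=D_{gi}^{-\alpha_{gi}}p_g^{(J)}>0$. For each $m$ let $G_m\sim\alpha\text{-}\mu(\alpha_{rm},\mu_{rm},\bar\gamma_{rm})$ (modeling $|G(f_m)|^2$) and $J_m\sim\alpha\text{-}\mu(\alpha_{rg},\mu_{rg},\bar\gamma_{rg})$ (modeling $|J(f_m)|^2$) be independent, with scale parameters $\beta_{rm},\beta_{rg}$, and define the radar mutual information $$I_{ij}=\frac{\Delta f\,T_{\rm pri}}{2}\sum_{m=1}^{M_c}\log_2\!\left(1+\frac{C_3^{(m)}G_m}{\sigma_r^2+C_4J_m}\right).$$ Then $$E[I_{ij}]=\sum_{m=1}^{M_c}\frac{\Delta f\,T_{\rm pri}}{2\ln 2}\,\Lambda\big(C_3^{(m)},C_4,\sigma_r^2;\alpha_{rm},\mu_{rm},\beta_{rm};\alpha_{rg},\mu_{rg},\beta_{rg}\big),$$ where $\Lambda$ is the function defined in the context.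
   Context: Squared $\alpha$–$\mu$ distribution: $\Upsilon\sim\alpha\text{-}\mu(\alpha,\mu,\bar\gamma)$ ($\alpha,\mu,\bar\gamma>0$) means $\Upsilon\ge0$ has density $f_\Upsilon(\gamma)=\frac{\alpha\gamma^{\alpha\mu/2-1}}{2\beta^{\alpha\mu/2}\Gamma(\mu)}\exp(-(\gamma/\beta)^{\alpha/2})$, $\gamma>0$, with scale parameter $\beta=\bar\gamma\Gamma(\mu)/\Gamma(\mu+2/\alpha)$. Definition of $\Lambda$: for $A,B,\sigma^2>0$ and parameters $\alpha_1,\mu_1,\beta_1,\alpha_2,\mu_2,\beta_2>0$, put $a_1=\alpha_1\mu_1/2$, $a_2=\alpha_2\mu_2/2$ and $$\Lambda(A,B,\sigma^2;\alpha_1,\mu_1,\beta_1;\alpha_2,\mu_2,\beta_2)=\frac{(\sigma^2)^{a_1+a_2}}{(A\beta_1)^{a_1}\Gamma(\mu_1)(B\beta_2)^{a_2}\Gamma(\mu_2)}\left(\frac{1}{2\pi i}\right)^2\int_{\mathcal L_1}\int_{\mathcal L_2}\frac{\Gamma\!\left(-\frac{2t_1}{\alpha_1}\right)\Gamma\!\left(-\frac{2t_2}{\alpha_2}\right)\Gamma(a_2+t_2)\Gamma(-a_1-a_2-t_1-t_2)}{\Gamma(-a_1-t_1)}\cdot\frac{\Gamma(a_1+t_1)\Gamma(1-a_1-t_1)}{a_1+t_1}\left(\frac{\sigma^2}{A\beta_1}\right)^{t_1}\left(\frac{\sigma^2}{B\beta_2}\right)^{t_2}dt_2\,dt_1,$$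 where $\mathcal L_2$ is the vertical line $\mathrm{Re}\,t_2=c_2$ with $-a_2<c_2<\min(0,1-a_2)$ and $\mathcal L_1$ the vertical line $\mathrm{Re}\,t_1=c_1$ with $-1-a_1<c_1<-a_1-a_2-c_2$. (This double Mellin–Barnes integral is a bivariate Fox $H$-function.) In the model, $p_m^{(T)}$ is the transmit power on sub-carrier $m$, $p_g^{(J)}$ the jamming power, $D_{bi},D_{gi}$ distances from node $i$ to the receiver/target and to the jammer with path-loss exponents $\alpha_{bi},\alpha_{gi}$. *)

(* Defs.v *)
From mathcomp Require Import all_boot all_order all_algebra.
From mathcomp Require Import all_classical all_reals all_analysis.
From mathcomp Require Import complex.
Set Implicit Arguments. Unset Strict Implicit. Unset Printing Implicit Defensive.
Import Order.TTheory GRing.Theory Num.Theory.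
Import numFieldNormedType.Exports.
Local Open Scope ring_scope.
Local Open Scope classical_set_scope.
Local Open Scope complex_scope.

Section Defs.
Variable R : realType.
Local Notation C := (R[i]).
Local Notation mu := (@lebesgue_measure R).

Definition cexp (z : C) : C :=
  (expR (complex.Re z))%:C * (cos (complex.Im z) +i* sin (complex.Im z)).

Definition cpow (x : R) (z : C) : C := cexp (z * (ln x)%:C).

Definition GammaR (x : R) : R :=
  Rintegral mu `]0%R, +oo[ (fun t => t `^ (x - 1) * expR (- t)).

(** Gamma function on C (minus the poles), via Gauss' limit formula
    Gamma(z) = lim_n n! n^z / (z (z+1) ... (z+n)),
    the limit of a complex sequence being taken componentwise. *)
Definition Gauss_seq (z : C) (n : nat) : C :=
  (n`!%:R)%:C * cpow n%:R z / \prod_(k < n.+1) (z + (k%:R)%:C).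
Definition GammaC (z : C) : C :=
  (limn (fun n => complex.Re (Gauss_seq z n)))%:C
  + 'i * (limn (fun n => complex.Im (Gauss_seq z n)))%:C.

Definition cint (f : R -> C) : C :=
  (Rintegral mu setT (fun y => complex.Re (f y)))%:C
  + 'i * (Rintegral mu setT (fun y => complex.Im (f y)))%:C.

(** (1/(2 pi i)) * int_{L} f(t) dt  along the vertical line L = {Re t = c},
    parametrised by t = c + i y, dt = i dy, y from -oo to +oo. *)
Definition mb_line (c : R) (f : C -> C) : C :=
  ((2%:R * pi)%:C * 'i)^-1 * cint (fun y => f (c%:C + 'i * y%:C) * 'i).

Definition amu_beta (al m gbar : R) : R := gbar * GammaR m / GammaR (m + 2 / al).

Definition amu_pdf (al m gbar : R) (g : R) : R :=
  if 0 < g then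
    let b := amu_beta al m gbar in
    al * g `^ (al * m / 2 - 1) / (2 * b `^ (al * m / 2) * GammaR m)
    * expR (- ((g / b) `^ (al / 2)))
  else 0.

Definition is_alpha_mu d (T : measurableType d) (P : probability T R)
  (Y : T -> R) (al m gbar : R) : Prop :=
  measurable_fun setT Y /\
  forall A : set R, measurable A ->
    P (Y @^-1` A) = (\int[mu]_(x in A) (amu_pdf al m gbar x)%:E)%E.

Definition indep2 d (T : measurableType d) (P : probability T R)
  (X Y : T -> R) : Prop :=
  forall A B : set R, measurable A -> measurable B ->
    P (X @^-1` A `&` Y @^-1` B) = (P (X @^-1` A) * P (Y @^-1` B))%E.

(** The function Lambda (bivariate Fox H-function) computed along the
    vertical contours Re t1 = c1 and Re t2 = c2. *)
Definition Lambda_integrand (A B s2 al1 m1 b1 al2 m2 b2 : R) (t1 t2 : C) : C :=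
  let a1 := (al1 * m1 / 2)%:C in
  let a2 := (al2 * m2 / 2)%:C in
  GammaC (- (2%:R%:C * t1) / al1%:C) * GammaC (- (2%:R%:C * t2) / al2%:C)
  * GammaC (a2 + t2) * GammaC (- a1 - a2 - t1 - t2) / GammaC (- a1 - t1)
  * (GammaC (a1 + t1) * GammaC (1 - a1 - t1) / (a1 + t1))
  * cpow (s2 / (A * b1)) t1 * cpow (s2 / (B * b2)) t2.

Definition Lambda (c1 c2 : R) (A B s2 al1 m1 b1 al2 m2 b2 : R) : C :=
  let a1 := al1 * m1 / 2 in
  let a2 := al2 * m2 / 2 in
  (s2 `^ (a1 + a2)
    / ((A * b1) `^ a1 * GammaR m1 * (B * b2) `^ a2 * GammaR m2))%:C
  * mb_line c1 (fun t1 => mb_line c2 (fun t2 =>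
      Lambda_integrand A B s2 al1 m1 b1 al2 m2 b2 t1 t2)).

Definition Lambda_contours (c1 c2 al1 m1 al2 m2 : R) : Prop :=
  let a1 := al1 * m1 / 2 in
  let a2 := al2 * m2 / 2 in
  [/\ - a2 < c2, c2 < Num.min 0 (1 - a2), - 1 - a1 < c1 & c1 < - a1 - a2 - c2].

Definition log2 (x : R) : R := ln x / ln 2.

End Defs.

(* Main.v *)
Require Import Defs.
From HB Require Import structures.
From mathcomp Require Import all_boot all_order all_algebra.
From mathcomp Require Import all_classical all_reals all_analysis.
From mathcomp Require Import complex measurable_realfun.
From mathcomp Require Import ring lra.
Set Implicit Arguments. Unset Strict Implicit. Unset Printing Implicit Defensive.
Import Order.TTheory GRing.Theory Num.Theory.
Import numFieldNormedType.Exports.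
Local Open Scope ring_scope.
Local Open Scope classical_set_scope.
Local Open Scope complex_scope.

(** On the contours put [s = - a1 - t1] and [u = a2 + t2], so that
    [0 < Re u < Re s < 1].  The integrand of [Lambda] then splits into the
    reflection kernel [Gamma s * Gamma (1 - s) / s], the Beta kernel
    [Gamma u * Gamma (s - u) / Gamma s], and factors which are, up to the
    prefactor of [Lambda], the moments [E (G ^ s)] and [E (J ^ - u)] of the
    alpha-mu laws.  By Fubini the integral in [u] is the Mellin inversion

      [1 / (2 pi i) * int Gamma u * Gamma (s - u) / Gamma s * x ^ - u du =
       (1 + x) ^ - s]

    under [E], at [x = B J / s2].  Independence turns the result into the
    [s]-moment of [A G / (s2 + B J)], and the integral in [s] is the inversion

      [1 / (2 pi i) * int Gamma s * Gamma (1 - s) / s * x ^ s ds = ln (1 + x)]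

    under [E].  After the substitution [x = exp v] both inversions are instances
    of Fourier inversion on the real line, proved with an approximate identity.
    The Gamma function is handled as [int_R exp (z v - exp v) dv], which agrees
    with Gauss' limit for [0 < Re z]. *)

(** Two bounds make the exchanges of line integral and expectation absolutely convergent. On a
    vertical line both kernels are at most a constant times [(oneDsqr y)^-1]: the functional
    equation moves Gamma to the right at the price of a factor 1/z, and two such factors give
    quadratic decay. The moment factors E (X ^ z) are bounded on the line by the absolute moment at
    the real part of z. The contour conditions keep these moments finite and the kernels inside
    their strips.

    Real integrals are total and return a default value when they diverge, so each inversion under
    the expectation delivers the integrability of its line integrand together with its value.
    [GammaC] is likewise a total limit. A single Gamma argument of [Lambda], namely [a1 + t1 = - s],
    lies in the left half-plane; it is reached by comparing the Gauss sequences at z and z + 1.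

    Divisions by Gamma values require nonvanishing. For complex arguments it comes from the Beta
    identity; for [GammaR] and the scale parameters of the laws it comes from the fact that a
    density has mass 1. *)

Local Notation Re := complex.Re.
Local Notation Im := complex.Im.
Local Notation normc := ComplexField.Normc.normc.

(** * Complex-valued integrals *)

Section complex_arith.
Variable R : realType.
Local Notation C := (R[i]).
Implicit Types (z w : C) (x y : R).

Lemma cReD z w : Re (z + w) = Re z + Re w. Proof. by case: z; case: w. Qed.
Lemma cImD z w : Im (z + w) = Im z + Im w. Proof. by case: z; case: w. Qed.
Lemma cReN z : Re (- z) = - Re z. Proof. by case: z. Qed.
Lemma cImN z : Im (- z) = - Im z. Proof. by case: z. Qed.
Lemma cReM z w : Re (z * w) = Re z * Re w - Im z * Im w.
Proof. by case: z; case: w. Qed.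
Lemma cImM z w : Im (z * w) = Re z * Im w + Im z * Re w.
Proof. by case: z; case: w. Qed.

Lemma cReMr z x : Re (z * x%:C) = Re z * x.
Proof. by rewrite cReM /= mulr0 subr0. Qed.
Lemma cImMr z x : Im (z * x%:C) = Im z * x.
Proof. by rewrite cImM /= mulr0 add0r. Qed.

Definition cReImE := (cReD, cImD, cReN, cImN, cReM, cImM).

Lemma complex_eq z w : Re z = Re w -> Im z = Im w -> z = w.
Proof. by case: z; case: w => /= ? ? ? ? -> ->. Qed.

Lemma Re_le_normc z : `|Re z| <= normc z.
Proof.
case: z => a b /=; rewrite -sqrtr_sqr ler_wsqrtr// lerDl; exact: sqr_ge0.
Qed.
Lemma Im_le_normc z : `|Im z| <= normc z.
Proof.
case: z => a b /=; rewrite -sqrtr_sqr ler_wsqrtr// lerDr; exact: sqr_ge0.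
Qed.
Lemma normc_le z : normc z <= `|Re z| + `|Im z|.
Proof.
case: z => a b /=; rewrite -[leRHS]ger0_norm ?addr_ge0//.
rewrite -[leRHS]sqrtr_sqr ler_wsqrtr// sqrrD !real_normK ?num_real//.
by rewrite -addrA [X in _ <= _ + X]addrC addrA lerDl mulrn_wge0// mulr_ge0.
Qed.
Lemma normc_ge0 z : 0 <= normc z.
Proof. by case: z => a b /=; exact: sqrtr_ge0. Qed.
Lemma normcR x : normc x%:C = `|x|.
Proof. by rewrite /= expr0n/= addr0 sqrtr_sqr. Qed.

Lemma cexpD z w : cexp (z + w) = cexp z * cexp w.
Proof.
by apply: complex_eq; rewrite /cexp !cReImE /= expRD cosD sinD; ring.
Qed.
Lemma cexp0 : cexp (0 : C) = 1.
Proof. by apply: complex_eq; rewrite /cexp !cReImE /= expR0 cos0 sin0; ring. Qed.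
Lemma cexpN z : cexp (- z) = (cexp z)^-1.
Proof.
have h : cexp z * cexp (- z) = 1 by rewrite -cexpD subrr cexp0.
have z0 : cexp z != 0.
  by apply/eqP => z0; move: h; rewrite z0 mul0r => /esym/eqP; rewrite oner_eq0.
by rewrite -[LHS]mul1r -(mulVf z0) -mulrA h mulr1.
Qed.
Lemma cexp_neq0 z : cexp z != 0.
Proof.
apply/eqP => z0; have : cexp z * cexp (- z) = 1 by rewrite -cexpD subrr cexp0.
by rewrite z0 mul0r => /esym/eqP; rewrite oner_eq0.
Qed.
Lemma Re_cexp z : Re (cexp z) = expR (Re z) * cos (Im z).
Proof. by rewrite /cexp cReM/=; ring. Qed.
Lemma Im_cexp z : Im (cexp z) = expR (Re z) * sin (Im z).
Proof. by rewrite /cexp cImM/=; ring. Qed.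
Lemma normc_cexp z : normc (cexp z) = expR (Re z).
Proof.
rewrite /cexp ComplexField.Normc.normcM normcR /= cos2Dsin2 sqrtr1 mulr1.
by rewrite ger0_norm// expR_ge0.
Qed.
Lemma cexpR x : cexp x%:C = (expR x)%:C.
Proof. by apply: complex_eq; rewrite ?Re_cexp ?Im_cexp /= ?cos0 ?sin0; ring. Qed.

End complex_arith.

(** * Measurability of complex-valued functions *)

Section cmeasurable.
Context d (T : measurableType d) (R : realType).
Local Notation C := (R[i]).
Implicit Types (f g : T -> C).

Definition cmeasurable f :=
  measurable_fun setT (fun x => Re (f x)) /\ measurable_fun setT (fun x => Im (f x)).

Lemma eq_cmeasurable f g : f =1 g -> cmeasurable f -> cmeasurable g.
Proof. by move=> /funext ->. Qed.

Lemma cmeasurable_cst (z : C) : cmeasurable (fun=> z).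
Proof. by split; exact: measurable_cst. Qed.
Lemma cmeasurable_real (f : T -> R) : measurable_fun setT f ->
  cmeasurable (fun x => (f x)%:C).
Proof. by move=> mf; split => //; exact: measurable_cst. Qed.
Lemma cmeasurableD f g : cmeasurable f -> cmeasurable g ->
  cmeasurable (fun x => f x + g x).
Proof.
move=> [f1 f2] [g1 g2]; split.
  by under eq_fun do rewrite cReD; exact: measurable_funD.
by under eq_fun do rewrite cImD; exact: measurable_funD.
Qed.
Lemma cmeasurableN f : cmeasurable f -> cmeasurable (fun x => - f x).
Proof.
move=> [f1 f2]; split.
  by under eq_fun do rewrite cReN; apply: measurableT_comp.
by under eq_fun do rewrite cImN; apply: measurableT_comp.
Qed.
Lemma cmeasurableB f g : cmeasurable f -> cmeasurable g ->
  cmeasurable (fun x => f x - g x).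
Proof. by move=> mf mg; apply: cmeasurableD => //; exact: cmeasurableN. Qed.
Lemma cmeasurableM f g : cmeasurable f -> cmeasurable g ->
  cmeasurable (fun x => f x * g x).
Proof.
move=> [f1 f2] [g1 g2]; split.
  under eq_fun do rewrite cReM.
  by apply: measurable_funB; exact: measurable_funM.
under eq_fun do rewrite cImM.
by apply: measurable_funD; exact: measurable_funM.
Qed.
Lemma cmeasurable_exp f : cmeasurable f -> cmeasurable (fun x => cexp (f x)).
Proof.
move=> [f1 f2]; split.
  under eq_fun do rewrite Re_cexp.
  apply: measurable_funM; first exact: measurableT_comp.
  by apply: measurableT_comp f2; apply: continuous_measurable_fun;
    exact: continuous_cos.
under eq_fun do rewrite Im_cexp.
apply: measurable_funM; first exact: measurableT_comp.
by apply: measurableT_comp f2; apply: continuous_measurable_fun;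
  exact: continuous_sin.
Qed.

End cmeasurable.

Lemma cmeasurable_comp d1 d2 (T1 : measurableType d1) (T2 : measurableType d2)
    (R : realType) (phi : T1 -> T2) (f : T2 -> R[i]) :
  measurable_fun setT phi -> cmeasurable f -> cmeasurable (fun x => f (phi x)).
Proof.
move=> mphi [f1 f2]; split.
  exact: (measurableT_comp f1).
exact: (measurableT_comp f2).
Qed.

(** * The complex integral, componentwise limits and dominated convergence *)

Section cintegral.
Context d (T : measurableType d) (R : realType).
Variable mu : {measure set T -> \bar R}.
Local Notation C := (R[i]).
Implicit Types (f g : T -> C).

Definition cintegrable f :=
  mu.-integrable setT (fun x => (Re (f x))%:E) /\
  mu.-integrable setT (fun x => (Im (f x))%:E).

Definition cintegral f : C :=
  (\int[mu]_x Re (f x))%R +i* (\int[mu]_x Im (f x))%R.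

Lemma eq_cintegrable f g : f =1 g -> cintegrable f -> cintegrable g.
Proof. by move=> /funext ->. Qed.

Lemma cintegrable_measurable f : cintegrable f -> cmeasurable f.
Proof.
by move=> [/integrableP[/measurable_EFinP f1 _] /integrableP[/measurable_EFinP f2 _]].
Qed.

Lemma le_cintegrable f (g : T -> R) : cmeasurable f ->
  (forall x, normc (f x) <= g x) -> mu.-integrable setT (EFin \o g) ->
  cintegrable f.
Proof.
move=> [f1 f2] fg ig; split; apply: (le_integrable measurableT) ig.
- exact/measurable_EFinP.
- move=> x _; rewrite /= lee_fin (le_trans (Re_le_normc _))//.
  by rewrite (le_trans (fg _))// ler_norm.
- exact/measurable_EFinP.
- move=> x _; rewrite /= lee_fin (le_trans (Im_le_normc _))//.
  by rewrite (le_trans (fg _))// ler_norm.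
Qed.

(** The sum of the absolute components dominates the modulus by [normc_le], and serves as the
    standard integrable majorant of a complex function. *)
Lemma cintegrable_normc f : cintegrable f ->
  mu.-integrable setT (fun x => (`|Re (f x)| + `|Im (f x)|)%:E).
Proof.
move=> [f1 f2]; under eq_fun do rewrite EFinD.
by apply: integrableD => //; [exact: (integrable_abse f1)|exact: (integrable_abse f2)].
Qed.

Lemma cintegrable_real (f : T -> R) : mu.-integrable setT (EFin \o f) ->
  cintegrable (fun x => (f x)%:C).
Proof. by move=> if1; split => //=; exact: integrable0. Qed.

Lemma cintegral_real (f : T -> R) :
  cintegral (fun x => (f x)%:C) = (\int[mu]_x f x)%:C.
Proof.
by apply: complex_eq => //=; rewrite /Rintegral/= integral0.
Qed.

Lemma eq_cintegral f g : f =1 g -> cintegral f = cintegral g.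
Proof. by move=> /funext ->. Qed.

Lemma cintegrableD f g : cintegrable f -> cintegrable g ->
  cintegrable (fun x => f x + g x).
Proof.
move=> [f1 f2] [g1 g2]; split.
  by under eq_fun do rewrite cReD EFinD; exact: integrableD.
by under eq_fun do rewrite cImD EFinD; exact: integrableD.
Qed.

Lemma cintegralD f g : cintegrable f -> cintegrable g ->
  cintegral (fun x => f x + g x) = cintegral f + cintegral g.
Proof.
move=> [f1 f2] [g1 g2]; apply: complex_eq; rewrite !cReImE /=.
  by under eq_Rintegral do rewrite cReD; rewrite RintegralD.
by under eq_Rintegral do rewrite cImD; rewrite RintegralD.
Qed.

Lemma cintegrableZl (z : C) f : cintegrable f -> cintegrable (fun x => z * f x).
Proof.
move=> [f1 f2]; split.
  under eq_fun do rewrite cReM EFinB !EFinM.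
  by apply: integrableB => //; exact: integrableZl.
under eq_fun do rewrite cImM EFinD !EFinM.
by apply: integrableD => //; exact: integrableZl.
Qed.

Lemma cintegralZl (z : C) f : cintegrable f ->
  cintegral (fun x => z * f x) = z * cintegral f.
Proof.
move=> [f1 f2]; apply: complex_eq; rewrite !cReImE /=.
  under eq_Rintegral do rewrite cReM.
  rewrite RintegralB//; last 2 first.
    exact: integrableZl f1.
    exact: integrableZl f2.
  by rewrite !RintegralZl.
under eq_Rintegral do rewrite cImM.
rewrite RintegralD//; last 2 first.
  exact: integrableZl f2.
  exact: integrableZl f1.
by rewrite !RintegralZl.
Qed.

(** The factor 2 comes from estimating the two components separately; only the finiteness of the
    resulting bounds matters later. *)
Lemma le_cintegral f (g : T -> R) : cmeasurable f ->
  (forall x, normc (f x) <= g x) -> mu.-integrable setT (EFin \o g) ->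
  normc (cintegral f) <= 2 * \int[mu]_x g x.
Proof.
move=> mf fg ig; have [f1 f2] := le_cintegrable mf fg ig.
apply: (le_trans (normc_le _)); rewrite mulr_natl mulr2n lerD//=.
  apply: (le_trans (le_normr_Rintegral _ _)) => //.
  apply: le_Rintegral => //; first exact: (integrable_abse f1).
  by move=> x _; exact: le_trans (Re_le_normc _) (fg x).
apply: (le_trans (le_normr_Rintegral _ _)) => //.
apply: le_Rintegral => //; first exact: (integrable_abse f2).
by move=> x _; exact: le_trans (Im_le_normc _) (fg x).
Qed.

(** Componentwise, to match the limit taken in [GammaC]. *)
Definition ccvg (u : nat -> C) (l : C) :=
  (fun n => Re (u n)) @ \oo --> Re l /\ (fun n => Im (u n)) @ \oo --> Im l.

Lemma ccvg_unique u l l' : ccvg u l -> ccvg u l' -> l = l'.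
Proof.
move=> [u1 u2] [v1 v2]; apply: complex_eq.
  exact: (cvg_unique _ u1 v1).
exact: (cvg_unique _ u2 v2).
Qed.

Lemma ccvgM u v l l' : ccvg u l -> ccvg v l' -> ccvg (fun n => u n * v n) (l * l').
Proof.
move=> [u1 u2] [v1 v2]; split; rewrite !cReImE.
  under eq_fun do rewrite cReM.
  by apply: cvgB; apply: cvgM.
under eq_fun do rewrite cImM.
by apply: cvgD; apply: cvgM.
Qed.

Lemma ccvgD u v l l' : ccvg u l -> ccvg v l' -> ccvg (fun n => u n + v n) (l + l').
Proof.
move=> [u1 u2] [v1 v2]; split; rewrite !cReImE.
  by under eq_fun do rewrite cReD; exact: cvgD.
by under eq_fun do rewrite cImD; exact: cvgD.
Qed.

Lemma ccvg_real (q : nat -> R) (l : R) : q @ \oo --> l ->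
  ccvg (fun n => (q n)%:C) l%:C.
Proof. by move=> ql; split => //=; exact: cvg_cst. Qed.

Lemma ccvg_cst l : ccvg (fun=> l) l.
Proof. by split; exact: cvg_cst. Qed.

Lemma ccvg_exp u l : ccvg u l -> ccvg (fun n => cexp (u n)) (cexp l).
Proof.
move=> [u1 u2]; split.
  under eq_fun do rewrite Re_cexp.
  rewrite Re_cexp; apply: cvgM.
    by apply: continuous_cvg => //; exact: continuous_expR.
  by apply: continuous_cvg => //; exact: continuous_cos.
under eq_fun do rewrite Im_cexp.
rewrite Im_cexp; apply: cvgM.
  by apply: continuous_cvg => //; exact: continuous_expR.
by apply: continuous_cvg => //; exact: continuous_sin.
Qed.

Lemma Rdominated_cvg (f_ : nat -> T -> R) (f g : T -> R) :
  (forall n, measurable_fun setT (f_ n)) -> measurable_fun setT f ->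
  (forall x, f_ ^~ x @ \oo --> f x) ->
  mu.-integrable setT (EFin \o g) -> (forall n x, `|f_ n x| <= g x) ->
  (fun n => \int[mu]_x f_ n x)%R @ \oo --> (\int[mu]_x f x)%R.
Proof.
move=> mf_ mf ff ig fg.
have [||||i1 _ h] := @dominated_convergence _ _ _ mu setT measurableT
  (fun n x => (f_ n x)%:E) (EFin \o f) (EFin \o g) _ _ _ ig _.
- by move=> n; exact/measurable_EFinP.
- exact/measurable_EFinP.
- by apply: aeW => x _; apply: cvg_EFin; [exact: nearW|exact: ff].
- by apply: aeW => x n _; rewrite /= lee_fin.
apply: fine_cvg; rewrite fineK//; exact: integrable_fin_num.
Qed.

Lemma cdominated_cvg (f_ : nat -> T -> C) f (g : T -> R) :
  (forall n, cmeasurable (f_ n)) -> cmeasurable f ->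
  (forall x, ccvg (f_ ^~ x) (f x)) ->
  mu.-integrable setT (EFin \o g) -> (forall n x, normc (f_ n x) <= g x) ->
  ccvg (fun n => cintegral (f_ n)) (cintegral f).
Proof.
move=> mf_ [f1 f2] ff ig fg; split => /=.
  apply: (Rdominated_cvg (g := g)) => //.
  - by move=> n; have [] := mf_ n.
  - by move=> x; have [] := ff x.
  - by move=> n x; exact: le_trans (Re_le_normc _) (fg _ _).
apply: (Rdominated_cvg (g := g)) => //.
- by move=> n; have [] := mf_ n.
- by move=> x; have [] := ff x.
- by move=> n x; exact: le_trans (Im_le_normc _) (fg _ _).
Qed.

End cintegral.

(** * Fubini's theorem for complex integrands *)

Section cfubini.
Context d1 d2 (T1 : measurableType d1) (T2 : measurableType d2) (R : realType).
Variable m1 : {sigma_finite_measure set T1 -> \bar R}.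
Variable m2 : {sigma_finite_measure set T2 -> \bar R}.
Local Notation C := (R[i]).

Section real.
Variable f : T1 * T2 -> R.
Hypothesis If : (m1 \x m2)%E.-integrable setT (EFin \o f).

Let F x := (\int[m2]_y (f (x, y))%:E)%E.
Let G y := (\int[m1]_x (f (x, y))%:E)%E.

(** [Rintegral] turns an infinite inner integral into 0 through [fine]. Almost every section of an
    integrable function is integrable, so this alters the inner integral only on a null set. *)
Let fineF : {ae m1, forall x, setT x -> (fine (F x))%:E = F x}.
Proof.
apply: filterS (ae_integrable1 If) => x ix _.
by rewrite fineK//; exact: integrable_fin_num.
Qed.
Let fineG : {ae m2, forall x, setT x -> (fine (G x))%:E = G x}.
Proof.
apply: filterS (ae_integrable2 If) => x ix _.
by rewrite fineK//; exact: integrable_fin_num.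
Qed.
Let mF : measurable_fun setT F. Proof. exact: (measurable_fubini_F If). Qed.
Let mG : measurable_fun setT G. Proof. exact: (measurable_fubini_G If). Qed.
Let mfF : measurable_fun setT (fun x => (fine (F x))%:E).
Proof. by apply/measurable_EFinP; exact: measurableT_comp. Qed.
Let mfG : measurable_fun setT (fun x => (fine (G x))%:E).
Proof. by apply/measurable_EFinP; exact: measurableT_comp. Qed.

Lemma RFubini12 : (\int[m1]_x \int[m2]_y f (x, y) = \int[(m1 \x m2)%E]_z f z)%R.
Proof.
rewrite /Rintegral; congr fine.
by rewrite -(integral12_prod_meas1 If); exact: ae_eq_integral.
Qed.

Lemma RFubini21 : (\int[m2]_y \int[m1]_x f (x, y) = \int[(m1 \x m2)%E]_z f z)%R.
Proof.
rewrite /Rintegral; congr fine.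
by rewrite -(integral21_prod_meas1 If); exact: ae_eq_integral.
Qed.

Lemma integrable_Rintegral1 :
  m1.-integrable setT (fun x => (\int[m2]_y f (x, y))%R%:E).
Proof.
apply/integrableP; split; first exact: mfF.
have /integrableP[_] := integrable_fubini_F If; apply: le_lt_trans.
rewrite le_eqVlt; apply/orP; left; apply/eqP; apply: ae_eq_integral => //.
- exact: measurableT_comp.
- exact: measurableT_comp.
- by apply: filterS fineF => x h _; rewrite /= -[RHS]/(`|F x|%E) -(h I).
Qed.

End real.

Lemma cFubini (f : T1 * T2 -> C) : cintegrable (m1 \x m2)%E f ->
  cintegral m1 (fun x => cintegral m2 (fun y => f (x, y))) =
  cintegral m2 (fun y => cintegral m1 (fun x => f (x, y))).
Proof.
move=> [f1 f2]; apply: complex_eq => /=.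
  by rewrite (RFubini12 f1) -(RFubini21 f1).
by rewrite (RFubini12 f2) -(RFubini21 f2).
Qed.

Lemma cintegrable_cintegral1 (f : T1 * T2 -> C) : cintegrable (m1 \x m2)%E f ->
  cintegrable m1 (fun x => cintegral m2 (fun y => f (x, y))).
Proof.
by move=> [f1 f2]; split => /=; [exact: (integrable_Rintegral1 f1)|
  exact: (integrable_Rintegral1 f2)].
Qed.

Lemma integrable_tensor (g : T1 -> R) (h : T2 -> R) :
  m1.-integrable setT (EFin \o g) -> m2.-integrable setT (EFin \o h) ->
  (m1 \x m2)%E.-integrable setT (fun z => (g z.1 * h z.2)%:E).
Proof.
move=> ig ih.
have /integrableP[/measurable_EFinP mg Ig] := ig.
have /integrableP[/measurable_EFinP mh Ih] := ih.
apply/integrable12ltyP.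
  apply/measurable_EFinP; apply: measurable_funM.
    exact: (measurableT_comp mg).
  exact: (measurableT_comp mh).
under eq_integral.
  move=> x _.
  under eq_integral do rewrite /= normrM EFinM.
  rewrite ge0_integralZl//; last first.
    by apply/measurable_EFinP; exact: measurableT_comp.
  over.
rewrite ge0_integralZr//; last 2 first.
- by apply/measurable_EFinP; exact: measurableT_comp.
- exact: integral_ge0.
by rewrite lte_mul_pinfty// ?integral_ge0// ge0_fin_numE// integral_ge0.
Qed.

Lemma le_cintegrable_tensor (f : T1 * T2 -> C) (g : T1 -> R) (h : T2 -> R) :
  cmeasurable f -> (forall x y, normc (f (x, y)) <= g x * h y) ->
  m1.-integrable setT (EFin \o g) -> m2.-integrable setT (EFin \o h) ->
  cintegrable (m1 \x m2)%E f.
Proof.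
move=> mf fgh ig ih; apply: (le_cintegrable (g := fun z => g z.1 * h z.2)) => //.
  by move=> [x y]; exact: fgh.
exact: integrable_tensor.
Qed.

End cfubini.

(** * Integrals over the real line *)

Section real_line.
Variable R : realType.
Local Notation C := (R[i]).
Local Notation mu := (@lebesgue_measure R).

Lemma oneDsqrV_ge0 (x : R) : 0 <= (oneDsqr x)^-1.
Proof. by rewrite invr_ge0 (le_trans ler01) ?oneDsqr_ge1. Qed.

Lemma integrable_oneDsqrV (K : R) :
  mu.-integrable setT (EFin \o (fun x : R => K * (oneDsqr x)^-1)).
Proof.
have h : mu.-integrable setT (EFin \o (fun x : R => (oneDsqr x)^-1)).
  apply/integrableP; split.
    apply/measurable_EFinP; apply: continuous_measurable_fun.
    exact: continuous_oneDsqrV.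
  under eq_integral do rewrite /= ger0_norm ?oneDsqrV_ge0//.
  rewrite (ge0_symfun_integralT (f := fun x => (oneDsqr x)^-1)).
  - by rewrite -set_itvcy integral0y_oneDsqr -EFinM ltry.
  - exact: oneDsqrV_ge0.
  - exact: continuous_oneDsqrV.
  - by move=> x /=; rewrite /oneDsqr sqrrN.
exact: (integrableZl measurableT K h).
Qed.

Lemma Rintegral_oneDsqrV : (\int[mu]_x (oneDsqr x)^-1)%R = pi.
Proof.
rewrite /Rintegral (ge0_symfun_integralT (f := fun x => (oneDsqr x)^-1)).
- rewrite -set_itvcy integral0y_oneDsqr -EFinM /=.
  by rewrite mulrC divfK.
- exact: oneDsqrV_ge0.
- exact: continuous_oneDsqrV.
- by move=> x /=; rewrite /oneDsqr sqrrN.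
Qed.

(** With t = e |x| one has exp t >= (1 + t / 2)^2 >= 1 + t^2 / 4, and (1 + 4 / e^2) (1 + e^2 x^2 /
    4) expands to 1 + x^2 plus nonnegative terms. Integrability of exponential tails is thereby
    reduced to the arctangent integral. *)
Lemma expR_le_oneDsqrV (e x : R) : 0 < e ->
  expR (- (e * `|x|)) <= (1 + 4 / e ^+ 2) * (oneDsqr x)^-1.
Proof.
move=> e0; have o0 : 0 < oneDsqr x by rewrite (lt_le_trans ltr01)// oneDsqr_ge1.
have K0 : 0 < 1 + 4 / e ^+ 2 by rewrite addr_gt0// divr_gt0// exprn_gt0.
have h : 1 + (e * x) ^+ 2 / 4 <= expR (e * `|x|).
  have -> : expR (e * `|x|) = expR (e * `|x| / 2) ^+ 2.
    by rewrite -expRM_natl; congr expR; field.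
  have t0 : 0 <= e * `|x| / 2 by rewrite divr_ge0// mulr_ge0// ltW.
  apply: (@le_trans _ _ ((1 + e * `|x| / 2) ^+ 2)).
    have -> : (e * x) ^+ 2 = (e * `|x|) ^+ 2.
      by rewrite !exprMn real_normK// num_real.
    have := mulr_ge0 (ltW e0) (normr_ge0 x); nra.
  by rewrite lerXn2r ?nnegrE ?expR_ge0 ?expR_ge1Dx// addr_ge0.
rewrite ler_pdivlMr// expRN mulrC ler_pdivrMr ?expR_gt0//.
apply: (@le_trans _ _ ((1 + 4 / e ^+ 2) * (1 + (e * x) ^+ 2 / 4))); last first.
  by rewrite ler_pM2l.
have -> : (1 + 4 / e ^+ 2) * (1 + (e * x) ^+ 2 / 4) =
    oneDsqr x + (4 / e ^+ 2 + (e * x) ^+ 2 / 4).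
  by rewrite /oneDsqr; field; rewrite gt_eqF.
by rewrite lerDl addr_ge0// divr_ge0 ?sqr_ge0.
Qed.

Lemma integrable_expRN_norm (e : R) : 0 < e ->
  mu.-integrable setT (EFin \o (fun x : R => expR (- (e * `|x|)))).
Proof.
move=> e0; apply: (le_integrable measurableT) (integrable_oneDsqrV (1 + 4 / e ^+ 2)).
  apply/measurable_EFinP; apply: measurableT_comp => //.
  apply: measurableT_comp => //; exact: measurable_funM.
move=> x _ /=; rewrite lee_fin ger0_norm ?expR_ge0//.
by rewrite (le_trans (expR_le_oneDsqrV x e0))// ler_norm.
Qed.

Lemma ge0_integral_affine (f : R -> R) (a b : R) : 0 < a -> continuous f ->
  (forall x, 0 <= f x) ->
  (\int[mu]_x (f x)%:E = \int[mu]_x (f (a * x + b) * a)%:E)%E.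
Proof.
move=> a0 cf f0; pose F x := a * x + b.
have dF (x : R) : is_derive x 1 F a.
  by apply: is_derive_eq; rewrite /= addr0 /GRing.scale/= mulr1.
have F'E : F^`() = cst a by apply/funext => x; rewrite derive1E; apply: derive_val.
rewrite (@increasing_ge0_integration_by_substitutionT _ F)//.
- by rewrite F'E.
- by move=> x y xy; rewrite /F ltrD2r ltr_pM2l.
- by rewrite F'E => x; exact: cvg_cst.
- by rewrite F'E; exact: is_cvg_cst.
- by rewrite F'E; exact: is_cvg_cst.
- apply/cvgrNyPle => A; near=> x; rewrite /F -lerBrDr -ler_pdivlMl//.
- apply/cvgryPge => A; near=> x; rewrite /F -lerBlDr -ler_pdivrMl//.
Unshelve. all: by end_near. Qed.

Lemma integral_affine (f : R -> R) (a b : R) : 0 < a -> continuous f ->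
  (\int[mu]_x (f x)%:E = \int[mu]_x (f (a * x + b) * a)%:E)%E.
Proof.
move=> a0 cf; rewrite [LHS]integralE [RHS]integralE; congr (_ - _)%E.
  rewrite !funerpos [LHS](ge0_integral_affine b a0)//.
  - apply: eq_integral => x _ /=; congr (_%:E); rewrite /funrpos.
    by rewrite maxr_pMl ?mul0r// ltW.
  - by move=> x; apply: continuous_max; [exact: cf|exact: cvg_cst].
rewrite !funerneg [LHS](ge0_integral_affine b a0)//.
- apply: eq_integral => x _ /=; congr (_%:E); rewrite /funrneg.
  by rewrite maxr_pMl ?mul0r ?mulNr// ltW.
- move=> x; apply: (@continuous_max _ _ (fun x => - f x) (fun=> 0)).
    by apply: cvgN; exact: cf.
  exact: cvg_cst.
Qed.

Definition ccontinuous (f : R -> C) :=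
  continuous (fun x => Re (f x)) /\ continuous (fun x => Im (f x)).

Lemma eq_ccontinuous (f g : R -> C) : f =1 g -> ccontinuous f -> ccontinuous g.
Proof. by move=> /funext ->. Qed.

Lemma ccontinuous_cst (z : C) : ccontinuous (fun=> z).
Proof. by split=> x; exact: cvg_cst. Qed.
Lemma ccontinuous_real (f : R -> R) : continuous f ->
  ccontinuous (fun x => (f x)%:C).
Proof. by move=> cf; split=> /= x; [exact: cf|exact: cvg_cst]. Qed.
Lemma ccontinuousD (f g : R -> C) : ccontinuous f -> ccontinuous g ->
  ccontinuous (fun x => f x + g x).
Proof.
move=> [f1 f2] [g1 g2]; split=> x.
  by under eq_fun do rewrite cReD; apply: continuousD; [exact: f1|exact: g1].
by under eq_fun do rewrite cImD; apply: continuousD; [exact: f2|exact: g2].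
Qed.
Lemma ccontinuousM (f g : R -> C) : ccontinuous f -> ccontinuous g ->
  ccontinuous (fun x => f x * g x).
Proof.
move=> [f1 f2] [g1 g2]; split=> x.
  under eq_fun do rewrite cReM.
  by apply: cvgB; apply: cvgM; [exact: f1|exact: g1|exact: f2|exact: g2].
under eq_fun do rewrite cImM.
by apply: cvgD; apply: cvgM; [exact: f1|exact: g2|exact: f2|exact: g1].
Qed.
Lemma ccontinuous_exp (f : R -> C) : ccontinuous f ->
  ccontinuous (fun x => cexp (f x)).
Proof.
move=> [f1 f2]; split=> x.
  under eq_fun do rewrite Re_cexp.
  by apply: cvgM; apply: continuous_cvg;
    [exact: continuous_expR|exact: f1|exact: continuous_cos|exact: f2].
under eq_fun do rewrite Im_cexp.
by apply: cvgM; apply: continuous_cvg;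
  [exact: continuous_expR|exact: f1|exact: continuous_sin|exact: f2].
Qed.
Lemma ccontinuous_measurable (f : R -> C) : ccontinuous f -> cmeasurable f.
Proof. by move=> [f1 f2]; split; exact: continuous_measurable_fun. Qed.

Lemma cintegral_affine (f : R -> C) (a b : R) : 0 < a -> ccontinuous f ->
  cintegral mu f = cintegral mu (fun x => f (a * x + b) * a%:C).
Proof.
move=> a0 [f1 f2]; apply: complex_eq => /=; rewrite /Rintegral.
  under [in RHS]eq_integral do rewrite cReM/= mulr0 subr0.
  by rewrite (integral_affine b a0).
under [in RHS]eq_integral do rewrite cImM/= mulr0 add0r.
by rewrite (integral_affine b a0).
Qed.

Lemma cintegral_shift (f : R -> C) (b : R) : ccontinuous f ->
  cintegral mu (fun x => f (x + b)) = cintegral mu f.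
Proof.
move=> cf; rewrite (cintegral_affine b ltr01 cf); apply: eq_cintegral => x.
by rewrite mul1r mulr1.
Qed.

Definition is_cderive (x : R) (F : R -> C) (z : C) :=
  is_derive x 1 (fun y => Re (F y)) (Re z) /\ is_derive x 1 (fun y => Im (F y)) (Im z).

Lemma is_cderive_real (x : R) (f : R -> R) (d : R) : is_derive x 1 f d ->
  is_cderive x (fun y => (f y)%:C) d%:C.
Proof. by move=> df; split => //=; exact: is_derive_cst. Qed.
Lemma is_cderive_cst (x : R) (z : C) : is_cderive x (fun=> z) 0.
Proof. by split; exact: is_derive_cst. Qed.
Lemma is_cderiveD x F G z w : is_cderive x F z -> is_cderive x G w ->
  is_cderive x (fun y => F y + G y) (z + w).
Proof.
move=> [f1 f2] [g1 g2]; split; rewrite ?cReD ?cImD.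
  by under eq_fun do rewrite cReD; exact: is_deriveD.
by under eq_fun do rewrite cImD; exact: is_deriveD.
Qed.
Lemma is_cderiveM x F G z w : is_cderive x F z -> is_cderive x G w ->
  is_cderive x (fun y => F y * G y) (z * G x + F x * w).
Proof.
move=> [f1 f2] [g1 g2]; split; rewrite !cReImE.
  under eq_fun do rewrite cReM.
  by apply: is_derive_eq; rewrite /GRing.scale/=; ring.
under eq_fun do rewrite cImM.
by apply: is_derive_eq; rewrite /GRing.scale/=; ring.
Qed.
Lemma is_cderive_exp x F z : is_cderive x F z ->
  is_cderive x (fun y => cexp (F y)) (z * cexp (F x)).
Proof.
move=> [f1 f2].
have e1 : is_derive x 1 (fun y => expR (Re (F y))) (expR (Re (F x)) * Re z).
  exact: is_derive1_comp.
have c1 : is_derive x 1 (fun y => cos (Im (F y))) (- sin (Im (F x)) * Im z).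
  exact: is_derive1_comp.
have s1 : is_derive x 1 (fun y => sin (Im (F y))) (cos (Im (F x)) * Im z).
  exact: is_derive1_comp.
split; rewrite !cReImE ?Re_cexp ?Im_cexp.
  under eq_fun do rewrite Re_cexp.
  by apply: is_derive_eq; rewrite /GRing.scale/=; ring.
under eq_fun do rewrite Im_cexp.
by apply: is_derive_eq; rewrite /GRing.scale/=; ring.
Qed.

End real_line.

(** * The fundamental theorem of calculus on the whole line, and the Poisson kernel *)

Section FTC.
Variable R : realType.
Local Notation C := (R[i]).
Local Notation mu := (@lebesgue_measure R).

Lemma FTC2_Rintegral (F f : R -> R) (a b : R) : a < b ->
  (forall x : R, is_derive x 1 F (f x)) -> continuous f ->
  (\int[mu]_(x in `[a, b]) f x)%R = F b - F a.
Proof.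
move=> ab dF cf; have cF : continuous F.
  move=> x; apply/differentiable_continuous/derivable1_diffP.
  by have [] := dF x.
rewrite /Rintegral (@continuous_FTC2 _ _ F _ _ ab) //.
- exact: continuous_subspaceT.
- split => [x _| |]; first by have [] := dF x.
  + by apply: cvg_at_right_filter; exact: cF.
  + by apply: cvg_at_left_filter; exact: cF.
- by move=> x _; rewrite derive1E; apply: derive_val.
Qed.

Lemma cvg_Rintegral_itv (f : R -> R) : mu.-integrable setT (EFin \o f) ->
  (fun n : nat => \int[mu]_(x in `[- n.+1%:R, n.+1%:R]) f x)%R @ \oo -->
  (\int[mu]_x f x)%R.
Proof.
move=> If; have /integrableP[/measurable_EFinP mf _] := If.
under eq_fun do rewrite Rintegral_mkcond.
apply: (@Rdominated_cvg _ _ R mu (fun n : nat => f \_ `[- n.+1%:R, n.+1%:R]) f (fun x : R => `|f x|)) => //.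
- move=> n; apply/(measurable_restrictT _ _).1 => //.
  exact: measurable_funTS.
- move=> x; apply: cvg_near_cst; near=> n; rewrite patchE mem_set//=.
  rewrite in_itv/= -ler_norml; near: n.
  exists `|Num.trunc `|x| |%N => // n /= h.
  rewrite (le_trans (ltW (truncnS_gt _)))// ler_nat ltnS.
  by rewrite (leq_trans _ h)//.
- exact: (integrable_abse If).
- move=> n x; rewrite patchE; case: ifP => // _; by rewrite normr0.
Unshelve. all: by end_near. Qed.

(** One primitive for each half-line, so that an integrand with a kink at 0, such as exp (- e |y|),
    is covered. Smooth integrands take the same primitive twice. *)
Lemma FTC_line (F1 F2 f1 f2 f : R -> R) (l1 l2 : R) :
  (forall x : R, is_derive x 1 F1 (f1 x)) -> continuous f1 ->
  (forall x : R, is_derive x 1 F2 (f2 x)) -> continuous f2 ->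
  (forall x : R, 0 <= x -> f x = f1 x) -> (forall x : R, x <= 0 -> f x = f2 x) ->
  mu.-integrable setT (EFin \o f) ->
  (fun n : nat => F1 n.+1%:R) @ \oo --> l1 ->
  (fun n : nat => F2 (- n.+1%:R)) @ \oo --> l2 ->
  (\int[mu]_x f x)%R = (l1 - F1 0) + (F2 0 - l2).
Proof.
move=> d1 c1 d2 c2 e1 e2 If F1l F2l.
have := cvg_Rintegral_itv If.
have -> : (fun n : nat => \int[mu]_(x in `[- n.+1%:R, n.+1%:R]) f x)%R =
    (fun n => (F1 n.+1%:R - F1 0) + (F2 0 - F2 (- n.+1%:R))).
  apply/funext => n.
  have n0 : 0 < n.+1%:R :> R by [].
  have In (i : interval R) : mu.-integrable [set` i] (EFin \o f).
    exact: (integrableS measurableT).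
  have := @Rintegral_itvB R f (BLeft (- n.+1%:R)) (BRight n.+1%:R) 0 (In _).
  rewrite !bnd_simp oppr_le0 => /(_ (ltW n0) (ltW n0)) /eqP.
  rewrite subr_eq => /eqP ->.
  rewrite Rintegral_itv_obnd_cbnd//; congr (_ + _).
    rewrite -FTC2_Rintegral//; apply: eq_Rintegral => x; rewrite inE/= in_itv/=.
    by move=> /andP[/e1].
  rewrite -FTC2_Rintegral ?oppr_lt0//; apply: eq_Rintegral => x; rewrite inE/= in_itv/=.
  by move=> /andP[_ /e2].
move=> h; apply: (cvg_unique _ h) => //.
by apply: cvgD; apply: cvgB => //; exact: cvg_cst.
Qed.

Lemma cFTC_line (F1 F2 f1 f2 f : R -> C) (l1 l2 : C) :
  (forall x, is_cderive x F1 (f1 x)) -> ccontinuous f1 ->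
  (forall x, is_cderive x F2 (f2 x)) -> ccontinuous f2 ->
  (forall x : R, 0 <= x -> f x = f1 x) -> (forall x : R, x <= 0 -> f x = f2 x) ->
  cintegrable mu f ->
  ccvg (fun n : nat => F1 n.+1%:R) l1 ->
  ccvg (fun n : nat => F2 (- n.+1%:R)) l2 ->
  cintegral mu f = (l1 - F1 0) + (F2 0 - l2).
Proof.
move=> d1 [c1 c1'] d2 [c2 c2'] e1 e2 [If If'] [l1l l1l'] [l2l l2l'].
apply: complex_eq; rewrite !cReImE /=.
  apply: (@FTC_line (fun x => Re (F1 x)) (fun x => Re (F2 x)) (fun x => Re (f1 x)) (fun x => Re (f2 x))) => //.
  - by move=> x; have [] := d1 x.
  - by move=> x; have [] := d2 x.
  - by move=> x /e1 ->.
  - by move=> x /e2 ->.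
apply: (@FTC_line (fun x => Im (F1 x)) (fun x => Im (F2 x)) (fun x => Im (f1 x)) (fun x => Im (f2 x))) => //.
- by move=> x; have [] := d1 x.
- by move=> x; have [] := d2 x.
- by move=> x /e1 ->.
- by move=> x /e2 ->.
Qed.

Lemma ccvg_norm0 (u : nat -> C) (v : nat -> R) :
  (forall n, normc (u n) <= v n) -> v @ \oo --> 0 -> ccvg u 0.
Proof.
move=> uv v0; split => /=.
  apply: (@squeeze_cvgr _ _ _ _ (fun n => - v n) v) => //.
    apply: nearW => n; rewrite -ler_norml.
    exact: le_trans (Re_le_normc _) (uv n).
  by rewrite -oppr0; exact: cvgN.
apply: (@squeeze_cvgr _ _ _ _ (fun n => - v n) v) => //.
  apply: nearW => n; rewrite -ler_norml.
  exact: le_trans (Im_le_normc _) (uv n).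
by rewrite -oppr0; exact: cvgN.
Qed.

Lemma cvg_expRN (K e : R) : 0 < e ->
  (fun n : nat => K * expR (- (e * n.+1%:R))) @ \oo --> (0 : R).
Proof.
move=> e0; rewrite -(mulr0 K); apply: cvgMr.
have /cvg_pinftyP := @cvgr_expR R; apply.
apply/cvgryPge => A; near=> n; rewrite mulrC -ler_pdivrMr//; near: n.
exists `|Num.trunc (A / e)|%N => // n /= h.
by rewrite (le_trans (ltW (truncnS_gt _)))// ler_nat ltnS.
Unshelve. all: by end_near. Qed.

Lemma ccvg_decay (F : R -> C) (K e : R) : 0 < e ->
  (forall x, normc (F x) <= K * expR (- (e * `|x|))) ->
  ccvg (fun n : nat => F n.+1%:R) 0 /\ ccvg (fun n : nat => F (- n.+1%:R)) 0.
Proof.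
move=> e0 h; split; apply: (ccvg_norm0 _ (cvg_expRN K e0)) => n;
  rewrite (le_trans (h _))// ?normrN ger0_norm//.
Qed.

(** The right-hand side is 2 pi times the Poisson kernel of width [e]: it concentrates at x = 0 as
    [e] tends to 0 and is the approximate identity behind [fourier_inversion]. *)
Lemma cintegral_kernel (e x : R) : 0 < e ->
  cintegral mu (fun y => cexp ('i * (x * y)%:C - (e * `|y|)%:C)) =
  (2 * e / (e ^+ 2 + x ^+ 2))%:C.
Proof.
move=> e0.
set z1 : C := 'i * x%:C - e%:C; set z2 : C := 'i * x%:C + e%:C.
have z1E : z1 = (- e) +i* x by apply: complex_eq; rewrite /z1 !cReImE /=; ring.
have z2E : z2 = e +i* x by apply: complex_eq; rewrite /z2 !cReImE /=; ring.
have z10 : z1 != 0 by rewrite z1E eq_complex /= negb_and oppr_eq0 gt_eqF.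
have z20 : z2 != 0 by rewrite z2E eq_complex /= negb_and gt_eqF.
have dE (z : C) (y : R) : z != 0 ->
    is_cderive y (fun y => z^-1 * cexp (z * y%:C)) (cexp (z * y%:C)).
  move=> z0.
  have h1 : is_cderive y (fun y : R => y%:C : C) 1.
    by apply: is_cderive_real; exact: is_derive_id.
  have h2 := is_cderiveM (is_cderive_cst y z) h1.
  have h3 := is_cderiveM (is_cderive_cst y z^-1) (is_cderive_exp h2).
  by move: h3; rewrite !mul0r !add0r mulr1 mulrA mulVf// mul1r.
have cE (z : C) : ccontinuous (fun y : R => cexp (z * y%:C)).
  apply: ccontinuous_exp; apply: ccontinuousM; first exact: ccontinuous_cst.
  by apply: ccontinuous_real => y; exact: cvg_id.
have e1 (y : R) : 0 <= y -> cexp ('i * (x * y)%:C - (e * `|y|)%:C) = cexp (z1 * y%:C).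
  move=> y0; congr cexp; rewrite ger0_norm// z1E.
  by apply: complex_eq; rewrite !cReImE /=; ring.
have e2 (y : R) : y <= 0 -> cexp ('i * (x * y)%:C - (e * `|y|)%:C) = cexp (z2 * y%:C).
  move=> y0; congr cexp; rewrite ler0_norm// z2E.
  by apply: complex_eq; rewrite !cReImE /=; ring.
have nE (y : R) : normc (cexp ('i * (x * y)%:C - (e * `|y|)%:C)) = expR (- (e * `|y|)).
  by rewrite normc_cexp !cReImE /=; congr expR; ring.
rewrite (@cFTC_line _ _ _ _ _ 0 0 (fun y => dE z1 y z10) (cE _)
  (fun y => dE z2 y z20) (cE _) e1 e2).
- rewrite !mulr0 cexp0 !mulr1 sub0r subr0 -invrN.
  have -> : - z1 = e -i* x by rewrite z1E; apply: complex_eq => /=; rewrite ?opprK.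
  rewrite z2E; apply: complex_eq => /=; rewrite ?sqrrN; field.
    by rewrite gt_eqF// ltr_wpDr ?sqr_ge0 ?exprn_gt0.
  by rewrite gt_eqF// ltr_wpDr ?sqr_ge0 ?exprn_gt0.
- apply: (@le_cintegrable _ _ R mu _ (fun y : R => expR (- (e * `|y|)))).
  + apply: cmeasurable_exp; apply: cmeasurableB.
      apply: cmeasurableM; first exact: cmeasurable_cst.
      by apply: cmeasurable_real; exact: measurable_funM.
    by apply: cmeasurable_real; apply: measurable_funM.
  + by move=> y; rewrite nE.
  + exact: integrable_expRN_norm.
- apply: (ccvg_norm0 _ (cvg_expRN (normc z1^-1) e0)) => n.
  rewrite ComplexField.Normc.normcM ler_wpM2l ?normc_ge0//.
  by rewrite -e1// nE ger0_norm.
- apply: (ccvg_norm0 _ (cvg_expRN (normc z2^-1) e0)) => n.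
  rewrite ComplexField.Normc.normcM ler_wpM2l ?normc_ge0//.
  by rewrite -e2 ?oppr_le0// nE normrN ger0_norm.
Qed.

End FTC.

Opaque cexp.

(** * Fourier inversion *)

Section fourier.
Variable R : realType.
Local Notation C := (R[i]).
Local Notation mu := (@lebesgue_measure R).

Lemma normcMM (a b c d : C) :
  normc ((a * b) * (c * d)) = (normc a * normc b) * (normc c * normc d).
Proof. by rewrite ComplexField.Normc.normcM (ComplexField.Normc.normcM a) (ComplexField.Normc.normcM c). Qed.

Lemma normc_cexp_i (x : R) : normc (cexp ('i * x%:C : C)) = 1.
Proof. by rewrite normc_cexp !cReImE /= !mul0r mulr0 subrr expR0. Qed.

Lemma normcM_cexpNi (z : C) (x : R) : normc (z * cexp (- ('i * x%:C))) = normc z.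
Proof.
by rewrite ComplexField.Normc.normcM -mulrN -rmorphN normc_cexp_i mulr1.
Qed.

Lemma cmeasurable_cexp_i d (T : measurableType d) (f : T -> R) :
  measurable_fun setT f -> cmeasurable (fun x => cexp ('i * (f x)%:C : C)).
Proof.
move=> mf; apply: cmeasurable_exp; apply: cmeasurableM.
  exact: cmeasurable_cst.
exact: cmeasurable_real.
Qed.

Lemma measurable_funT_expR_norm : measurable_fun setT (fun y : R => expR `|y|).
Proof. exact: measurableT_comp. Qed.

(** An integrable [f] times a character is not integrable in the pair (y, v). The weight exp (- |y|)
    makes it so; Fubini then gives measurability of the weighted transform, and multiplication by
    exp |y| removes the weight. *)
Lemma cmeasurable_fourier (f : R -> C) : cintegrable mu f ->
  cmeasurable (fun y : R => cintegral mu (fun v : R => cexp ('i * (y * v)%:C) * f v)).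
Proof.
move=> If; have mf := cintegrable_measurable If.
have Ie (y : R) : cintegrable mu (fun v : R => cexp ('i * (y * v)%:C) * f v).
  apply: (@le_cintegrable _ _ R mu _ (fun v : R => `|Re (f v)| + `|Im (f v)|)).
  - apply: cmeasurableM => //; apply: cmeasurable_cexp_i; exact: measurable_funM.
  - by move=> v; rewrite ComplexField.Normc.normcM normc_cexp_i mul1r normc_le.
  - exact: cintegrable_normc.
pose H (p : R * R) : C := (expR (- (1 * `|p.1|)))%:C * (cexp ('i * (p.1 * p.2)%:C) * f p.2).
have me : measurable_fun setT (fun y : R => expR (- (1 * `|y|))).
  apply: measurableT_comp => //; apply: measurableT_comp => //.
  exact: measurable_funM.
have IH : cintegrable (mu \x mu)%E H.
  apply: (@le_cintegrable_tensor _ _ _ _ R mu mu H (fun y : R => expR (- (1 * `|y|)))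
    (fun v : R => `|Re (f v)| + `|Im (f v)|)).
  - apply: cmeasurableM.
      exact: (cmeasurable_comp (phi := fst) measurable_fst (cmeasurable_real me)).
    apply: cmeasurableM; last exact: (cmeasurable_comp (phi := snd) measurable_snd mf).
    by apply: cmeasurable_cexp_i; exact: measurable_funM.
  - move=> y v; rewrite /H -[X in X * _]mul1r normcMM normcR normc_cexp_i mul1r.
    rewrite (_ : normc 1 = 1) ?mul1r; last by rewrite -[1]/(1%:C) normcR normr1.
    by rewrite ger0_norm ?expR_ge0//= ler_wpM2l ?expR_ge0// normc_le.
  - exact: integrable_expRN_norm.
  - exact: cintegrable_normc.
have := cmeasurableM (cmeasurable_real (measurable_funT_expR_norm))
  (cintegrable_measurable (cintegrable_cintegral1 IH)).
apply: eq_cmeasurable => y; rewrite /H /= cintegralZl// mulrA -rmorphM /=.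
by rewrite -expRD mul1r subrr expR0 mul1r.
Qed.

(** The outer integral is damped by exp (- |y| / (n + 1)). Removing the damping recovers the
    left-hand side, while Fubini turns the damped integral into [f] integrated against a Poisson
    kernel centred at [v0]. Both limits are computed along the same sequence and compared. *)
Lemma fourier_inversion (f : R -> C) (M v0 : R) :
  ccontinuous f -> (forall v, normc (f v) <= M) -> cintegrable mu f ->
  let F := fun y : R => cintegral mu (fun v : R => cexp ('i * (y * v)%:C) * f v) in
  cintegrable mu F ->
  cintegral mu (fun y : R => F y * cexp (- ('i * (y * v0)%:C))) =
  (2 * pi)%:C * f v0.
Proof.
move=> cf fM If F IF.
have mf := cintegrable_measurable If.
have mF := cintegrable_measurable IF.
have eps0 n : 0 < n.+1%:R^-1 :> R by rewrite invr_gt0.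
have mi (a : R) : cmeasurable (fun y : R => cexp (- ('i * (y * a)%:C : C))).
  under eq_fun do rewrite -mulrN -rmorphN.
  by apply: cmeasurable_cexp_i; apply: measurableT_comp => //; exact: measurable_funM.
have ni (x : R) : normc (cexp (- ('i * x%:C : C))) = 1.
  by rewrite -mulrN -rmorphN; exact: normc_cexp_i.
have me n : measurable_fun setT (fun y : R => - (n.+1%:R^-1 * `|y|)).
  by apply: measurableT_comp => //; exact: measurable_funM.
have mr n : cmeasurable (fun y : R => (expR (- (n.+1%:R^-1 * `|y|)))%:C : C).
  by apply: cmeasurable_real; apply: measurableT_comp => //; exact: me.
pose A n := cintegral mu (fun y : R =>
  F y * cexp (- ('i * (y * v0)%:C)) * (expR (- (n.+1%:R^-1 * `|y|)))%:C).
have lim1 : ccvg A (cintegral mu (fun y : R => F y * cexp (- ('i * (y * v0)%:C)))).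
  apply: (@cdominated_cvg _ _ R mu _ _ (fun y : R => `|Re (F y)| + `|Im (F y)|)).
  - move=> n; apply: cmeasurableM; last exact: mr.
    by apply: cmeasurableM => //; exact: mi.
  - by apply: cmeasurableM => //; exact: mi.
  - move=> y; rewrite -[X in ccvg _ X]mulr1; apply: ccvgM; first exact: ccvg_cst.
    split => /=; last exact: cvg_cst.
    rewrite -[X in _ --> X]expR0; apply: continuous_cvg; first exact: continuous_expR.
    rewrite -[X in _ --> X]oppr0; apply: cvgN.
    rewrite -[X in _ --> X](mul0r `|y|); apply: cvgMl.
    exact: cvg_harmonic.
  - exact: cintegrable_normc.
  - move=> n y; rewrite 2!ComplexField.Normc.normcM ni mulr1 normcR.
    rewrite -[leRHS]mulr1 ler_pM ?normc_ge0//; first exact: normc_le.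
    by rewrite ger0_norm ?expR_ge0// -expR0 ler_expR oppr_le0 mulr_ge0// ltW.
(* The rescaling v = w / (n + 1) + v0 moves the dependence on n from the kernel into the argument of
   [f]. Continuity at [v0] gives the pointwise limit, and the bound [M] on [f] gives the
   majorant. *)
pose B n := cintegral mu (fun w : R =>
  f (n.+1%:R^-1 * w + v0) * (2 * (oneDsqr w)^-1)%:C).
have lim2 : ccvg B ((2 * pi)%:C * f v0).
  have -> : (2 * pi)%:C * f v0 =
      cintegral mu (fun w : R => f v0 * (2 * (oneDsqr w)^-1)%:C).
    rewrite cintegralZl; last by apply: cintegrable_real; exact: integrable_oneDsqrV.
    rewrite cintegral_real RintegralZl//; last first.
      have := @integrable_oneDsqrV R 1.
      by congr (_.-integrable _ _); apply/funext => x /=; rewrite mul1r.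
    by rewrite Rintegral_oneDsqrV mulrC.
  have [cf1 cf2] := cf.
  apply: (@cdominated_cvg _ _ R mu _ _ (fun w : R => (M * 2) * (oneDsqr w)^-1)).
  - move=> n; apply: cmeasurableM.
      apply: (cmeasurable_comp (phi := fun w : R => n.+1%:R^-1 * w + v0)) mf.
      by apply: measurable_funD => //; exact: measurable_funM.
    apply: cmeasurable_real; apply: measurable_funM => //.
    by apply: continuous_measurable_fun; exact: continuous_oneDsqrV.
  - apply: cmeasurableM; first exact: cmeasurable_cst.
    apply: cmeasurable_real; apply: measurable_funM => //.
    by apply: continuous_measurable_fun; exact: continuous_oneDsqrV.
  - move=> w; apply: ccvgM; last exact: ccvg_cst.
    have h : (fun n : nat => n.+1%:R^-1 * w + v0) @ \oo --> v0.
      rewrite -[X in _ --> X]add0r -(mul0r w); apply: cvgD; last exact: cvg_cst.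
      by apply: cvgMl; exact: cvg_harmonic.
    by split; [exact: (continuous_cvg _ (cf1 v0) h)|exact: (continuous_cvg _ (cf2 v0) h)].
  - exact: integrable_oneDsqrV.
  - move=> n w; rewrite ComplexField.Normc.normcM normcR ger0_norm; last first.
      by rewrite mulr_ge0// oneDsqrV_ge0.
    by rewrite -mulrA ler_pM ?normc_ge0.
suff AB n : A n = B n.
  by apply: ccvg_unique lim1 _; rewrite (_ : A = B)//; exact/funext.
rewrite /A /B; set e := n.+1%:R^-1; have e0 : 0 < e := eps0 n.
pose H (p : R * R) : C := (cexp (- ('i * (p.1 * v0)%:C)) * (expR (- (e * `|p.1|)))%:C) *
  (cexp ('i * (p.1 * p.2)%:C) * f p.2).
have IH : cintegrable (mu \x mu)%E H.
  apply: (@le_cintegrable_tensor _ _ _ _ R mu mu H (fun y : R => expR (- (e * `|y|)))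
    (fun v : R => `|Re (f v)| + `|Im (f v)|)).
  - apply: cmeasurableM.
      apply: cmeasurableM.
        exact: (cmeasurable_comp (phi := fst) measurable_fst (mi v0)).
      exact: (cmeasurable_comp (phi := fst) measurable_fst (mr n)).
    apply: cmeasurableM; last exact: (cmeasurable_comp (phi := snd) measurable_snd mf).
    apply: cmeasurable_cexp_i; apply: measurable_funM => //.
  - move=> y v; rewrite /H normcMM ni normc_cexp_i !mul1r normcR.
    by rewrite ger0_norm ?expR_ge0//= ler_wpM2l ?expR_ge0// normc_le.
  - exact: integrable_expRN_norm.
  - exact: cintegrable_normc.
transitivity (cintegral mu (fun y : R => cintegral mu (fun v : R => H (y, v)))).
  apply: eq_cintegral => y; rewrite /H /= cintegralZl; first by rewrite /F; ring.
  apply: (@le_cintegrable _ _ R mu _ (fun v : R => `|Re (f v)| + `|Im (f v)|)).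
  - apply: cmeasurableM => //; apply: cmeasurable_cexp_i; exact: measurable_funM.
  - by move=> v; rewrite ComplexField.Normc.normcM normc_cexp_i mul1r normc_le.
  - exact: cintegrable_normc.
rewrite (cFubini IH).
(* After the exchange, the y-integral for fixed v is [cintegral_kernel] at v - v0. *)
transitivity (cintegral mu (fun v : R => f v * (2 * e / (e ^+ 2 + (v - v0) ^+ 2))%:C)).
  apply: eq_cintegral => v; rewrite -(cintegral_kernel (v - v0) e0) -cintegralZl.
    apply: eq_cintegral => y; rewrite /H.
    have -> : cexp ('i * ((v - v0) * y)%:C - (e * `|y|)%:C) = cexp (- ('i * (y * v0)%:C)) *
        (expR (- (e * `|y|)))%:C * cexp ('i * (y * v)%:C).
      by rewrite -cexpR -!cexpD !rmorphM rmorphB rmorphN rmorphM; congr cexp; ring.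
    by rewrite /=; ring.
  apply: (@le_cintegrable _ _ R mu _ (fun y : R => expR (- (e * `|y|)))).
  - apply: cmeasurable_exp; apply: cmeasurableB.
      apply: cmeasurableM; first exact: cmeasurable_cst.
      by apply: cmeasurable_real; exact: measurable_funM.
    by apply: cmeasurable_real; apply: measurable_funM.
  - by move=> y; rewrite cexpD ComplexField.Normc.normcM normc_cexp_i mul1r -rmorphN cexpR normcR ger0_norm ?expR_ge0.
  - exact: integrable_expRN_norm.
rewrite (cintegral_affine v0 e0).
  apply: eq_cintegral => w; rewrite -mulrA -rmorphM/=; congr (_ * _%:C).
  rewrite addrK /oneDsqr exprMn; field.
  have h : 0 < 1 + w ^+ 2 by rewrite ltr_pwDl// sqr_ge0.
  by rewrite !gt_eqF// ltr_pwDl ?exprn_gt0 ?sqr_ge0.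
apply: ccontinuousM => //; apply: ccontinuous_real => v.
apply: cvgM; first exact: cvg_cst.
apply: cvgV.
  by rewrite gt_eqF// ltr_pwDl ?sqr_ge0// exprn_gt0.
apply: cvgD; first exact: cvg_cst.
apply: (@continuous_cvg _ _ _ _ _ (fun v : R => v - v0) (fun t : R => t ^+ 2)).
  exact: exprn_continuous.
by apply: cvgB; [exact: cvg_id|exact: cvg_cst].
Qed.

End fourier.

(** * The Gamma and Beta integrals *)

(** Tonelli with a known inner integral, for majorants that do not split into a function of x times
    a function of y; [cGammaM] has such a majorant. *)
Lemma le_cintegrable_iterated d1 d2 (T1 : measurableType d1)
    (T2 : measurableType d2) (R : realType)
    (m1 : {sigma_finite_measure set T1 -> \bar R})
    (m2 : {sigma_finite_measure set T2 -> \bar R})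
    (f : T1 * T2 -> R[i]) (k : T1 * T2 -> R) (g : T1 -> R) :
  cmeasurable f -> measurable_fun setT k ->
  (forall z, normc (f z) <= k z) ->
  (forall x, (\int[m2]_y (k (x, y))%:E = (g x)%:E)%E) ->
  m1.-integrable setT (EFin \o g) -> cintegrable (m1 \x m2)%E f.
Proof.
move=> mf mk fk kg ig; apply: (le_cintegrable (g := k)) => //.
apply/integrable12ltyP; first exact/measurable_EFinP.
under eq_integral do under eq_integral do
  rewrite /= ger0_norm ?(le_trans (normc_ge0 _) (fk _))//.
under eq_integral do rewrite kg.
have /integrableP[_] := ig; apply: le_lt_trans; apply: ge0_le_integral => //.
- move=> x _; rewrite -kg; apply: integral_ge0 => y _; rewrite lee_fin.
  exact: le_trans (normc_ge0 _) (fk _).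
- by have /integrableP[] := ig.
- by apply: measurableT_comp => //; have /integrableP[] := ig.
- by move=> x _; rewrite /= lee_fin ler_norm.
Qed.

Section cgamma.
Variable R : realType.
Local Notation C := (R[i]).
Local Notation mu := (@lebesgue_measure R).

(** A single bound that yields both integrability and vanishing at the two ends, as required for
    integration by parts with [cFTC_line]. *)
Definition decays (f : R -> C) := exists K e : R, 0 < e /\
  forall x, normc (f x) <= K * expR (- (e * `|x|)).

Lemma decays_cintegrable (f : R -> C) : cmeasurable f -> decays f ->
  cintegrable mu f.
Proof.
move=> mf [K [e [e0 h]]].
apply: (@le_cintegrable _ _ R mu _ (fun x : R => K * expR (- (e * `|x|)))) => //.
exact: (integrableZl measurableT K (integrable_expRN_norm e0)).
Qed.

Definition gamma_fun (z : C) (x : R) : C := cexp (z * x%:C - (expR x)%:C).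
Definition cGamma (z : C) : C := cintegral mu (gamma_fun z).

Lemma normc_gamma_fun z x : normc (gamma_fun z x) = expR (Re z * x - expR x).
Proof. by rewrite normc_cexp !cReImE /=; congr expR; ring. Qed.

Lemma expR_ge_sqr (x : R) : 0 <= x -> x ^+ 2 / 4 <= expR x.
Proof.
move=> x0; have -> : expR x = expR (x / 2) ^+ 2.
  by rewrite -expRM_natl; congr expR; field.
have -> : x ^+ 2 / 4 = (x / 2) ^+ 2 by field.
rewrite lerXn2r ?nnegrE ?expR_ge0 ?divr_ge0//.
by rewrite (le_trans _ (expR_ge1Dx _))// lerDr.
Qed.

Lemma gamma_fun_le (c x : R) : 0 < c ->
  expR (c * x - expR x) <= expR (4 * c ^+ 2) * expR (- (c * `|x|)).
Proof.
move=> c0; rewrite -expRD ler_expR.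
have [x0|/ltW x0] := leP 0 x.
  rewrite ger0_norm//; have := expR_ge_sqr x0.
  (* Completing the square: exp x >= x^2 / 4 >= 2 c x - 4 c^2. This is the origin of the constant
     exp (4 c^2). *)
  have := sqr_ge0 (x / 2 - 2 * c); nra.
rewrite ler0_norm// mulrN opprK -subr_ge0.
have := expR_ge0 x; have := sqr_ge0 c; lra.
Qed.

Lemma ccontinuous_lin (z : C) : ccontinuous (fun x : R => z * x%:C).
Proof.
apply: ccontinuousM; first exact: ccontinuous_cst.
by apply: ccontinuous_real => y; exact: cvg_id.
Qed.

Lemma ccontinuous_gamma_fun z : ccontinuous (gamma_fun z).
Proof.
apply: ccontinuous_exp; apply: ccontinuousD; first exact: ccontinuous_lin.
under eq_fun do rewrite -rmorphN.
by apply: ccontinuous_real => x; apply: cvgN; exact: continuous_expR.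
Qed.

Lemma decays_gamma_fun z : 0 < Re z -> decays (gamma_fun z).
Proof.
move=> z0; exists (expR (4 * Re z ^+ 2)), (Re z); split => // x.
by rewrite normc_gamma_fun gamma_fun_le.
Qed.

Lemma cintegrable_gamma_fun z : 0 < Re z -> cintegrable mu (gamma_fun z).
Proof.
move=> z0; apply: decays_cintegrable; last exact: decays_gamma_fun.
exact/ccontinuous_measurable/ccontinuous_gamma_fun.
Qed.

Lemma integrable_gamma_funr (c : R) : 0 < c ->
  mu.-integrable setT (EFin \o (fun x : R => expR (c * x - expR x))).
Proof.
move=> c0; have [+ _] := @cintegrable_gamma_fun c%:C c0.
congr (_.-integrable _ _); apply/funext => x /=; congr (_%:E).
by rewrite /gamma_fun -rmorphM -rmorphB cexpR.
Qed.

Lemma decays_shift (f : R -> C) (y : R) : decays f -> decays (fun v => f (v + y)).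
Proof.
move=> [K [e [e0 h]]]; exists (`|K| * expR (e * `|y|)), e; split => // v.
rewrite (le_trans (h _))// -mulrA -expRD.
apply: (@le_trans _ _ (`|K| * expR (- (e * `|v + y|)))).
  by rewrite ler_wpM2r ?expR_ge0// ler_norm.
rewrite ler_wpM2l// ler_expR -mulrBr -mulrN ler_pM2l//.
rewrite lerNl opprB lerBlDr.
by rewrite -{1}[v](addrK y) (le_trans (ler_normD _ _))// normrN.
Qed.

(** Integration by parts: the derivative of [gamma_fun z] is z times itself minus
    [gamma_fun (z + 1)], and [gamma_fun z] vanishes at both ends, so the integral of this derivative
    is 0. *)
Lemma cGammaD1 z : 0 < Re z -> cGamma (z + 1) = z * cGamma z.
Proof.
move=> z0; have z10 : 0 < Re (z + 1) by rewrite cReD /= addr_gt0.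
have [K [e [e0 h]]] := decays_gamma_fun z0.
have [l1 l2] := ccvg_decay e0 h.
have d (x : R) : is_cderive x (gamma_fun z) (z * gamma_fun z x + (-1) * gamma_fun (z + 1) x).
  have h1 : is_cderive x (fun y : R => y%:C : C) 1.
    by apply: is_cderive_real; exact: is_derive_id.
  have h2 : is_cderive x (fun y : R => - (expR y)%:C : C) (- expR x)%:C.
    under eq_fun do rewrite -rmorphN.
    by apply: is_cderive_real; exact: is_deriveN.
  have h3 := is_cderive_exp (is_cderiveD (is_cderiveM (is_cderive_cst x z) h1) h2).
  move: h3; rewrite mul0r add0r mulr1 mulrDl.
  suff -> : (- expR x)%:C * cexp (z * x%:C + - (expR x)%:C) = -1 * gamma_fun (z + 1) x by [].
  have -> : (- expR x)%:C = - cexp (x%:C : C) by rewrite rmorphN cexpR.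
  by rewrite mulN1r mulNr -cexpD; congr (- cexp _); ring.
have cd : ccontinuous (fun x => z * gamma_fun z x + (-1) * gamma_fun (z + 1) x).
  by apply: ccontinuousD; apply: ccontinuousM;
    [exact: ccontinuous_cst|exact: ccontinuous_gamma_fun|
     exact: ccontinuous_cst|exact: ccontinuous_gamma_fun].
have := @cFTC_line R _ _ _ _ (fun x => z * gamma_fun z x + (-1) * gamma_fun (z + 1) x)
  0 0 d cd d cd (fun=> fun=> erefl) (fun=> fun=> erefl) _ l1 l2.
have I1 := cintegrable_gamma_fun z0; have I2 := cintegrable_gamma_fun z10.
rewrite cintegralD; [|exact: cintegrableZl|exact: cintegrableZl].
rewrite !cintegralZl// mulN1r => /(_ _)/wrap[].
  by apply: cintegrableD; exact: cintegrableZl.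
rewrite -/(cGamma _) -/(cGamma _) sub0r subr0 addNr => /eqP.
by rewrite subr_eq0 => /eqP ->.
Qed.

Lemma cGamma1 : cGamma 1 = 1.
Proof.
have d (x : R) : is_derive x 1 (fun y => - expR (- expR y)) (expR (x - expR x)).
  have h1 : is_derive x 1 (fun y => - expR y) (- expR x) by exact: is_deriveN.
  have h2 : is_derive x 1 (fun y => expR (- expR y)) (expR (- expR x) * (- expR x)).
    exact: is_derive1_comp.
  by apply: is_derive_eq; rewrite expRD; ring.
have c : continuous (fun x : R => expR (x - expR x)).
  move=> x; apply: continuous_cvg; first exact: continuous_expR.
  by apply: cvgB; [exact: cvg_id|exact: continuous_expR].
have I1 : mu.-integrable setT (EFin \o (fun x : R => expR (x - expR x))).
  have [+ _] := @cintegrable_gamma_fun 1 ltr01.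
  congr (_.-integrable _ _); apply/funext => x /=; congr (_%:E).
  rewrite /gamma_fun mul1r -rmorphB cexpR//.
have -> : cGamma 1 = cintegral mu (fun x : R => (expR (x - expR x))%:C).
  by apply: eq_cintegral => x; rewrite /gamma_fun mul1r -rmorphB cexpR.
rewrite cintegral_real.
have e0 : (fun n : nat => expR (- n.+1%:R)) @ \oo --> (0 : R).
  by have := cvg_expRN 1 (@ltr01 R); under eq_fun do rewrite !mul1r.
rewrite (@FTC_line R _ _ _ _ _ 0 (-1) d c d c (fun=> fun=> erefl) (fun=> fun=> erefl) I1).
- by congr (_%:C); ring.
- rewrite -oppr0; apply: cvgN.
  apply: (@squeeze_cvgr _ _ _ _ (fun=> 0) (fun n : nat => expR (- n.+1%:R))) => //.
    apply: nearW => n; rewrite expR_ge0/= ler_expR lerN2.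
    by rewrite (le_trans _ (expR_ge1Dx _))// lerDr.
  exact: cvg_cst.
- apply: cvgN; rewrite -[X in _ --> X]expR0.
  apply: continuous_cvg; first exact: continuous_expR.
  by rewrite -oppr0; exact: cvgN.
Qed.

(** The integrand of Euler's Beta integral int_0^oo x^(u - 1) (1 + x)^(- u - w) dx, with x = exp
    v. *)
Definition cbeta_fun (u w : C) (v : R) : C :=
  cexp (u * v%:C - (u + w) * (ln (1 + expR v))%:C).
Definition cBeta (u w : C) : C := cintegral mu (cbeta_fun u w).

Lemma ln1expR_ge0 (v : R) : 0 <= ln (1 + expR v).
Proof. by rewrite ln_ge0// lerDl expR_ge0. Qed.

Lemma ln1expR_ge (v : R) : v <= ln (1 + expR v).
Proof.
by rewrite -[leLHS]expRK ler_ln ?posrE ?expR_gt0 ?addr_gt0 ?expR_gt0// lerDr.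
Qed.

Lemma continuous_ln1expR : continuous (fun v : R => ln (1 + expR v)).
Proof.
move=> v; apply: (@continuous_cvg _ _ _ _ _ (fun v : R => 1 + expR v) (@ln R)).
  by apply: continuous_ln; rewrite addr_gt0// expR_gt0.
by apply: cvgD; [exact: cvg_cst|exact: continuous_expR].
Qed.

Lemma ccontinuous_cbeta_fun u w : ccontinuous (cbeta_fun u w).
Proof.
apply: ccontinuous_exp; apply: ccontinuousD; first exact: ccontinuous_lin.
under eq_fun do rewrite -mulNr.
apply: ccontinuousM; first exact: ccontinuous_cst.
apply: ccontinuous_real; exact: continuous_ln1expR.
Qed.

Lemma normc_cbeta_fun u w v :
  normc (cbeta_fun u w v) = expR (Re u * v - (Re u + Re w) * ln (1 + expR v)).
Proof. by rewrite normc_cexp !cReImE /=; congr expR; ring. Qed.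

Lemma decays_cbeta_fun u w : 0 < Re u -> 0 < Re w -> decays (cbeta_fun u w).
Proof.
move=> u0 w0; exists 1, (Num.min (Re u) (Re w)); rewrite lt_min u0 w0; split=> // v.
rewrite normc_cbeta_fun mul1r ler_expR.
have [v0|/ltW v0] := leP 0 v.
  have h : Num.min (Re u) (Re w) <= Re w by rewrite ge_min lexx orbT.
  rewrite ger0_norm//; have := ln1expR_ge v; nra.
have h : Num.min (Re u) (Re w) <= Re u by rewrite ge_min lexx.
rewrite ler0_norm//; have := ln1expR_ge0 v; nra.
Qed.

Lemma cintegrable_cbeta_fun u w : 0 < Re u -> 0 < Re w ->
  cintegrable mu (cbeta_fun u w).
Proof.
move=> u0 w0; apply: decays_cintegrable; last exact: decays_cbeta_fun.
exact/ccontinuous_measurable/ccontinuous_cbeta_fun.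
Qed.

Lemma expR_ln1expR (y v : R) :
  expR y + expR (v + y) = expR (y + ln (1 + expR v)).
Proof.
rewrite !expRD lnK; first by ring.
by rewrite posrE addr_gt0// expR_gt0.
Qed.

(** The product of the two Gamma integrals is a double integral in which the variable of [cGamma u]
    is translated by that of [cGamma w]. In the new variables v is the logarithm of the ratio of
    Euler's original variables, and integrating over y first leaves the Beta integrand. *)
Lemma cGammaM u w : 0 < Re u -> 0 < Re w ->
  cGamma u * cGamma w = cGamma (u + w) * cBeta u w.
Proof.
move=> u0 w0.
have Iu := cintegrable_gamma_fun u0; have Iw := cintegrable_gamma_fun w0.
pose H (p : R * R) := gamma_fun w p.1 * gamma_fun u (p.2 + p.1).
have mg z := ccontinuous_measurable (ccontinuous_gamma_fun z).
have IH : cintegrable (mu \x mu)%E H.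
  pose k (p : R * R) := expR (Re w * p.1 - expR p.1) *
    expR (Re u * (p.2 + p.1) - expR (p.2 + p.1)).
  pose gu := (\int[mu]_x expR (Re u * x - expR x))%R.
  apply: (@le_cintegrable_iterated _ _ _ _ R mu mu H k
    (fun y : R => gu * expR (Re w * y - expR y))).
  - apply: cmeasurableM; first exact: (cmeasurable_comp (phi := fst) measurable_fst (mg w)).
    apply: (cmeasurable_comp (phi := fun p : R * R => p.2 + p.1)) (mg u).
    exact: measurable_funD.
  - have me (c : R) : measurable_fun setT (fun x : R => expR (c * x - expR x)).
      apply: measurableT_comp => //; exact: measurable_funB.
    apply: measurable_funM.
      exact: (measurableT_comp (me (Re w)) (measurable_fst)).
    apply: (measurableT_comp (f := fun x : R => expR (Re u * x - expR x))) => //.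
      exact: measurable_funD.
  - by move=> p; rewrite ComplexField.Normc.normcM !normc_gamma_fun.
  - move=> y; rewrite /k /=; under eq_integral do rewrite EFinM.
    have cgu : continuous (fun x : R => expR (Re u * x - expR x)).
      move=> x; apply: continuous_cvg; first exact: continuous_expR.
      apply: cvgB; last exact: continuous_expR.
      by apply: cvgM; [exact: cvg_cst|exact: cvg_id].
    rewrite ge0_integralZl//=; last first.
      apply/measurable_EFinP; apply: continuous_measurable_fun => v.
      apply: (@continuous_cvg _ _ _ _ _ (fun v => v + y) (fun x : R => expR (Re u * x - expR x))).
        exact: cgu.
      by apply: cvgD; [exact: cvg_id|exact: cvg_cst].
    have -> : (\int[mu]_v (expR (Re u * (v + y) - expR (v + y)))%:E = gu%:E)%E.
      rewrite /gu /Rintegral fineK; last first.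
        by apply: integrable_fin_num => //; exact: integrable_gamma_funr.
      rewrite [RHS](integral_affine y ltr01 cgu); apply: eq_integral => v _.
      by rewrite mul1r mulr1.
    by rewrite -EFinM mulrC.
  - exact: (integrableZl measurableT gu (integrable_gamma_funr w0)).
have sh (y : R) : cintegrable mu (fun v : R => gamma_fun u (v + y)).
  apply: decays_cintegrable.
    apply: (cmeasurable_comp (phi := fun v : R => v + y)) (mg u).
    exact: measurable_funD.
  exact/decays_shift/decays_gamma_fun.
transitivity (cintegral mu (fun y : R => cintegral mu (fun v : R => H (y, v)))).
  rewrite -cintegralZl//; apply: eq_cintegral => y.
  rewrite /H /= cintegralZl// mulrC (cintegral_shift y)//.
  exact: ccontinuous_gamma_fun.
rewrite (cFubini IH) -cintegralZl; last exact: cintegrable_cbeta_fun.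
have uw0 : 0 < Re (u + w) by rewrite cReD addr_gt0.
apply: eq_cintegral => v.
(* For fixed v the exponential term is exp y (1 + exp v). Translating the integral of
   [cGamma (u + w)] by ln (1 + exp v) produces the same term and releases the power (1 + exp v)^(u +
   w), which cancels the one in [cbeta_fun]. *)
rewrite /cGamma -(cintegral_shift (ln (1 + expR v)) (ccontinuous_gamma_fun (u + w))) mulrC.
rewrite -cintegralZl.
  apply: eq_cintegral => y; rewrite /H /gamma_fun /cbeta_fun /= -!cexpD.
  rewrite -expR_ln1expR !rmorphD /=; congr cexp; ring.
apply: decays_cintegrable.
  apply: (cmeasurable_comp (phi := fun y : R => y + ln (1 + expR v))) (mg _).
  exact: measurable_funD.
exact/decays_shift/decays_gamma_fun.
Qed.

Lemma cGamma_cvg1 (s : C) : 0 < Re s ->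
  ccvg (fun k : nat => cGamma (1 + s / (2 ^+ k)%:C)) 1.
Proof.
move=> s0; rewrite -[X in ccvg _ X]cGamma1.
have E k : s / (2 ^+ k)%:C = s * (2^-1 ^+ k)%:C by rewrite exprVn fmorphV.
have p0 k : 0 <= (2^-1 ^+ k : R) <= 1.
  by rewrite exprn_ge0//= exprn_ile1 ?invr_ge0 ?invf_le1 ?ler1n.
(* The real part of the argument stays between 1 and 1 + Re s, so one of the two summands dominates,
   according to the sign of x. *)
apply: (@cdominated_cvg _ _ R mu _ _ (fun x : R => expR (1 * x - expR x) +
    expR ((1 + Re s) * x - expR x))).
- by move=> k; exact/ccontinuous_measurable/ccontinuous_gamma_fun.
- exact/ccontinuous_measurable/ccontinuous_gamma_fun.
- move=> x; apply: ccvg_exp.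
  have -> : (fun k : nat => (1 + s / (2 ^+ k)%:C) * x%:C - (expR x)%:C) =
      (fun k : nat => 1 * x%:C - (expR x)%:C + (s * x%:C) * (2^-1 ^+ k)%:C).
    by apply/funext => k; rewrite E; ring.
  have h : (fun k : nat => 2^-1 ^+ k : R) @ \oo --> (0 : R).
    by apply: cvg_expr; rewrite ger0_norm// invf_lt1// ltr1n.
  rewrite -[X in ccvg _ X]addr0 -[X in ccvg _ (_ + X)](mulr0 (s * x%:C)).
  apply: ccvgD; first exact: ccvg_cst.
  by apply: ccvgM; [exact: ccvg_cst|exact: ccvg_real h].
- have := integrableD measurableT (integrable_gamma_funr ltr01)
    (integrable_gamma_funr (addr_gt0 ltr01 s0)).
  by congr (_.-integrable _ _).
- move=> k x; rewrite normc_gamma_fun E !cReImE /= mulr0 subr0.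
  have /andP[q0 q1] := p0 k; set q := 2^-1 ^+ k in q0 q1 *.
  have [x0|/ltW x0] := leP 0 x.
    rewrite -[leLHS]add0r lerD ?expR_ge0// ler_expR lerD2r ler_wpM2r// lerD2l.
    by rewrite ler_piMr// ltW.
  rewrite -[leLHS]addr0 lerD ?expR_ge0// ler_expR lerD2r ler_wnM2r// lerDl.
  by rewrite mulr_ge0// ltW.
Qed.

(* If [cGamma s = 0] then Euler's identity forces [cGamma (s / 2 ^ k) = 0] for
   all [k], hence [cGamma (1 + s / 2 ^ k) = 0], against the limit [cGamma 1]. *)
Lemma cGamma_neq0 (s : C) : 0 < Re s -> cGamma s != 0.
Proof.
move=> s0; apply/eqP => G0.
have E k : s / (2 ^+ k)%:C = s * (2^-1 ^+ k)%:C by rewrite exprVn fmorphV.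
have Re0 k : 0 < Re (s / (2 ^+ k)%:C).
  by rewrite E cReM /= mulr0 subr0 mulr_gt0// exprn_gt0.
have Gk k : cGamma (s / (2 ^+ k)%:C) = 0.
  elim: k => [|k IH]; first by rewrite expr0 divr1.
  have h : s / (2 ^+ k)%:C = s / (2 ^+ k.+1)%:C + s / (2 ^+ k.+1)%:C.
    rewrite !E exprS !rmorphM /= -mulrDr -!mulrDl -rmorphD /=.
    have -> : (2^-1 + 2^-1 : R) = 1 by field.
    by rewrite mul1r.
  have := cGammaM (Re0 k.+1) (Re0 k.+1); rewrite -h IH mul0r => /eqP.
  by rewrite mulf_eq0 orbb => /eqP.
have := cGamma_cvg1 s0.
under eq_fun do rewrite addrC cGammaD1// Gk mulr0.
move=> /(ccvg_unique (ccvg_cst 0))/eqP; rewrite eq_sym; exact/negP/oner_neq0.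
Qed.

End cgamma.

(** * Gauss' limit formula and the Gamma integral *)

Section gauss_limit.
Variable R : realType.
Local Notation C := (R[i]).
Local Notation mu := (@lebesgue_measure R).

Lemma cGamma_prod (z : C) n : 0 < Re z ->
  \prod_(k < n) (z + (k%:R)%:C) * cGamma z = cGamma (z + (n%:R)%:C).
Proof.
move=> z0; elim: n => [|n IH]; first by rewrite big_ord0 mul1r addr0.
rewrite big_ord_recr /= mulrAC mulrC mulrC IH -[n.+1%:R]natr1 rmorphD /= addrA.
rewrite cGammaD1 1?mulrC// cReD /= ltr_wpDr//.
Qed.

Lemma cGamma_nat n : cGamma (1 + (n%:R)%:C) = (n`!%:R)%:C :> C.
Proof.
elim: n => [|n IH]; first by rewrite addr0 cGamma1.
rewrite -[n.+1%:R]natr1 rmorphD /= addrA cGammaD1; last by rewrite cReD /= ltr_wpDr.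
by rewrite IH factS natrM rmorphM /= -natr1 rmorphD /= addrC.
Qed.

(** Here n! is Gamma (n + 1) and the product is Gamma (z + n + 1) / Gamma z, so Gauss' quotient is a
    Beta value. Cancelling Gamma z is where [cGamma_neq0] enters. *)
Lemma Gauss_seqE (z : C) n : 0 < Re z ->
  Gauss_seq z n = cpow n%:R z * cBeta z (1 + (n%:R)%:C).
Proof.
move=> z0; have n0 : 0 < Re (1 + (n%:R)%:C : C) by rewrite cReD /= ltr_wpDr.
have := cGammaM z0 n0; rewrite cGamma_nat addrA -[z + 1 + _]addrA [1 + _]addrC.
rewrite -(rmorphD _ n%:R 1) natr1 -cGamma_prod// => /(congr1 (fun x => x / cGamma z)).
have G0 := cGamma_neq0 z0.
rewrite mulrAC mulfV// mul1r mulrAC mulfK// => h.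
rewrite /Gauss_seq h.
have : \prod_(k < n.+1) (z + (k%:R)%:C) != 0.
  apply/prodf_neq0 => k _.
  by rewrite eq_complex /= negb_and cReD /= gt_eqF// ltr_wpDr.
by move: (\prod_(k < n.+1) _) => P P0; field.
Qed.

(** The Beta integrand of [Gauss_seqE] with v translated by - ln n. The translation absorbs the
    power n^z, and the factor (1 + exp v / n)^-(z + 1 + n) tends to exp (- exp v). *)
Definition euler_fun (z : C) (n : nat) (v : R) : C :=
  cexp (z * v%:C - (z + 1 + (n%:R)%:C) * (ln (1 + expR v / n%:R))%:C).

Lemma Gauss_seq_integral (z : C) n : 0 < Re z -> (0 < n)%N ->
  Gauss_seq z n = cintegral mu (euler_fun z n).
Proof.
move=> z0 n0; rewrite Gauss_seqE// /cpow.
have n1 : 0 < Re (1 + (n%:R)%:C : C) by rewrite cReD /= ltr_wpDr.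
rewrite -cintegralZl; last exact: cintegrable_cbeta_fun.
rewrite -(cintegral_shift (- ln n%:R)); last first.
  apply: ccontinuousM; first exact: ccontinuous_cst.
  exact: ccontinuous_cbeta_fun.
apply: eq_cintegral => v; rewrite /cbeta_fun /euler_fun -cexpD expRD expRN lnK ?posrE ?ltr0n//.
rewrite rmorphB /=; congr cexp; ring.
Qed.

(** Concavity of ln: 1 + t / n is the convex combination of 1 + t / N and 1 with weight N / n on the
    former. *)
Lemma le_nln (N n : nat) (t : R) : 0 <= t -> (0 < N)%N -> (N <= n)%N ->
  N%:R * ln (1 + t / N%:R) <= n%:R * ln (1 + t / n%:R).
Proof.
move=> t0 N0 Nn; have n0 : (0 < n)%N by exact: leq_trans Nn.
have N0' : 0 < N%:R :> R by rewrite ltr0n.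
have n0' : 0 < n%:R :> R by rewrite ltr0n.
have l0 : 0 <= N%:R / n%:R :> R by rewrite divr_ge0.
have l1 : N%:R / n%:R <= 1 :> R by rewrite ler_pdivrMr// mul1r ler_nat.
have h : 0 < 1 + t / N%:R by rewrite ltr_wpDr// divr_ge0// ltW.
have := @concave_ln R (Itv01 l0 l1) (1 + t / N%:R) 1 h ltr01.
rewrite !convRE /= ln1 mulr0 addr0 mulr1 /unstable.onem.
have -> : N%:R / n%:R * (1 + t / N%:R) + (1 - N%:R / n%:R) = 1 + t / n%:R.
  by field; rewrite !gt_eqF.
by rewrite mulrAC ler_pdivrMr// [leRHS]mulrC.
Qed.

Lemma normc_euler_fun z n v : normc (euler_fun z n v) =
  expR (Re z * v - (Re z + 1 + n%:R) * ln (1 + expR v / n%:R)).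
Proof. by rewrite normc_cexp !cReImE /=; congr expR; ring. Qed.

(** A majorant uniform in n. By [le_nln] the exponent n may be lowered to N, and N ln (1 + exp v /
    N) >= N (v - ln N) gives the rate N - Re z for v >= 0 and the constant exp (N ln N). For v <= 0
    the factor exp (Re z v) already decays. *)
Lemma euler_fun_le z (N n : nat) v : 0 < Re z -> Re z < N%:R -> (N <= n)%N ->
  normc (euler_fun z n v) <=
  expR (N%:R * ln N%:R) * expR (- (Num.min (Re z) (N%:R - Re z) * `|v|)).
Proof.
move=> z0 zN Nn; have N0 : 0 < N%:R :> R by exact: lt_trans zN.
have N0' : (0 < N)%N by rewrite -(ltr0n R).
rewrite normc_euler_fun -expRD ler_expR.
have ev := expR_gt0 v.
have L0 (m : nat) : 0 <= ln (1 + expR v / m%:R) by rewrite ln_ge0// lerDl divr_ge0// ltW.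
have h := le_nln (ltW ev) N0' Nn.
have hv : v - ln N%:R <= ln (1 + expR v / N%:R).
  have e1 : 0 < 1 + expR v / N%:R by rewrite ltr_wpDr// divr_ge0// ltW.
  rewrite -[leLHS]expRK ler_ln ?posrE ?expR_gt0//.
  by rewrite expRD expRN lnK ?posrE// lerDr.
have lN : 0 <= ln N%:R :> R by rewrite ln_ge0// ler1n.
have := L0 n; have := L0 N.
have [v0|/ltW v0] := leP 0 v.
  have hm : Num.min (Re z) (N%:R - Re z) <= N%:R - Re z by rewrite ge_min lexx orbT.
  rewrite ger0_norm// => L1 L2.
  have : Num.min (Re z) (N%:R - Re z) * v <= (N%:R - Re z) * v by rewrite ler_wpM2r.
  have : N%:R * (v - ln N%:R) <= N%:R * ln (1 + expR v / N%:R) by rewrite ler_pM2l.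
  have : 0 <= (Re z + 1) * ln (1 + expR v / n%:R) by rewrite mulr_ge0// addr_ge0// ltW.
  by move: h; lra.
have hm : Num.min (Re z) (N%:R - Re z) <= Re z by rewrite ge_min lexx.
rewrite ler0_norm// => L1 L2.
have : Re z * v <= Num.min (Re z) (N%:R - Re z) * v by rewrite ler_wnM2r.
have : 0 <= (Re z + 1 + n%:R) * ln (1 + expR v / n%:R).
  by rewrite mulr_ge0// !addr_ge0// ltW.
have : 0 <= N%:R * ln N%:R :> R by rewrite mulr_ge0// ltW.
lra.
Qed.

Lemma cvg_divn (t : R) (N : nat) : (fun k : nat => t / (k + N.+1)%:R) @ \oo --> (0 : R).
Proof.
rewrite -(mulr0 t); apply: cvgMr.
have : (fun k : nat => (k + N).+1%:R^-1 : R) @ \oo --> (0 : R).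
  by rewrite (cvg_shiftn N (fun k : nat => k.+1%:R^-1 : R)); exact: cvg_harmonic.
by under eq_fun do rewrite -addnS.
Qed.

Lemma cvg_nln (t : R) (N : nat) : 0 <= t ->
  (fun k : nat => (k + N.+1)%:R * ln (1 + t / (k + N.+1)%:R)) @ \oo --> t.
Proof.
move=> t0.
apply: (@squeeze_cvgr _ _ _ _ (fun k : nat => t / (1 + t / (k + N.+1)%:R)) (fun=> t)).
- apply: nearW => k; have n0 : 0 < (k + N.+1)%:R :> R by rewrite ltr0n addnS.
  set n := (k + N.+1)%:R in n0 *.
  have x0 : 0 <= t / n by rewrite divr_ge0// ltW.
  have x1 : 0 < 1 + t / n by rewrite ltr_wpDr.
  apply/andP; split.
    (* The inequality ln (1 + y) <= y is used at y = - x / (1 + x) with x = t / n, where 1 + y is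
       the inverse of 1 + x; this yields the lower side of the squeeze. *)
    have h : ln (1 + - (t / n / (1 + t / n))) <= - (t / n / (1 + t / n)).
      by apply: le_ln1Dx; rewrite ltrN2 ltr_pdivrMr// mul1r; lra.
    have E : 1 + - (t / n / (1 + t / n)) = (1 + t / n)^-1.
      by field; rewrite !lt0r_neq0//; lra.
    move: h; rewrite E lnV ?posrE// lerN2 => h.
    rewrite -ler_pdivrMl//; apply: le_trans h.
    by rewrite le_eqVlt; apply/orP; left; apply/eqP; field; rewrite !lt0r_neq0//; lra.
  have : ln (1 + t / n) <= t / n by apply: le_ln1Dx; lra.
  by rewrite ler_pdivlMr// mulrC.
- rewrite -[X in _ --> X]divr1; apply: cvgM; first exact: cvg_cst.
  apply: cvgV; first exact: oner_neq0.
  rewrite -[X in _ --> X]addr0; apply: cvgD; first exact: cvg_cst.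
  exact: cvg_divn.
- exact: cvg_cst.
Qed.

Lemma ccvg_Gauss_seq (z : C) : 0 < Re z -> ccvg (Gauss_seq z) (cGamma z).
Proof.
(* Starting the sequence at an N above Re z makes the majorant [euler_fun_le] available and keeps
   the denominators n positive. *)
move=> z0; pose N := (Num.trunc (Re z)).+1.
have zN : Re z < N%:R by exact: truncnS_gt.
suff : ccvg (fun k : nat => Gauss_seq z (k + N)) (cGamma z).
  move=> [h1 h2]; split.
    by rewrite -(cvg_shiftn N (fun k => Re (Gauss_seq z k))).
  by rewrite -(cvg_shiftn N (fun k => Im (Gauss_seq z k))).
have -> : (fun k : nat => Gauss_seq z (k + N)) =
    (fun k : nat => cintegral mu (euler_fun z (k + N))).
  by apply/funext => k; rewrite Gauss_seq_integral// addnS.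
have cL (n : nat) : continuous (fun v : R => ln (1 + expR v / n%:R)).
  move=> v; apply: (@continuous_cvg _ _ _ _ _ (fun v : R => 1 + expR v / n%:R) (@ln R)).
    by apply: continuous_ln; rewrite ltr_wpDr// divr_ge0// expR_ge0.
  apply: cvgD; first exact: cvg_cst.
  by apply: cvgM; [exact: continuous_expR|exact: cvg_cst].
apply: (@cdominated_cvg _ _ R mu _ _ (fun v : R => expR (N%:R * ln N%:R) *
    expR (- (Num.min (Re z) (N%:R - Re z) * `|v|)))).
- move=> k; apply: ccontinuous_measurable; apply: ccontinuous_exp.
  apply: ccontinuousD; first exact: ccontinuous_lin.
  under eq_fun do rewrite -mulNr.
  apply: ccontinuousM; first exact: ccontinuous_cst.
  exact: ccontinuous_real.
- exact/ccontinuous_measurable/ccontinuous_gamma_fun.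
- move=> v; apply: ccvg_exp.
  have -> : (fun k : nat => z * v%:C - (z + 1 + ((k + N)%:R)%:C) *
        (ln (1 + expR v / (k + N)%:R))%:C) =
      (fun k : nat => (z * v%:C + (- (z + 1)) * (ln (1 + expR v / (k + N)%:R))%:C) +
         (-1) * ((k + N)%:R * ln (1 + expR v / (k + N)%:R))%:C).
    by apply/funext => k; rewrite rmorphM /=; ring.
  have -> : z * v%:C - (expR v)%:C = (z * v%:C + (- (z + 1)) * 0%:C) + (-1) * (expR v)%:C.
    by rewrite mulr0 addr0 mulN1r.
  apply: ccvgD; last first.
    apply: ccvgM; first exact: ccvg_cst.
    by apply: ccvg_real; apply: cvg_nln; exact: expR_ge0.
  apply: ccvgD; first exact: ccvg_cst.
  apply: ccvgM; first exact: ccvg_cst.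
  apply: ccvg_real; rewrite -[X in _ --> X](@ln1 R).
  apply: continuous_cvg; first exact: continuous_ln.
  rewrite -[X in _ --> X]addr0; apply: cvgD; first exact: cvg_cst.
  exact: cvg_divn.
- apply: (integrableZl measurableT (expR (N%:R * ln N%:R)) (integrable_expRN_norm _)).
  by rewrite lt_min z0 subr_gt0.
- by move=> k v; apply: euler_fun_le => //; exact: leq_addl.
Qed.

Lemma GammaC_lim (z l : C) : ccvg (Gauss_seq z) l -> GammaC z = l.
Proof.
move=> [/(cvg_lim (@Rhausdorff R)) h1 /(cvg_lim (@Rhausdorff R)) h2].
by rewrite /GammaC h1 h2 -complexE.
Qed.

Lemma GammaCE (z : C) : 0 < Re z -> GammaC z = cGamma z.
Proof. by move=> z0; apply: GammaC_lim; exact: ccvg_Gauss_seq. Qed.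

(** The Gauss sequences at z and z + 1 differ by the factor (z + n + 1) / (n z), which tends to 1 /
    z. Convergence therefore extends one unit to the left of the half-plane. The index n + 1 keeps
    the denominator nonzero. *)
Lemma GammaC_sub1 (z : C) : -1 < Re z -> Re z < 0 ->
  GammaC z = cGamma (z + 1) / z.
Proof.
move=> z1 z0; apply: GammaC_lim.
have zn0 : z != 0 by rewrite eq_complex negb_and lt_eqF.
suff h : ccvg (fun n => Gauss_seq z (n + 1)) (cGamma (z + 1) / z).
  case: h => h1 h2; split.
    by rewrite -(cvg_shiftn 1 (fun k => Re (Gauss_seq z k))).
  by rewrite -(cvg_shiftn 1 (fun k => Im (Gauss_seq z k))).
have z10 : 0 < Re (z + 1) by rewrite cReD /= -ltrBlDr sub0r.
have -> : (fun n => Gauss_seq z (n + 1)) = (fun n => Gauss_seq (z + 1) (n + 1) *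
    (z^-1 * (1 + (z + 1) * (1 / (n + 1)%:R)%:C))).
  apply/funext => n; rewrite /Gauss_seq /cpow.
  have -> : cexp ((z + 1) * (ln (n + 1)%:R)%:C) =
      cexp (z * (ln (n + 1)%:R)%:C) * ((n + 1)%:R)%:C.
    rewrite mulrDl mul1r cexpD cexpR lnK// posrE ltr0n addn1//.
  rewrite big_ord_recl [in RHS]big_ord_recr /= addr0.
  under eq_bigr do rewrite /bump /= add1n -natr1 rmorphD /= [_ + 1]addrC addrA.
  set P := \prod_(i < n + 1) _.
  have P0 : P != 0.
    apply/prodf_neq0 => k _; rewrite eq_complex negb_and !cReD /= gt_eqF//.
    by rewrite ltr_wpDr//; move: z10; rewrite cReD.
  have n0 : ((n + 1)%:R)%:C != 0 :> C by rewrite eq_complex negb_and /= pnatr_eq0 addn1.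
  have q0 : z + 1 + ((n + 1)%:R)%:C != 0.
    rewrite eq_complex negb_and !cReD /= gt_eqF//.
    by rewrite ltr_wpDr//; move: z10; rewrite cReD.
  rewrite div1r fmorphV /=; move: (((n + 1)%:R)%:C) n0 q0 => w n0 q0.
  by field; rewrite q0 P0 n0 zn0.
rewrite -[X in ccvg _ (_ * X)]mulr1; apply: ccvgM.
  have [h1 h2] := ccvg_Gauss_seq z10; split.
    by rewrite (cvg_shiftn 1 (fun k => Re (Gauss_seq (z + 1) k))).
  by rewrite (cvg_shiftn 1 (fun k => Im (Gauss_seq (z + 1) k))).
apply: ccvgM; first exact: ccvg_cst.
rewrite -[X in ccvg _ X]addr0 -[X in ccvg _ (_ + X)](mulr0 (z + 1)).
apply: ccvgD; first exact: ccvg_cst.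
apply: ccvgM; first exact: ccvg_cst.
by apply: ccvg_real; exact: (cvg_divn 1 0).
Qed.

End gauss_limit.

(** * Mellin inversion *)

Section mellin_pairs.
Variable R : realType.
Local Notation C := (R[i]).
Local Notation mu := (@lebesgue_measure R).

Lemma normc_sqr (z : C) : normc z ^+ 2 = Re z ^+ 2 + Im z ^+ 2.
Proof. by case: z => a b /=; rewrite sqr_sqrtr// addr_ge0 ?sqr_ge0. Qed.

Lemma normc_neq0 (z : C) : 0 < Re z -> 0 < normc z.
Proof.
move=> z0; rewrite (lt_le_trans z0)// (le_trans (ler_norm _))// Re_le_normc//.
Qed.

Lemma normcV_line_le (z : C) : 0 < Re z ->
  normc z ^- 2 <= (1 + (Re z)^-2) * (oneDsqr (Im z))^-1.
Proof.
move=> c0; have h : 0 < Re z ^+ 2 by rewrite exprn_gt0.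
have o0 : 0 < oneDsqr (Im z) by rewrite (lt_le_trans ltr01)// oneDsqr_ge1.
have z2 : 0 < normc z ^+ 2 by rewrite exprn_gt0// normc_neq0.
rewrite ler_pdivlMr// mulrC ler_pdivrMr// normc_sqr /oneDsqr.
have -> : (1 + (Re z)^-2) * (Re z ^+ 2 + Im z ^+ 2) =
    1 + Im z ^+ 2 + (Re z ^+ 2 + Im z ^+ 2 / Re z ^+ 2).
  by field; rewrite gt_eqF.
by rewrite lerDl addr_ge0 ?divr_ge0 ?sqr_ge0.
Qed.

Lemma normc_ReD1 (z : C) : 0 < Re z -> normc z <= normc (z + 1).
Proof.
move=> z0; rewrite -(@ler_pXn2r _ 2) ?nnegrE ?normc_ge0// !normc_sqr cReD cImD /=.
nra.
Qed.

(** The Gamma integral at a real argument; it controls the modulus of [cGamma] along the vertical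
    line through [c]. *)
Definition rGamma (c : R) := (\int[mu]_x expR (c * x - expR x))%R.

Lemma normc_cGamma_le (z : C) : 0 < Re z -> normc (cGamma z) <= 2 * rGamma (Re z).
Proof.
move=> z0; apply: le_cintegral.
- exact/ccontinuous_measurable/ccontinuous_gamma_fun.
- by move=> x; rewrite normc_gamma_fun.
- exact: integrable_gamma_funr.
Qed.

Lemma rGamma_ge0 c : 0 <= rGamma c.
Proof. by apply: Rintegral_ge0 => x _; exact: expR_ge0. Qed.

Lemma cGammaD2 (z : C) : 0 < Re z -> cGamma z = cGamma (z + 1 + 1) / (z * (z + 1)).
Proof.
move=> z0; have z1 : 0 < Re (z + 1) by rewrite cReD /= addr_gt0.
have n0 : z != 0 by rewrite eq_complex negb_and gt_eqF.
have n1 : z + 1 != 0 by rewrite eq_complex negb_and gt_eqF.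
by rewrite !cGammaD1//; field; rewrite n0 n1.
Qed.

Lemma cBeta_gamma (u w : C) : 0 < Re u -> 0 < Re w ->
  cBeta u w = cGamma u * cGamma w / cGamma (u + w).
Proof.
move=> u0 w0; rewrite cGammaM// mulrAC mulfV ?mul1r//.
by apply: cGamma_neq0; rewrite cReD addr_gt0.
Qed.

(** Two uses of the functional equation write Gamma u as Gamma (u + 2) / (u (u + 1)), whose
    denominator supplies the quadratic decay. The Gamma factors in the numerator are bounded through
    their real parts, and Gamma (u + w) is constant on the lines of interest, where u + w = s. *)
Lemma cBeta_le (u w : C) : 0 < Re u -> 0 < Re w ->
  normc (cBeta u w) <= 4 * rGamma (Re u + 1 + 1) * rGamma (Re w) *
    (normc (cGamma (u + w)))^-1 * (1 + (Re u)^-2) * (oneDsqr (Im u))^-1.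
Proof.
move=> u0 w0; rewrite cBeta_gamma// (cGammaD2 u0).
have u2 : 0 < Re (u + 1 + 1) by rewrite !cReD !addr_gt0.
have -> : cGamma (u + 1 + 1) / (u * (u + 1)) * cGamma w / cGamma (u + w) =
  (cGamma (u + 1 + 1) * cGamma w) * ((cGamma (u + w))^-1 * (u * (u + 1))^-1) by ring.
rewrite normcMM !ComplexField.Normc.normcV ComplexField.Normc.normcM.
have -> : 4 * rGamma (Re u + 1 + 1) * rGamma (Re w) * (normc (cGamma (u + w)))^-1 *
    (1 + (Re u)^-2) / oneDsqr (Im u) = ((2 * rGamma (Re u + 1 + 1)) * (2 * rGamma (Re w))) *
    ((normc (cGamma (u + w)))^-1 * ((1 + (Re u)^-2) / oneDsqr (Im u))) by ring.
have g0 := normc_ge0; have g0' := rGamma_ge0.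
apply: ler_pM; rewrite ?mulr_ge0 ?invr_ge0 ?mulr_ge0 ?g0//.
  apply: ler_pM => //; last exact: normc_cGamma_le.
  by have := normc_cGamma_le u2; rewrite !cReD.
apply: ler_wpM2l; first by rewrite invr_ge0.
apply: le_trans (normcV_line_le u0).
have n0 := normc_neq0 u0.
rewrite lef_pV2 ?posrE ?exprn_gt0 ?mulr_gt0 ?normc_neq0 ?cReD ?addr_gt0//.
by rewrite expr2 ler_pM2l// normc_ReD1.
Qed.

(** With the sum of the two arguments fixed at s, moving u up its vertical line only multiplies the
    integrand by a character. Hence the Beta function along the line is a Fourier transform. *)
Lemma cbeta_fun_line (s : C) (c y v : R) :
  cbeta_fun (c%:C + 'i * y%:C) (s - (c%:C + 'i * y%:C)) v =
  cexp ('i * (y * v)%:C) * cbeta_fun c%:C (s - c%:C) v.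
Proof.
rewrite /cbeta_fun -cexpD rmorphM /=; congr cexp; ring.
Qed.

(** * Inversion of the Beta kernel *)

Section beta_line.
Variables (s : C) (c : R).
Hypotheses (c0 : 0 < c) (cs : c < Re s).

Let w0 : 0 < Re (s - c%:C). Proof. by rewrite !cReImE /= subr_gt0. Qed.

Let ReL (y : R) : Re (c%:C + 'i * y%:C) = c.
Proof. by rewrite !cReImE /=; ring. Qed.
Let ImL (y : R) : Im (c%:C + 'i * y%:C) = y.
Proof. by rewrite !cReImE /=; ring. Qed.

Lemma cBeta_line (y : R) : cBeta (c%:C + 'i * y%:C) (s - (c%:C + 'i * y%:C)) =
  cintegral mu (fun v : R => cexp ('i * (y * v)%:C) * cbeta_fun c%:C (s - c%:C) v).
Proof. by apply: eq_cintegral => v; exact: cbeta_fun_line. Qed.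

Lemma cmeasurable_cBeta_line :
  cmeasurable (fun y : R => cBeta (c%:C + 'i * y%:C) (s - (c%:C + 'i * y%:C))).
Proof.
under eq_fun do rewrite cBeta_line.
by apply: cmeasurable_fourier; exact: cintegrable_cbeta_fun.
Qed.

Lemma cBeta_line_le : exists K : R, forall y : R,
  normc (cBeta (c%:C + 'i * y%:C) (s - (c%:C + 'i * y%:C))) <= K * (oneDsqr y)^-1.
Proof.
exists (4 * rGamma (c + 1 + 1) * rGamma (Re s - c) *
    (normc (cGamma s))^-1 * (1 + c ^- 2)) => y.
have h1 : 0 < Re (c%:C + 'i * y%:C) by rewrite ReL.
have h2 : 0 < Re (s - (c%:C + 'i * y%:C)) by rewrite cReD cReN ReL subr_gt0.
have := cBeta_le h1 h2; rewrite (cReD s) cReN ReL ImL.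
by rewrite (_ : c%:C + 'i * y%:C + (s - (c%:C + 'i * y%:C)) = s)//; ring.
Qed.

Lemma cBeta_inversion (v0 : R) :
  cintegral mu (fun y : R => cBeta (c%:C + 'i * y%:C) (s - (c%:C + 'i * y%:C)) *
     cexp (- ((c%:C + 'i * y%:C) * v0%:C))) =
  (2 * pi)%:C * cexp (- (s * (ln (1 + expR v0))%:C)).
Proof.
have [K HK] := cBeta_line_le.
have IF : cintegrable mu (fun y : R => cBeta (c%:C + 'i * y%:C) (s - (c%:C + 'i * y%:C))).
  apply: (@le_cintegrable _ _ R mu _ (fun y : R => K * (oneDsqr y)^-1)) => //.
  - exact: cmeasurable_cBeta_line.
  - exact: integrable_oneDsqrV.
have Ib := @cintegrable_cbeta_fun R c%:C _ c0 w0.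
(* Boundedness is a hypothesis of [fourier_inversion]; here it follows from c v <= c ln (1 + exp v)
   <= Re s ln (1 + exp v). *)
have bb v : normc (cbeta_fun c%:C (s - c%:C) v) <= 1.
  rewrite normc_cbeta_fun /= -[leRHS]expR0 ler_expR subr_le0.
  rewrite cReD cReN /= addrC subrK.
  apply: (@le_trans _ _ (c * ln (1 + expR v))).
    by rewrite ler_pM2l// ln1expR_ge.
  by rewrite ler_wpM2r ?ln1expR_ge0// ltW.
have := @fourier_inversion R (cbeta_fun c%:C (s - c%:C)) 1 v0
  (ccontinuous_cbeta_fun _ _) bb Ib.
under eq_fun do rewrite -cBeta_line.
(* The factor exp (- c v0) completes the character exp (- i y v0) to exp (- u v0) at the point u of
   the line. *)
move=> /(_ IF) /(congr1 (fun x => cexp (- (c%:C * v0%:C)) * x)).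
rewrite -cintegralZl; last first.
  apply: (@le_cintegrable _ _ R mu _ (fun y : R => K * (oneDsqr y)^-1)) => //.
  - apply: cmeasurableM; first exact: cmeasurable_cBeta_line.
    under eq_fun do rewrite -mulrN -rmorphN.
    apply: cmeasurable_cexp_i; apply: measurableT_comp => //.
    exact: measurable_funM.
  - move=> y; rewrite normcM_cexpNi; exact: HK.
  - exact: integrable_oneDsqrV.
rewrite mulrCA /cbeta_fun -cexpD.
have -> : - (c%:C * v0%:C) + (c%:C * v0%:C - (c%:C + (s - c%:C)) * (ln (1 + expR v0))%:C) =
  - (s * (ln (1 + expR v0))%:C) by ring.
move=> <-; apply: eq_cintegral => y.
rewrite [RHS]mulrCA -[X in _ = _ * X]cexpD rmorphM /=.
by congr (_ * cexp _); ring.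
Qed.

End beta_line.

(** * Inversion of the kernel of the logarithm *)

Section log_pair.
Variable c : R.
Hypotheses (c0 : 0 < c) (c1 : c < 1).

Let L (v : R) := ln (1 + expR v).
Let lf (v : R) : C := (expR (- (c * v)) * L v)%:C.

(** For v >= 0, half of the decay exp (- c v) absorbs the growth ln (1 + exp v) <= 1 + v, at the
    cost 1 + v <= (1 + 2 / c) (1 + c v / 2). For v <= 0, ln (1 + exp v) <= exp v leaves the rate 1 -
    c. This is where the strip 0 < c < 1 comes from. *)
Lemma decays_log (s : C) : Re s = c -> decays (fun v : R => cexp (- (s * v%:C)) * (L v)%:C).
Proof.
move=> sc; exists (1 + 2 / c), (Num.min (1 - c) (c / 2)).
rewrite lt_min subr_gt0 c1 divr_gt0//; split => // v.
have L0 : 0 <= L v := ln1expR_ge0 v.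
rewrite ComplexField.Normc.normcM normcR ger0_norm// normc_cexp !cReImE sc /= mulr0 subr0.
have k0 : 0 < 2 / c by rewrite divr_gt0.
have [v0|/ltW v0] := leP 0 v.
  have hL : L v <= 1 + v.
    rewrite /L -[leRHS]expRK ler_ln ?posrE ?expR_gt0 ?addr_gt0 ?expR_gt0// expRD.
    have e1 := @expR_ge1Dx R 1.
    have : 1 <= expR v by rewrite -expR0 ler_expR.
    nra.
  have hm : Num.min (1 - c) (c / 2) <= c / 2 by rewrite ge_min lexx orbT.
  rewrite ger0_norm//.
  apply: (@le_trans _ _ ((1 + 2 / c) * expR (- (c / 2 * v)))); last first.
    by rewrite ler_wpM2l ?addr_ge0 ?(ltW k0)// ler_expR lerN2 ler_wpM2r.
  have -> : expR (- (c * v)) = expR (- (c / 2 * v)) * expR (- (c / 2 * v)).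
    by rewrite -expRD; congr expR; field.
  rewrite [leRHS]mulrC -[leLHS]mulrA ler_wpM2l ?expR_ge0//.
  rewrite expRN mulrC ler_pdivrMr ?expR_gt0//.
  apply: (le_trans hL).
  apply: (@le_trans _ _ ((1 + 2 / c) * (1 + c / 2 * v))); last first.
    by rewrite ler_wpM2l ?addr_ge0 ?(ltW k0)// expR_ge1Dx.
  have -> : (1 + 2 / c) * (1 + c / 2 * v) = 1 + v + (2 / c + c / 2 * v).
    by field; rewrite gt_eqF.
  by rewrite lerDl addr_ge0 ?(ltW k0)// mulr_ge0// divr_ge0// ltW.
have hL : L v <= expR v by rewrite /L le_ln1Dx// (lt_trans _ (expR_gt0 v))// ltrN10.
have hm : Num.min (1 - c) (c / 2) <= 1 - c by rewrite ge_min lexx.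
apply: (@le_trans _ _ (1 * expR (- (c * v) + v))).
  by rewrite mul1r expRD ler_wpM2l ?expR_ge0.
rewrite ler_pM ?expR_ge0// ?lerDl ?(ltW k0)// ler_expR ler0_norm//.
nra.
Qed.

Lemma ccontinuous_log (s : C) :
  ccontinuous (fun v : R => cexp (- (s * v%:C)) * (L v)%:C).
Proof.
apply: ccontinuousM.
  apply: ccontinuous_exp; under eq_fun do rewrite -mulNr.
  exact: ccontinuous_lin.
by apply: ccontinuous_real; exact: continuous_ln1expR.
Qed.

Lemma cintegrable_log (s : C) : Re s = c ->
  cintegrable mu (fun v : R => cexp (- (s * v%:C)) * (L v)%:C).
Proof.
move=> sc; apply: decays_cintegrable; last exact: decays_log.
exact/ccontinuous_measurable/ccontinuous_log.
Qed.

(** Integration by parts: differentiating the logarithm gives exp v / (1 + exp v), so s times the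
    integral is the Beta value B (1 - s, s), and Gamma 1 = 1. *)
Lemma cintegral_log (s : C) : Re s = c ->
  cintegral mu (fun v : R => cexp (- (s * v%:C)) * (L v)%:C) =
  cGamma s * cGamma (1 - s) / s.
Proof.
move=> sc; have s0 : 0 < Re s by rewrite sc.
have s1 : 0 < Re (1 - s) by rewrite !cReImE sc subr_gt0.
have n0 : s != 0 by rewrite eq_complex negb_and gt_eqF.
have [K [e [e0 h]]] := decays_log sc.
have [l1 l2] := ccvg_decay e0 h.
pose G v := cexp (- (s * v%:C)) * (L v)%:C.
have d (v : R) : is_cderive v G ((- s) * G v + cbeta_fun (1 - s) s v).
  have h1 : is_cderive v (fun y : R => y%:C : C) 1.
    by apply: is_cderive_real; exact: is_derive_id.
  have h2 : is_cderive v (fun y : R => (L y)%:C : C) (expR v / (1 + expR v))%:C.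
    apply: is_cderive_real.
    have q : is_derive v 1 (fun y : R => 1 + expR y) (expR v).
      by have := is_deriveD (is_derive_cst (1 : R) v 1) (is_derive_expR v); rewrite add0r.
    have p : 0 < 1 + expR v by rewrite addr_gt0// expR_gt0.
    have r := is_derive1_ln p.
    by have := @is_derive1_comp R (@ln R) (fun y : R => 1 + expR y) v _ _ r q; rewrite mulrC.
  have h3 := is_cderiveM (is_cderive_exp (is_cderiveM (is_cderive_cst v (- s)) h1)) h2.
  move: h3; under eq_fun do rewrite mulNr.
  rewrite mul0r add0r mulr1 -mulrA (_ : - s * v%:C = - (s * v%:C)); last by rewrite mulNr.
  have -> : cexp (- (s * v%:C)) * (expR v / (1 + expR v))%:C = cbeta_fun (1 - s) s v.
    rewrite /cbeta_fun -[expR v / _](_ : expR (v - ln (1 + expR v)) = _); last first.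
      by rewrite expRD expRN lnK// posrE addr_gt0// expR_gt0.
    by rewrite -cexpR -cexpD rmorphB /=; congr cexp; ring.
  by [].
have cd : ccontinuous (fun v => (- s) * G v + cbeta_fun (1 - s) s v).
  apply: ccontinuousD; last exact: ccontinuous_cbeta_fun.
  by apply: ccontinuousM; [exact: ccontinuous_cst|exact: ccontinuous_log].
have Ib := cintegrable_cbeta_fun s1 s0.
have IG : cintegrable mu G := cintegrable_log sc.
have := @cFTC_line R _ _ _ _ (fun v => (- s) * G v + cbeta_fun (1 - s) s v)
  0 0 d cd d cd (fun=> fun=> erefl) (fun=> fun=> erefl) _ l1 l2.
rewrite cintegralD//; last exact: cintegrableZl.
rewrite cintegralZl// -/(cBeta _ _) => /(_ _)/wrap[].
  by apply: cintegrableD => //; exact: cintegrableZl.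
rewrite sub0r subr0 addNr cBeta_gamma// subrK cGamma1 divr1 mulNr => /eqP.
rewrite addrC subr_eq0 => /eqP E; rewrite [cGamma s * _]mulrC E.
by rewrite mulrAC mulfV// mul1r.
Qed.

Let ReL (y : R) : Re (c%:C - 'i * y%:C) = c.
Proof. by rewrite !cReImE /=; ring. Qed.
Let ImL (y : R) : Im (c%:C - 'i * y%:C) = - y.
Proof. by rewrite !cReImE /=; ring. Qed.

Let lfE v : lf v = cexp (- (c%:C * v%:C)) * (L v)%:C.
Proof. by rewrite -rmorphM -rmorphN cexpR -rmorphM. Qed.

(** The line in s is traversed downwards because t1 = - a1 - s moves upwards. With this orientation
    the integrand carries the character exp (i y v), as in [fourier_inversion]. *)
Lemma log_line (y : R) :
  cGamma (c%:C - 'i * y%:C) * cGamma (1 - (c%:C - 'i * y%:C)) / (c%:C - 'i * y%:C) =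
  cintegral mu (fun v : R => cexp ('i * (y * v)%:C) * lf v).
Proof.
rewrite -cintegral_log//; apply: eq_cintegral => v.
rewrite lfE mulrA -cexpD rmorphM /=.
by congr (cexp _ * _); ring.
Qed.

Let Ilf : cintegrable mu lf.
Proof.
by have := @cintegrable_log c%:C erefl; apply: eq_cintegrable => v; rewrite lfE.
Qed.

Lemma cmeasurable_log_line : cmeasurable (fun y : R =>
  cGamma (c%:C - 'i * y%:C) * cGamma (1 - (c%:C - 'i * y%:C)) / (c%:C - 'i * y%:C)).
Proof. by under eq_fun do rewrite log_line; exact: cmeasurable_fourier. Qed.

(** One use of the functional equation suffices: Gamma s = Gamma (s + 1) / s, and the kernel already
    contains a second factor 1 / s. *)
Lemma log_line_le : exists K : R, forall y : R,
  normc (cGamma (c%:C - 'i * y%:C) * cGamma (1 - (c%:C - 'i * y%:C)) /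
    (c%:C - 'i * y%:C)) <= K * (oneDsqr y)^-1.
Proof.
exists (4 * rGamma (c + 1) * rGamma (1 - c) * (1 + c ^- 2)) => y.
set s := c%:C - 'i * y%:C.
have sc : Re s = c := ReL y.
have si : Im s = - y := ImL y.
have s0 : 0 < Re s by rewrite sc.
have s1 : 0 < Re (1 - s) by rewrite cReD cReN sc subr_gt0.
have s2 : 0 < Re (s + 1) by rewrite cReD addr_gt0.
have n0 : s != 0 by rewrite eq_complex negb_and gt_eqF.
have -> : cGamma s * cGamma (1 - s) / s = (cGamma (s + 1) * cGamma (1 - s)) * (s^-1 * s^-1).
  by rewrite cGammaD1//; field.
rewrite normcMM ComplexField.Normc.normcV -invfM -expr2.
rewrite -[X in _ <= X]mulrA.
have g0 := normc_ge0.
apply: ler_pM; rewrite ?mulr_ge0 ?invr_ge0 ?exprn_ge0 ?g0//.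
  have -> : 4 * rGamma (c + 1) * rGamma (1 - c) =
    (2 * rGamma (c + 1)) * (2 * rGamma (1 - c)) by ring.
  apply: ler_pM => //.
    by have := normc_cGamma_le s2; rewrite cReD sc.
  by have := normc_cGamma_le s1; rewrite cReD cReN sc.
by have := normcV_line_le s0; rewrite sc si /oneDsqr sqrrN.
Qed.

Lemma log_inversion (v0 : R) :
  cintegral mu (fun y : R => cGamma (c%:C - 'i * y%:C) *
    cGamma (1 - (c%:C - 'i * y%:C)) / (c%:C - 'i * y%:C) *
    cexp ((c%:C - 'i * y%:C) * v0%:C)) = (2 * pi * ln (1 + expR v0))%:C.
Proof.
have [K HK] := log_line_le.
have IF : cintegrable mu (fun y : R => cGamma (c%:C - 'i * y%:C) *
    cGamma (1 - (c%:C - 'i * y%:C)) / (c%:C - 'i * y%:C)).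
  apply: (@le_cintegrable _ _ R mu _ (fun y : R => K * (oneDsqr y)^-1)) => //.
  - exact: cmeasurable_log_line.
  - exact: integrable_oneDsqrV.
have [K' [e [e0 h]]] := @decays_log c%:C erefl.
have bb v : normc (lf v) <= `|K'|.
  rewrite lfE (le_trans (h v))// -[leRHS]mulr1.
  apply: (@le_trans _ _ (`|K'| * expR (- (e * `|v|)))).
    by rewrite ler_wpM2r ?expR_ge0// ler_norm.
  by rewrite ler_wpM2l// -expR0 ler_expR oppr_le0 mulr_ge0// ltW.
have clf : ccontinuous lf.
  by have := @ccontinuous_log c%:C; apply: eq_ccontinuous => v; rewrite lfE.
have := @fourier_inversion R lf _ v0 clf bb Ilf.
under eq_fun do rewrite -log_line.
move=> /(_ IF) /(congr1 (fun x => cexp (c%:C * v0%:C) * x)).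
rewrite -cintegralZl; last first.
  apply: (@le_cintegrable _ _ R mu _ (fun y : R => K * (oneDsqr y)^-1)) => //.
  - apply: cmeasurableM; first exact: cmeasurable_log_line.
    under eq_fun do rewrite -mulrN -rmorphN.
    apply: cmeasurable_cexp_i; apply: measurableT_comp => //.
    exact: measurable_funM.
  - move=> y; rewrite normcM_cexpNi; exact: HK.
  - exact: integrable_oneDsqrV.
have -> : cexp (c%:C * v0%:C) * ((2 * pi)%:C * lf v0) = (2 * pi * ln (1 + expR v0))%:C.
  by rewrite lfE cexpN rmorphM /= -/(L v0); field; exact: cexp_neq0.
move=> <-.
apply: eq_cintegral => y; rewrite [RHS]mulrCA -[X in _ = _ * X]cexpD rmorphM /=.
by congr (_ * cexp _); ring.
Qed.

End log_pair.

End mellin_pairs.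

(** * The alpha-mu law *)

Section exp_substitution.
Variable R : realType.
Local Notation mu := (@lebesgue_measure R).

(** An alpha-mu density may be unbounded at 0, so continuity is available only on the open
    half-line. The substitution is made on compact intervals exhausting it, and monotone convergence
    passes to the limit on both sides. *)
Lemma ge0_integral_expR_substitution (k : R -> R) (a b : R) : 0 < a ->
  measurable_fun setT k -> (forall x, 0 < x -> {for x, continuous k}) ->
  (forall x, 0 <= k x) -> (forall x, x <= 0 -> k x = 0) ->
  (\int[mu]_x (k x)%:E =
   \int[mu]_v (k (expR (a * v + b)) * (expR (a * v + b) * a))%:E)%E.
Proof.
move=> a0 mk ck k0 kn; pose F v := expR (a * v + b).
have dF (v : R) : is_derive v 1 F (expR (a * v + b) * a).
  have d1 : is_derive v 1 (fun v : R => a * v + b) a.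
    by apply: is_derive_eq; rewrite /= addr0 /GRing.scale/= mulr1.
  exact: (@is_derive1_comp R (@expR R) (fun v : R => a * v + b) v _ _ _ d1).
have F'E : F^`() = (fun v => expR (a * v + b) * a).
  by apply/funext => v; rewrite derive1E; apply: derive_val.
have cF : continuous F.
  move=> x; apply/differentiable_continuous/derivable1_diffP.
  by have [] := dF x.
have cF' : continuous F^`().
  by rewrite F'E => x; apply: cvgM; [exact: cF|exact: cvg_cst].
have mF : {homo F : x y / x < y}.
  by move=> x y xy; rewrite /F ltr_expR ltrD2r ltr_pM2l.
have mF' : {homo F : x y / x <= y}.
  by move=> x y xy; rewrite /F ler_expR lerD2r ler_pM2l.
pose A (n : nat) : set R := `[F (- n.+1%:R), F n.+1%:R].
pose B (n : nat) : set R := `[- n.+1%:R, n.+1%:R].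
have AB n : (\int[mu]_(x in A n) (k x)%:E =
    \int[mu]_(v in B n) (k (expR (a * v + b)) * (expR (a * v + b) * a))%:E)%E.
  have nn : - n.+1%:R < n.+1%:R :> R by rewrite (lt_trans (y := 0))// oppr_lt0.
  rewrite /A (@integration_by_substitution_increasing R F k) ?(ltW nn)//.
  - by rewrite F'E.
  - by move=> x y _ _; exact: mF.
  - by apply/cvg_ex; exists (F^`() (- n.+1%:R)); apply: cvg_at_right_filter; exact: cF'.
  - by apply/cvg_ex; exists (F^`() n.+1%:R); apply: cvg_at_left_filter; exact: cF'.
  - split=> [x _| |]; first by have [] := dF x.
      by apply: cvg_at_right_filter; exact: cF.
    by apply: cvg_at_left_filter; exact: cF.
  - apply: continuous_in_subspaceT => x; rewrite inE /= in_itv /= => /andP[h _].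
    by apply: ck; rewrite (lt_le_trans _ h)// expR_gt0.
have subn (x : R) : exists n : nat, `|x| <= n.+1%:R.
  by exists (Num.trunc `|x|); exact: ltW (truncnS_gt _).
have Bmono : {homo B : n m / (n <= m)%N >-> (n <= m)%O}.
  move=> n m nm; apply/subsetPset => x; rewrite /B /= !in_itv /= => /andP[h1 h2].
  have nm' : n.+1%:R <= m.+1%:R :> R by rewrite ler_nat.
  by rewrite (le_trans _ h1) ?lerN2// (le_trans h2).
have Amono : {homo A : n m / (n <= m)%N >-> (n <= m)%O}.
  move=> n m nm; apply/subsetPset => x; rewrite /A /= !in_itv /= => /andP[h1 h2].
  have nm' : n.+1%:R <= m.+1%:R :> R by rewrite ler_nat.
  by rewrite (le_trans _ h1) ?mF' ?lerN2// (le_trans h2)// mF'.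
have UB : \bigcup_n B n = setT.
  apply/seteqP; split => // x _; have [n hn] := subn x; exists n => //.
  by rewrite /B /= in_itv /= -ler_norml.
have UA : \bigcup_n A n = `]0, +oo[%classic.
  apply/seteqP; split => [x [n _]|x]; rewrite /A /= !in_itv /=.
    by move=> /andP[h _]; rewrite andbT (lt_le_trans _ h)// expR_gt0.
  rewrite andbT => x0; have [n] := subn ((ln x - b) / a); rewrite ler_norml => /andP[h1 h2].
  exists n => //=; rewrite in_itv /= /F -{1}[x]lnK ?posrE// -{2}[x]lnK ?posrE// !ler_expR.
  by move: h1 h2; rewrite ler_pdivlMr// ler_pdivrMr// lerBrDr lerBlDr ![_ * a]mulrC => -> ->.
have mkF : measurable_fun setT (fun v => k (expR (a * v + b)) * (expR (a * v + b) * a)).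
  apply: measurable_funM.
    by apply: (measurableT_comp mk); exact: continuous_measurable_fun.
  by rewrite -F'E; exact: continuous_measurable_fun.
have lA : (fun n => \int[mu]_(x in A n) (k x)%:E)%E @ \oo --> (\int[mu]_x (k x)%:E)%E.
  have -> : (\int[mu]_x (k x)%:E = \int[mu]_(x in \bigcup_n A n) (k x)%:E)%E.
    rewrite UA [RHS]integral_mkcond; apply: eq_integral => x _; rewrite patchE.
    case: ifPn => // /negP; rewrite inE /= in_itv /= andbT => /negP.
    by rewrite -leNgt => /kn ->.
  apply: ge0_nondecreasing_set_cvg_integral => //.
  - by move=> n; exact: measurable_itv.
  - by move=> n; apply/measurable_EFinP; exact: measurable_funTS.
  - by move=> n x _; rewrite lee_fin.
have lB : (fun n => \int[mu]_(v in B n) (k (expR (a * v + b)) * (expR (a * v + b) * a))%:E)%E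
    @ \oo --> (\int[mu]_v (k (expR (a * v + b)) * (expR (a * v + b) * a))%:E)%E.
  rewrite -[X in _ --> (\int[_]_(x in X) _)%E]UB.
  apply: ge0_nondecreasing_set_cvg_integral => //.
  - by move=> n; exact: measurable_itv.
  - by move=> n; apply/measurable_EFinP; exact: measurable_funTS.
  - by move=> n x _; rewrite lee_fin !mulr_ge0 ?expR_ge0 ?(ltW a0).
move: lA; rewrite (_ : (fun n => _) = (fun n =>
  \int[mu]_(v in B n) (k (expR (a * v + b)) * (expR (a * v + b) * a))%:E)%E).
  by move=> lA; apply: (cvg_unique _ lA lB).
by apply/funext => n; exact: AB.
Qed.

End exp_substitution.

(** * Expectations under a law with a density *)

Section density.
Context d (T : measurableType d) (R : realType) (P : probability T R).
Local Notation mu := (@lebesgue_measure R).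

(** The law of [Y] is absolutely continuous, and its Radon-Nikodym derivative agrees almost
    everywhere with [p] because both have the same integral over every measurable set. *)
Lemma ge0_integral_density (Y : T -> R) (p h : R -> R) :
  measurable_fun setT Y -> measurable_fun setT p -> (forall x, 0 <= p x) ->
  (forall A : set R, measurable A ->
     P (Y @^-1` A) = (\int[mu]_(x in A) (p x)%:E)%E) ->
  measurable_fun setT h -> (forall x, 0 <= h x) ->
  (\int[P]_w (h (Y w))%:E = \int[mu]_x (h x * p x)%:E)%E.
Proof.
move=> mY mp p0 Pp mh h0.
have mY' : measurable_fun setT (Y : T -> measurableTypeR R) := mY.
pose X : {mfun T >-> measurableTypeR R} :=
  HB.pack (Y : T -> measurableTypeR R) (isMeasurableFun.Build _ _ _ _ _ mY').
pose nu : probability (measurableTypeR R) R := distribution P X.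
have nuE A : measurable A -> nu A = (\int[mu]_(x in A) (p x)%:E)%E.
  by move=> mA; rewrite -Pp.
have Ip : mu.-integrable setT (EFin \o p).
  apply/integrableP; split; first exact/measurable_EFinP.
  under eq_integral do rewrite /= ger0_norm//.
  by rewrite -nuE// probability_setT ltry.
have numu : nu `<< mu.
  apply/null_content_dominatesP => A mA A0; rewrite nuE//.
  by apply: null_set_integral => //; apply/measurable_EFinP; exact: measurable_funTS.
have -> : (\int[P]_w (h (Y w))%:E = \int[nu]_x (h x)%:E)%E.
  rewrite (ge0_integral_distribution X (f := EFin \o h))//.
  exact/measurable_EFinP.
rewrite -(@Radon_Nikodym_SigmaFinite.change_of_variables _ _ _ nu mu numu (EFin \o h))//;
  last exact/measurable_EFinP.
have If := Radon_Nikodym_SigmaFinite.f_integrable numu.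
apply: ae_eq_integral => //.
- apply: emeasurable_funM; first exact/measurable_EFinP.
  exact: measurable_int If.
- by apply/measurable_EFinP; exact: measurable_funM.
- have : ae_eq mu setT (Radon_Nikodym_SigmaFinite.f nu mu) (EFin \o p).
    apply: integral_ae_eq => //; first exact/measurable_EFinP.
    by move=> E _ mE; rewrite -[RHS]nuE// (Radon_Nikodym_SigmaFinite.f_integral numu mE).
  by apply: filterS => x /(_ I) -> _.
Qed.

End density.

Section alpha_mu.
Context d (T : measurableType d) (R : realType) (P : probability T R).
Local Notation mu := (@lebesgue_measure R).
Local Notation C := (R[i]).
Variables (Y : T -> R) (al m gb : R).
Hypotheses (al0 : 0 < al) (m0 : 0 < m) (gb0 : 0 < gb).
Hypothesis HY : is_alpha_mu P Y al m gb.

Let b := amu_beta al m gb.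
Let G := GammaR m.

Lemma alpha_mu_measurable : measurable_fun setT Y. Proof. by case: HY. Qed.

Lemma GammaR_ge0 (x : R) : 0 <= GammaR x.
Proof.
by apply: Rintegral_ge0 => t _; rewrite mulr_ge0 ?powR_ge0 ?expR_ge0.
Qed.

(** A law has total mass 1. This yields the positivity of [GammaR m] and of the scale: were either
    of them 0, the convention 0^-1 = 0 would make the density vanish identically. *)
Lemma alpha_mu_pdf_nontrivial : ~ (forall x, amu_pdf al m gb x = 0).
Proof.
move=> h; have [_ /(_ setT measurableT)] := HY.
rewrite preimage_setT probability_setT (eq_integral (fun=> 0%E)); last first.
  by move=> x _; rewrite h.
by rewrite integral0 => /eqP; rewrite onee_eq0.
Qed.

Lemma GammaR_gt0 : 0 < G.
Proof.
rewrite lt_neqAle GammaR_ge0 andbT; apply/eqP => G0.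
apply: alpha_mu_pdf_nontrivial => x; rewrite /amu_pdf -/G -G0 mulr0 invr0 mulr0 mul0r.
by case: ifP.
Qed.

Lemma amu_beta_gt0 : 0 < b.
Proof.
have b0 : 0 <= b by rewrite /b divr_ge0 ?mulr_ge0 ?GammaR_ge0// ltW.
rewrite lt_neqAle b0 andbT; apply/eqP => b00.
apply: alpha_mu_pdf_nontrivial => x; rewrite /amu_pdf -/b -b00 powR0; last first.
  by rewrite gt_eqF// divr_gt0// mulr_gt0.
by rewrite mulr0 mul0r invr0 mulr0 mul0r; case: ifP.
Qed.

Let q (x : R) := al / (2 * expR (al * m / 2 * ln b) * G) *
  expR ((al * m / 2 - 1) * ln x) * expR (- expR (al / 2 * (ln x - ln b))).

Lemma amu_pdfE (x : R) : amu_pdf al m gb x = (q \_ `]0, +oo[) x.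
Proof.
rewrite patchE /amu_pdf; have [x0|x0] := ltP 0 x; last first.
  by case: ifPn => //; rewrite inE /= in_itv /= andbT ltNge x0.
rewrite mem_set /= ?in_itv /= ?x0//.
have b0 := amu_beta_gt0.
have pE (y r : R) : 0 < y -> y `^ r = expR (r * ln y) by move=> y0; rewrite /powR gt_eqF.
rewrite /q -/b -/G (pE x)// (pE b)// (pE (x / b)) ?mulr_gt0 ?invr_gt0//.
by rewrite ln_div ?posrE//; congr (_ * _); rewrite mulrAC.
Qed.

Lemma measurable_amu_pdf : measurable_fun setT (amu_pdf al m gb).
Proof.
rewrite (_ : amu_pdf al m gb = q \_ `]0, +oo[); last exact/funext/amu_pdfE.
apply/(measurable_restrictT _ _).1 => //; apply: measurable_funTS.
have ml := @measurable_ln R.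
apply: measurable_funM; [apply: measurable_funM => //|]; apply: measurableT_comp => //.
  exact: measurable_funM.
apply: measurableT_comp => //; apply: measurableT_comp => //.
by apply: measurable_funM => //; exact: measurable_funB.
Qed.

Lemma amu_pdf_ge0 x : 0 <= amu_pdf al m gb x.
Proof.
rewrite amu_pdfE patchE; case: ifP => // _.
have G0 := GammaR_gt0.
by rewrite !mulr_ge0 ?expR_ge0 ?invr_ge0 ?mulr_ge0 ?expR_ge0 ?(ltW al0) ?(ltW G0).
Qed.

(** The substitution v = (al / 2) ln (x / b) turns the density into the normalised integrand of
    Gamma m: (Y / b)^(al / 2) has a Gamma law of shape [m]. *)
Lemma amu_pdf_expR (v : R) : let x := expR (2 / al * v + ln b) in
  amu_pdf al m gb x * (x * (2 / al)) = G^-1 * expR (m * v - expR v).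
Proof.
move=> x; rewrite amu_pdfE patchE mem_set /= ?in_itv /= ?expR_gt0//.
have G0 := GammaR_gt0.
rewrite /q /x expRK.
have -> : al / 2 * (2 / al * v + ln b - ln b) = v by field; rewrite gt_eqF.
have -> : expR ((al * m / 2 - 1) * (2 / al * v + ln b)) =
    expR (al * m / 2 * ln b) * expR (m * v) / expR (2 / al * v + ln b).
  by rewrite -expRN -!expRD; congr expR; field; rewrite gt_eqF.
have -> : expR (m * v - expR v) = expR (m * v) * expR (- expR v) by rewrite expRD.
by field; rewrite !gt_eqF ?expR_gt0.
Qed.

Lemma ge0_alpha_mu_law (h : R -> R) : measurable_fun setT h -> (forall x, 0 <= h x) ->
  (forall x, 0 < x -> {for x, continuous h}) ->
  (\int[P]_w (h (Y w))%:E =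
   \int[mu]_v (h (expR (2 / al * v + ln b)) * (G^-1 * expR (m * v - expR v)))%:E)%E.
Proof.
move=> mh h0 ch; have [mY HP] := HY.
rewrite (ge0_integral_density mY measurable_amu_pdf amu_pdf_ge0 HP mh h0).
rewrite (@ge0_integral_expR_substitution R (fun x => h x * amu_pdf al m gb x) (2 / al) (ln b)).
- by apply: eq_integral => v _; rewrite -mulrA amu_pdf_expR.
- by rewrite divr_gt0.
- by apply: measurable_funM => //; exact: measurable_amu_pdf.
- move=> x x0; apply: cvgM; first exact: ch.
  have cq : {for x, continuous q}.
    have cl := continuous_ln x0.
    apply: cvgM; [apply: cvgM; first exact: cvg_cst|]; apply: continuous_cvg.
    + exact: continuous_expR.
    + by apply: cvgM; [exact: cvg_cst|exact: cl].
    + exact: continuous_expR.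
    + apply: cvgN; apply: continuous_cvg; first exact: continuous_expR.
      apply: cvgM; first exact: cvg_cst.
      by apply: cvgB; [exact: cl|exact: cvg_cst].
  have E (y : R) : 0 < y -> amu_pdf al m gb y = q y.
    by move=> y0; rewrite amu_pdfE patchE mem_set// /= in_itv /= y0.
  rewrite E//; apply: cvg_trans cq; apply: near_eq_cvg.
  near=> y; rewrite E//; near: y.
  exact: lt_nbhsr.
- by move=> x; rewrite mulr_ge0// amu_pdf_ge0.
- by move=> x x0; rewrite /amu_pdf ltNge x0 /= mulr0.
Unshelve. all: by end_near. Qed.

Lemma alpha_mu_law (h : R -> R) : measurable_fun setT h ->
  (forall x, 0 < x -> {for x, continuous h}) ->
  (\int[P]_w (h (Y w))%:E =
   \int[mu]_v (h (expR (2 / al * v + ln b)) * (G^-1 * expR (m * v - expR v)))%:E)%E.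
Proof.
move=> mh ch; have G0 := GammaR_gt0.
have w0 (v : R) : 0 <= G^-1 * expR (m * v - expR v).
  by rewrite mulr_ge0 ?expR_ge0// invr_ge0 ltW.
rewrite [LHS]integralE [RHS]integralE; congr (_ - _)%E.
  rewrite !funerpos [LHS](@ge0_alpha_mu_law h^\+)//.
  - apply: eq_integral => v _ /=; congr (_%:E); rewrite /funrpos.
    by rewrite maxr_pMl ?mul0r.
  - exact: measurable_funrpos.
  - move=> x x0; apply: (@continuous_max _ _ h (fun=> 0)); first exact: ch.
    exact: cvg_cst.
rewrite !funerneg [LHS](@ge0_alpha_mu_law h^\-)//.
- apply: eq_integral => v _ /=; congr (_%:E); rewrite /funrneg.
  by rewrite maxr_pMl ?mul0r ?mulNr.
- exact: measurable_funrneg.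
- move=> x x0; apply: (@continuous_max _ _ (fun x => - h x) (fun=> 0)).
    by apply: cvgN; exact: ch.
  exact: cvg_cst.
Qed.

Lemma alpha_mu_gt0 : {ae P, forall w, 0 < Y w}.
Proof.
have [mY HP] := HY.
exists (Y @^-1` `]-oo, 0]); split.
- by rewrite -[_ @^-1` _]setTI; exact: mY.
- rewrite HP// (eq_integral (fun=> 0%E)) ?integral0// => x; rewrite inE /= in_itv /=.
  by move=> x0; rewrite /amu_pdf ltNge x0.
- by move=> w /= /negP; rewrite in_itv /= -leNgt.
Qed.

(** The moment of order r is a Gamma integral at m + 2 r / al. Negative orders are allowed down to -
    al m / 2, which is the source of the bound Re u < a2 on the contour. *)
Lemma alpha_mu_integrable (r : R) : 0 < m + 2 / al * r ->
  P.-integrable setT (EFin \o (fun w => expR (r * ln (Y w)))).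
Proof.
move=> r0; have [mY _] := HY; have ml := @measurable_ln R.
have mh : measurable_fun setT (fun x : R => expR (r * ln x)).
  by apply: measurableT_comp => //; exact: measurable_funM.
apply/integrableP; split.
  by apply/measurable_EFinP; exact: (measurableT_comp mh).
under eq_integral do rewrite /= ger0_norm ?expR_ge0//.
rewrite (@alpha_mu_law (fun x => expR (r * ln x)) mh); last first.
  move=> x x0; apply: continuous_cvg; first exact: continuous_expR.
  by apply: cvgM; [exact: cvg_cst|exact: continuous_ln].
have E (v : R) : expR (r * ln (expR (2 / al * v + ln b))) * (G^-1 * expR (m * v - expR v)) =
    (G^-1 * expR (r * ln b)) * expR ((m + 2 / al * r) * v - expR v).
  rewrite expRK [LHS]mulrCA -[RHS]mulrA; congr (_ * _).
  by rewrite -!expRD; congr expR; ring.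
under eq_integral do rewrite E.
have /integrableP[_] :=
  integrableZl measurableT (G^-1 * expR (r * ln b)) (integrable_gamma_funr r0).
apply: le_lt_trans; rewrite le_eqVlt; apply/orP; left; apply/eqP.
apply: eq_integral => v _; rewrite /= ger0_norm//.
by rewrite !mulr_ge0 ?expR_ge0// invr_ge0 GammaR_ge0.
Qed.

Lemma alpha_mu_moment (z : C) : 0 < m + 2 / al * Re z ->
  cintegrable P (fun w => cexp (z * (ln (Y w))%:C)) /\
  cintegral P (fun w => cexp (z * (ln (Y w))%:C)) =
    cexp (z * (ln b)%:C) * cGamma (m%:C + (2 / al)%:C * z) / G%:C.
Proof.
move=> z0; have [mY _] := HY; have ml := @measurable_ln R.
have mz : cmeasurable (fun x : R => cexp (z * (ln x)%:C)).
  apply: cmeasurable_exp; apply: cmeasurableM; first exact: cmeasurable_cst.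
  exact: cmeasurable_real.
have [mz1 mz2] := mz.
have cz (x : R) : 0 < x -> {for x, continuous (fun x : R => Re (cexp (z * (ln x)%:C)))} /\
    {for x, continuous (fun x : R => Im (cexp (z * (ln x)%:C)))}.
  move=> x0; have cl := continuous_ln x0.
  have [c1 c2] : ccontinuous (fun t : R => cexp (z * t%:C)).
    exact/ccontinuous_exp/ccontinuous_lin.
  split.
    exact: (@continuous_cvg _ _ _ _ _ (@ln R) (fun t : R => Re (cexp (z * t%:C))) _ (c1 _) cl).
  exact: (@continuous_cvg _ _ _ _ _ (@ln R) (fun t : R => Im (cexp (z * t%:C))) _ (c2 _) cl).
split.
  apply: (le_cintegrable (g := fun w => expR (Re z * ln (Y w)))).
  - exact: (cmeasurable_comp mY mz).
  - by move=> w; rewrite normc_cexp cReM /= mulr0 subr0.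
  - exact: alpha_mu_integrable.
have zG : 0 < Re (m%:C + (2 / al)%:C * z).
  by rewrite cReD cReM /= mul0r subr0.
have E (v : R) : cexp (z * (2 / al * v + ln b)%:C) * (G^-1 * expR (m * v - expR v))%:C =
    (cexp (z * (ln b)%:C) / G%:C) * gamma_fun (m%:C + (2 / al)%:C * z) v.
  have -> : (G^-1 * expR (m * v - expR v))%:C = (G%:C)^-1 * cexp ((m * v - expR v)%:C).
    by rewrite rmorphM /= fmorphV cexpR.
  rewrite mulrCA -cexpD [RHS]mulrAC [RHS]mulrC /gamma_fun -[X in _ = _ * X]cexpD.
  by congr (_ * cexp _); rewrite rmorphD rmorphB !rmorphM /=; ring.
transitivity (cintegral mu (fun v : R => (cexp (z * (ln b)%:C) / G%:C) *
    gamma_fun (m%:C + (2 / al)%:C * z) v)); last first.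
  by rewrite cintegralZl; [rewrite mulrAC|exact: cintegrable_gamma_fun].
apply: complex_eq => /=; rewrite /Rintegral; congr fine.
  rewrite (alpha_mu_law mz1 (fun x x0 => (cz x x0).1)); apply: eq_integral => v _.
  by rewrite expRK -E cReMr.
rewrite (alpha_mu_law mz2 (fun x x0 => (cz x x0).2)); apply: eq_integral => v _.
by rewrite expRK -E cImMr.
Qed.

End alpha_mu.

(** * Independence and Mellin inversion under expectation *)

Section distribution.
Context d d' (T : measurableType d) (T' : measurableType d') (R : realType).
Variables (P : probability T R) (X : {mfun T >-> T'}).
Local Notation C := (R[i]).

Lemma integrable_distributionP (f : T' -> R) : measurable_fun setT f ->
  (distribution P X).-integrable setT (EFin \o f) <->
  P.-integrable setT (EFin \o (f \o X)).
Proof.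
move=> mf; have mfX : measurable_fun setT (f \o X) by exact: measurableT_comp.
have E : (\int[distribution P X]_x `|(EFin \o f) x| =
    \int[P]_w `|(EFin \o (f \o X)) w|)%E.
  rewrite (ge0_integral_distribution X (f := fun x => `|(f x)%:E|%E))//.
  exact/measurable_EFinP/measurableT_comp.
split=> /integrableP[_ h]; apply/integrableP; split.
- exact/measurable_EFinP.
- by rewrite -E.
- exact/measurable_EFinP.
- by rewrite E.
Qed.

Lemma cintegrable_distributionP (f : T' -> C) : cmeasurable f ->
  cintegrable (distribution P X) f <-> cintegrable P (fun w => f (X w)).
Proof.
move=> [m1 m2]; have h1 := integrable_distributionP m1.
have h2 := integrable_distributionP m2.
by split=> -[i1 i2]; split; [exact/h1|exact/h2|exact/h1|exact/h2].
Qed.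

Lemma cintegral_distribution (f : T' -> C) : cmeasurable f ->
  cintegrable P (fun w => f (X w)) ->
  cintegral (distribution P X) f = cintegral P (fun w => f (X w)).
Proof.
move=> [m1 m2] [i1 i2]; apply: complex_eq => /=; rewrite /Rintegral; congr fine.
  by apply: (integral_distribution (X := X) (f := fun x => (Re (f x))%:E)) => //; exact/measurable_EFinP.
by apply: (integral_distribution (X := X) (f := fun x => (Im (f x))%:E)) => //; exact/measurable_EFinP.
Qed.

End distribution.

Section independence.
Context d (T : measurableType d) (R : realType) (P : probability T R).
Local Notation C := (R[i]).

(** Independence identifies the joint law with the product of the marginal laws on rectangles, hence
    everywhere by uniqueness of product measures; Fubini then splits the integral. *)
Lemma indep2_cintegralM (X Y : T -> R) (F H : R -> C) :
  measurable_fun setT X -> measurable_fun setT Y -> indep2 P X Y ->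
  cmeasurable F -> cmeasurable H ->
  cintegrable P (fun w => F (X w)) -> cintegrable P (fun w => H (Y w)) ->
  cintegral P (fun w => F (X w) * H (Y w)) =
  cintegral P (fun w => F (X w)) * cintegral P (fun w => H (Y w)).
Proof.
move=> mX mY XY mF mH IF IH.
pose X' : {mfun T >-> R} := HB.pack X (isMeasurableFun.Build _ _ _ _ X mX).
pose Y' : {mfun T >-> R} := HB.pack Y (isMeasurableFun.Build _ _ _ _ Y mY).
have mXY : measurable_fun setT (fun w => (X w, Y w)) by exact: measurable_fun_pair.
pose XY' : {mfun T >-> (R * R)%type} :=
  HB.pack (fun w => (X w, Y w)) (isMeasurableFun.Build _ _ _ _ (fun w => (X w, Y w)) mXY).
pose n1 : probability R R := distribution P X'.
pose n2 : probability R R := distribution P Y'.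
pose n : probability (R * R)%type R := distribution P XY'.
have nE (S : set (R * R)) : measurable S -> (n1 \x n2)%E S = n S.
  apply: product_measure_unique => A B mA mB.
  by rewrite -[RHS]XY.
have mFH : cmeasurable (fun z : R * R => F z.1 * H z.2).
  apply: cmeasurableM; first exact: (cmeasurable_comp (phi := fst) measurable_fst mF).
  exact: (cmeasurable_comp (phi := snd) measurable_snd mH).
have I1 : cintegrable n1 F by exact/(cintegrable_distributionP P X' mF).
have I2 : cintegrable n2 H by exact/(cintegrable_distributionP P Y' mH).
have I12 : cintegrable (n1 \x n2)%E (fun z : R * R => F z.1 * H z.2).
  apply: (@le_cintegrable_tensor _ _ _ _ R n1 n2 _
    (fun x => `|Re (F x)| + `|Im (F x)|) (fun y => `|Re (H y)| + `|Im (H y)|)) => //.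
  - move=> x y; rewrite ComplexField.Normc.normcM.
    by rewrite ler_pM ?normc_ge0// normc_le.
  - exact: cintegrable_normc.
  - exact: cintegrable_normc.
have eqi (f : R * R -> R) : (n1 \x n2)%E.-integrable setT (EFin \o f) ->
    n.-integrable setT (EFin \o f).
  move=> /integrableP[mf h]; apply/integrableP; split => //.
  by rewrite (eq_measure_integral (n1 \x n2)%E)// => S mS _; exact/esym/nE.
have In : cintegrable n (fun z : R * R => F z.1 * H z.2).
  by have [i1 i2] := I12; split; exact: eqi.
have IP : cintegrable P (fun w => F (X w) * H (Y w)).
  exact: (cintegrable_distributionP P XY' mFH).1 In.
rewrite -[LHS](cintegral_distribution (X := XY') mFH IP).
transitivity (cintegral (n1 \x n2)%E (fun z : R * R => F z.1 * H z.2)).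
  apply: complex_eq => /=; rewrite /Rintegral; congr fine;
    by apply: eq_measure_integral => S mS _; exact/esym/nE.
transitivity (cintegral n1 (fun x => cintegral n2 (fun y => F x * H y))).
  have [i1 i2] := I12; apply: complex_eq => /=.
    by rewrite -(RFubini12 i1).
  by rewrite -(RFubini12 i2).
rewrite -(cintegral_distribution (X := X') mF IF) -(cintegral_distribution (X := Y') mH IH).
rewrite mulrC -cintegralZl//; apply: eq_cintegral => x.
by rewrite cintegralZl// mulrC.
Qed.

End independence.

Section channel.
Context d (T : measurableType d) (R : realType) (P : probability T R).
Local Notation C := (R[i]).
Local Notation mu := (@lebesgue_measure R).

Lemma Re_line (c y : R) : Re (c%:C + 'i * y%:C) = c.
Proof. by rewrite (cReD c%:C) (cReMr 'i) /= mul0r addr0. Qed.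

Lemma Re_lineN (c y : R) : Re (c%:C - 'i * y%:C) = c.
Proof. by rewrite (cReD c%:C) (cReN ('i * y%:C)) (cReMr 'i) /= mul0r oppr0 addr0. Qed.

Lemma normc_cexpMr (z : C) (x : R) : normc (cexp (z * x%:C)) = expR (Re z * x).
Proof. by rewrite normc_cexp (cReMr z). Qed.

Lemma cmeasurable_line (c e : R) : cmeasurable (fun y : R => c%:C + (e%:C * 'i) * y%:C).
Proof.
apply: cmeasurableD; first exact: cmeasurable_cst.
apply: cmeasurableM; first exact: cmeasurable_cst.
exact: cmeasurable_real.
Qed.

Lemma cmeasurable_exp_prod (l : R -> C) (X : T -> R) : cmeasurable l ->
  measurable_fun setT X ->
  cmeasurable (fun p : R * T => cexp (l p.1 * (X p.2)%:C)).
Proof.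
move=> ml mX; apply: cmeasurable_exp; apply: cmeasurableM.
  exact: (cmeasurable_comp (phi := fst) measurable_fst ml).
exact: (cmeasurable_comp (phi := snd) measurable_snd (cmeasurable_real mX)).
Qed.

(** Here exp X plays the role of x in the Beta inversion. The kernel bound times the moment E (exp
    (- c X)) dominates the double integral, so the inversion may be performed pointwise under the
    expectation. *)
Lemma mellin_inv_beta (X : T -> R) (s : C) (c : R) : 0 < c -> c < Re s ->
  measurable_fun setT X ->
  P.-integrable setT (EFin \o (fun w => expR (- c * X w))) ->
  let N := fun y : R => cBeta (c%:C + 'i * y%:C) (s - (c%:C + 'i * y%:C)) *
     cintegral P (fun w => cexp (- (c%:C + 'i * y%:C) * (X w)%:C)) in
  cintegrable mu N /\
  cintegral mu N = (2 * pi)%:C * cintegral P (fun w => cexp (- (s * (ln (1 + expR (X w)))%:C))).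
Proof.
move=> c0 cs mX IX N.
have s0 : 0 < Re s by exact: lt_trans cs.
pose B y := cBeta (c%:C + 'i * y%:C) (s - (c%:C + 'i * y%:C)).
have mB : cmeasurable B := cmeasurable_cBeta_line c0 cs.
have [K HK] := cBeta_line_le c0 cs.
have nE (y : R) w : normc (cexp (- (c%:C + 'i * y%:C) * (X w)%:C)) = expR (- c * X w).
  by rewrite normc_cexpMr (cReN (c%:C + 'i * y%:C)) Re_line.
have ml : cmeasurable (fun y : R => - (c%:C + 'i * y%:C) : C).
  apply: cmeasurableN; apply: eq_cmeasurable (cmeasurable_line c 1) => y.
  by rewrite mul1r.
pose H (p : R * T) := B p.1 * cexp (- (c%:C + 'i * (p.1)%:C) * (X p.2)%:C).
have IH : cintegrable (mu \x P)%E H.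
  apply: (@le_cintegrable_tensor _ _ _ _ R mu P H (fun y : R => K * (oneDsqr y)^-1)
    (fun w => expR (- c * X w))) => //.
  - apply: cmeasurableM; last exact: (cmeasurable_exp_prod ml mX).
    exact: (cmeasurable_comp (phi := fst) measurable_fst mB).
  - move=> y w; rewrite /H (ComplexField.Normc.normcM (B y)) nE.
    by rewrite ler_wpM2r ?expR_ge0// HK.
  - exact: integrable_oneDsqrV.
have Ie (y : R) : cintegrable P (fun w => cexp (- (c%:C + 'i * y%:C) * (X w)%:C)).
  apply: (le_cintegrable (g := fun w => expR (- c * X w))) => //.
  - apply: cmeasurable_exp; apply: cmeasurableM; first exact: cmeasurable_cst.
    exact: cmeasurable_real.
  - by move=> w; rewrite nE.
have NE (y : R) : N y = cintegral P (fun w => H (y, w)).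
  by rewrite /N /H /= cintegralZl.
split.
  apply: eq_cintegrable (cintegrable_cintegral1 IH) => y; exact/esym/NE.
transitivity (cintegral mu (fun y : R => cintegral P (fun w => H (y, w)))).
  by apply: eq_cintegral => y; exact: NE.
rewrite (cFubini IH) -cintegralZl.
  apply: eq_cintegral => w; rewrite -(cBeta_inversion c0 cs (X w)).
  by apply: eq_cintegral => y; rewrite /H mulNr.
apply: (@le_cintegrable _ _ R P _ (fun=> 1)).
- apply: cmeasurable_exp; under eq_fun do rewrite -mulNr.
  apply: cmeasurableM; first exact: cmeasurable_cst.
  apply: cmeasurable_real; apply: (measurableT_comp (f := fun v : R => ln (1 + expR v))) => //.
  by apply: continuous_measurable_fun; exact: continuous_ln1expR.
- move=> w; rewrite normc_cexp cReN cReMr -expR0 ler_expR oppr_le0.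
  by rewrite mulr_ge0 ?(ltW s0)// ?expR0 ln1expR_ge0.
- exact: finite_measure_integrable_cst.
Qed.

Lemma mellin_inv_log (X : T -> R) (c : R) : 0 < c -> c < 1 ->
  measurable_fun setT X ->
  P.-integrable setT (EFin \o (fun w => expR (c * X w))) ->
  let N := fun y : R => cGamma (c%:C - 'i * y%:C) * cGamma (1 - (c%:C - 'i * y%:C)) /
     (c%:C - 'i * y%:C) * cintegral P (fun w => cexp ((c%:C - 'i * y%:C) * (X w)%:C)) in
  [/\ cintegrable mu N,
      P.-integrable setT (EFin \o (fun w => ln (1 + expR (X w)))) &
      cintegral mu N = (2 * pi * \int[P]_w ln (1 + expR (X w)))%:C].
Proof.
move=> c0 c1 mX IX N.
pose B y := cGamma (c%:C - 'i * y%:C) * cGamma (1 - (c%:C - 'i * y%:C)) / (c%:C - 'i * y%:C).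
have mB : cmeasurable B := cmeasurable_log_line c0 c1.
have [K HK] := log_line_le c0 c1.
have nE (y : R) w : normc (cexp ((c%:C - 'i * y%:C) * (X w)%:C)) = expR (c * X w).
  by rewrite normc_cexpMr Re_lineN.
have ml : cmeasurable (fun y : R => c%:C - 'i * y%:C : C).
  apply: eq_cmeasurable (cmeasurable_line c (-1)) => y.
  by rewrite rmorphN mulN1r mulNr.
pose H (p : R * T) := B p.1 * cexp ((c%:C - 'i * (p.1)%:C) * (X p.2)%:C).
have mH : cmeasurable H.
  apply: cmeasurableM; last exact: (cmeasurable_exp_prod ml mX).
  exact: (cmeasurable_comp (phi := fst) measurable_fst mB).
have leH (y : R) w : normc (H (y, w)) <= K * (oneDsqr y)^-1 * expR (c * X w).
  rewrite /H (ComplexField.Normc.normcM (B y)) nE.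
  by rewrite ler_wpM2r ?expR_ge0// HK.
have IH : cintegrable (mu \x P)%E H.
  apply: (@le_cintegrable_tensor _ _ _ _ R mu P H (fun y : R => K * (oneDsqr y)^-1)
    (fun w => expR (c * X w))) => //.
  exact: integrable_oneDsqrV.
(* The same integrand with its factors in the opposite order. Its y-integral is 2 pi ln (1 + exp X),
   so Fubini also yields the integrability of the logarithm. *)
have IH' : cintegrable (P \x mu)%E (fun p : T * R => H (p.2, p.1)).
  apply: (@le_cintegrable_tensor _ _ _ _ R P mu _ (fun w => expR (c * X w))
    (fun y : R => K * (oneDsqr y)^-1)) => //.
  - apply: cmeasurableM; first exact: (cmeasurable_comp (phi := snd) measurable_snd mB).
    apply: cmeasurable_exp; apply: cmeasurableM.
      exact: (cmeasurable_comp (phi := snd) measurable_snd ml).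
    exact: (cmeasurable_comp (phi := fst) measurable_fst (cmeasurable_real mX)).
  - by move=> w y; rewrite [leRHS]mulrC; exact: leH.
  - exact: integrable_oneDsqrV.
have Ie (y : R) : cintegrable P (fun w => cexp ((c%:C - 'i * y%:C) * (X w)%:C)).
  apply: (le_cintegrable (g := fun w => expR (c * X w))) => //.
  - apply: cmeasurable_exp; apply: cmeasurableM; first exact: cmeasurable_cst.
    exact: cmeasurable_real.
  - by move=> w; rewrite nE.
have NE (y : R) : N y = cintegral P (fun w => H (y, w)).
  by rewrite /N /H /= cintegralZl.
have LE w : cintegral mu (fun y : R => H (y, w)) = (2 * pi * ln (1 + expR (X w)))%:C.
  exact: (log_inversion c0 c1 (X w)).
have p0 : 2 * pi != 0 :> R by rewrite gt_eqF// mulr_gt0// pi_gt0.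
have IL : P.-integrable setT (EFin \o (fun w => ln (1 + expR (X w)))).
  have [+ _] := cintegrable_cintegral1 IH'.
  under eq_fun do rewrite LE.
  move=> /(integrableZl measurableT (2 * pi)^-1).
  by congr (_.-integrable _ _); apply/funext => w /=; rewrite -EFinM mulKf.
split => //.
  apply: eq_cintegrable (cintegrable_cintegral1 IH) => y; exact/esym/NE.
transitivity (cintegral mu (fun y : R => cintegral P (fun w => H (y, w)))).
  by apply: eq_cintegral => y; exact: NE.
rewrite (cFubini IH).
transitivity (cintegral P (fun w => (2 * pi * ln (1 + expR (X w)))%:C)).
  by apply: eq_cintegral => w; exact: LE.
by rewrite cintegral_real RintegralZl.
Qed.

End channel.

(** * The function Lambda *)

Section mellin_barnes.
Context (R : realType).
Local Notation C := (R[i]).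
Local Notation mu := (@lebesgue_measure R).

Lemma cintE (f : R -> C) : cint f = cintegral mu f.
Proof. by rewrite [RHS]complexE. Qed.

Lemma mb_lineE (c : R) (f : C -> C) :
  cintegrable mu (fun y : R => f (c%:C + 'i * y%:C)) ->
  mb_line c f = ((2 * pi)%:C)^-1 * cintegral mu (fun y : R => f (c%:C + 'i * y%:C)).
Proof.
move=> If; rewrite /mb_line cintE.
transitivity (((2 * pi)%:C * 'i)^-1 *
  cintegral mu (fun y : R => 'i * f (c%:C + 'i * y%:C))).
  by congr (_ * _); apply: eq_cintegral => y; rewrite mulrC.
rewrite cintegralZl// mulrA; congr (_ * _).
by rewrite invfM mulfVK// neq0Ci.
Qed.

Lemma powR_expR (x a : R) : 0 < x -> x `^ a = expR (a * ln x).
Proof. by move=> x0; rewrite /powR gt_eqF. Qed.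

(** Gamma (- s) = Gamma (1 - s) / (- s) by [GammaC_sub1], while Gamma (1 + s) = s Gamma s; the two
    signs cancel. This disposes of the only Gamma argument in the left half-plane. *)
Lemma cGammaN_reflect (s : C) : 0 < Re s -> Re s < 1 ->
  GammaC (- s) * GammaC (1 + s) / - s = cGamma s * cGamma (1 - s) / s.
Proof.
move=> s0 s1.
have sn0 : s != 0 by apply: contraTneq s0 => ->; rewrite ltxx.
rewrite GammaC_sub1 ?(cReN s) ?oppr_lt0// ?ltrN2//.
rewrite GammaCE ?(cReD 1 s) ?addr_gt0//.
rewrite [cGamma (1 + s)](_ : _ = s * cGamma s); last by rewrite (addrC 1 s) cGammaD1.
rewrite [- s + 1]addrC.
by field.
Qed.

Section integrand.
Variables (A B s2 al1 m1 b1 al2 m2 b2 : R).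
Hypotheses (A0 : 0 < A) (B0 : 0 < B) (s20 : 0 < s2).
Hypotheses (al10 : 0 < al1) (m10 : 0 < m1) (b10 : 0 < b1).
Hypotheses (al20 : 0 < al2) (m20 : 0 < m2) (b20 : 0 < b2).
Hypotheses (G10 : 0 < GammaR m1) (G20 : 0 < GammaR m2).
Let a1 := al1 * m1 / 2.
Let a2 := al2 * m2 / 2.
Let kappa := s2 `^ (a1 + a2) /
  ((A * b1) `^ a1 * GammaR m1 * (B * b2) `^ a2 * GammaR m2).

Lemma kappa_neq0 : kappa != 0.
Proof.
by rewrite gt_eqF// divr_gt0 ?powR_gt0// !mulr_gt0// powR_gt0// mulr_gt0.
Qed.

Lemma cpow_ratioE (x y b : R) (z : C) : 0 < x -> 0 < y -> 0 < b ->
  cpow (x / (y * b)) (- z) = cexp (z * (ln (y / x))%:C) * cexp (z * (ln b)%:C).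
Proof.
move=> x0 y0 b0; rewrite /cpow -cexpD; congr cexp.
rewrite ln_div ?posrE ?mulr_gt0// lnM ?posrE// ln_div ?posrE//.
by rewrite !(rmorphB, rmorphD) /=; ring.
Qed.

(** The substitution t1 = - a1 - s, t2 = u - a2. The bound Re u < a2 keeps the argument m2 - 2 u /
    al2 in the right half-plane, and the quotients by [GammaR m1] and [GammaR m2] complete the
    moments of the two laws. *)
Lemma Lambda_integrandE (s u : C) :
  0 < Re s -> Re s < 1 -> 0 < Re u -> Re u < Re s -> Re u < a2 ->
  kappa%:C * Lambda_integrand A B s2 al1 m1 b1 al2 m2 b2 (- a1%:C - s) (u - a2%:C) =
  (cGamma s * cGamma (1 - s) / s * (cexp (s * (ln (A / s2))%:C) *
    (cexp (s * (ln b1)%:C) * cGamma (m1%:C + (2 / al1)%:C * s) / (GammaR m1)%:C))) *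
  (cBeta u (s - u) * (cexp (- u * (ln (B / s2))%:C) *
    (cexp (- u * (ln b2)%:C) * cGamma (m2%:C + (2 / al2)%:C * - u) / (GammaR m2)%:C))).
Proof.
move=> s0 s1 u0 us ua.
have c2R : (2%:R : R)%:C = 2 :> C by rewrite rmorph_nat.
have al1C : al1%:C != 0 :> C by rewrite fmorph_eq0 gt_eqF.
have al2C : al2%:C != 0 :> C by rewrite fmorph_eq0 gt_eqF.
have su0 : 0 < Re (s - u) by rewrite (cReD s) (cReN u) subr_gt0.
have e1 : - (2%:R%:C * (- a1%:C - s)) / al1%:C = m1%:C + (2 / al1)%:C * s.
  by rewrite /a1 !rmorphM !fmorphV /= c2R; field.
have e2 : - (2%:R%:C * (u - a2%:C)) / al2%:C = m2%:C + (2 / al2)%:C * - u.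
  by rewrite /a2 !rmorphM !fmorphV /= c2R; field.
have e3 : a2%:C + (u - a2%:C) = u by ring.
have e4 : - a1%:C - a2%:C - (- a1%:C - s) - (u - a2%:C) = s - u by ring.
have e5 : - a1%:C - (- a1%:C - s) = s by ring.
have e6 : a1%:C + (- a1%:C - s) = - s by ring.
have e7 : 1 - a1%:C - (- a1%:C - s) = 1 + s by ring.
have r1 : 0 < Re (m1%:C + (2 / al1)%:C * s).
  rewrite (cReD m1%:C) (mulrC _ s) (cReMr s) addr_gt0// mulr_gt0// divr_gt0//.
have r2 : 0 < Re (m2%:C + (2 / al2)%:C * - u).
  rewrite (cReD m2%:C) (mulrC _ (- u)) (cReMr (- u)) (cReN u) mulNr subr_gt0.
  rewrite mulrA ltr_pdivrMr// -ltr_pdivlMr//.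
  by move: ua; rewrite /a2 (mulrC al2).
rewrite /Lambda_integrand -/a1 -/a2 e1 e2 e3 e4 e5 e6 e7.
rewrite cGammaN_reflect// !(GammaCE r1, GammaCE r2, GammaCE u0, GammaCE su0, GammaCE s0).
rewrite cBeta_gamma// subrKC.
rewrite -[- a1%:C - s]opprD -[u - a2%:C]opprK !cpow_ratioE// !opprB.
rewrite !(mulrDl a1%:C) !(mulrDl a2%:C) !cexpD.
(* In exponential form the prefactor is the inverse of the powers produced by the translations a1
   and a2, divided by the two normalising Gamma values. *)
have kE : kappa%:C = cexp (- (a1%:C * (ln (A / s2))%:C)) * cexp (- (a1%:C * (ln b1)%:C)) *
    (cexp (- (a2%:C * (ln (B / s2))%:C)) * cexp (- (a2%:C * (ln b2)%:C))) /
    ((GammaR m1)%:C * (GammaR m2)%:C).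
  rewrite -!cexpD -!rmorphM -!rmorphN -!rmorphD cexpR -fmorphV -rmorphM.
  congr (_%:C); rewrite /kappa !powR_expR ?mulr_gt0// !ln_div ?posrE// !lnM ?posrE//.
  set x := (X in expR X / _); set y := (X in expR X * _ * _ * _); set z := (X in _ * expR X * _).
  rewrite (_ : _ + _ = x - y - z); last by rewrite /x /y /z; ring.
  have [y0 z0] := (expR_gt0 y, expR_gt0 z).
  by rewrite !expRD !expRN; field; rewrite !gt_eqF.
rewrite kE !mulNr !cexpN.
have s00 : s != 0 by apply: contraTneq s0 => ->; rewrite ltxx.
have G1C : (GammaR m1)%:C != 0 :> C by rewrite fmorph_eq0 gt_eqF.
have G2C : (GammaR m2)%:C != 0 :> C by rewrite fmorph_eq0 gt_eqF.
by field; rewrite ?s00 ?G1C ?G2C ?cGamma_neq0 ?cexp_neq0.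
Qed.

End integrand.
End mellin_barnes.

Section measurable_inverse.
Context (R : realType).

(** The inverse is written as x |x|^-2 with the power expressed through ln, which is measurable. The
    factor x makes the formula agree with 0^-1 = 0 at the origin. *)
Lemma measurable_inv : measurable_fun setT (fun x : R => x^-1).
Proof.
have E : (fun x : R => x * expR (- (2 * ln `|x|))) = (fun x => x^-1).
  apply/funext => x; have [->|x0] := eqVneq x 0; first by rewrite mul0r invr0.
  have x0' : 0 < `|x| by rewrite normr_gt0.
  rewrite expRN expRM_natl lnK ?posrE// -normrX ger0_norm ?sqr_ge0//.
  by rewrite expr2 invfM mulrA mulfV// mul1r.
rewrite -E; apply: measurable_funM => //; apply: measurableT_comp => //.
apply: measurableT_comp => //; apply: measurable_funM => //.
by apply: measurableT_comp => //; exact: measurable_ln.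
Qed.

Lemma ae_eq_integrable d (T : measurableType d) (m : {measure set T -> \bar R}) (f g : T -> R) :
  measurable_fun setT g -> {ae m, forall x, f x = g x} ->
  m.-integrable setT (EFin \o f) -> m.-integrable setT (EFin \o g).
Proof.
move=> mg fg /integrableP[mf If]; apply/integrableP; split; first exact/measurable_EFinP.
rewrite (ae_eq_integral (fun x => `|(EFin \o f) x|%E))//.
- exact/measurableT_comp/measurable_EFinP.
- exact: measurableT_comp.
- by apply: filterS fg => x + _ /= => ->.
Qed.

End measurable_inverse.

(** * The mean for one sub-carrier *)

Section channel_expectation.
Context d (T : measurableType d) (R : realType) (P : probability T R).
Local Notation C := (R[i]).
Local Notation mu := (@lebesgue_measure R).
Variables (G J : T -> R) (al1 m1 g1 al2 m2 g2 A B s2 c1 c2 : R).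
Hypotheses (A0 : 0 < A) (B0 : 0 < B) (s20 : 0 < s2).
Hypotheses (al10 : 0 < al1) (m10 : 0 < m1) (g10 : 0 < g1).
Hypotheses (al20 : 0 < al2) (m20 : 0 < m2) (g20 : 0 < g2).
Hypotheses (HG : is_alpha_mu P G al1 m1 g1) (HJ : is_alpha_mu P J al2 m2 g2).
Hypotheses (GJ : indep2 P G J) (Hc : Lambda_contours c1 c2 al1 m1 al2 m2).
Let b1 := amu_beta al1 m1 g1.
Let b2 := amu_beta al2 m2 g2.
Let a1 := al1 * m1 / 2.
Let a2 := al2 * m2 / 2.
Let cs := - a1 - c1.
Let cu := a2 + c2.
(** The logarithms of A G / s2 and, in [X2], of B J / s2, outside the null event where G or J fails
    to be positive and [ln] takes its default value. *)
Let X1 w := ln (A / s2) + ln (G w).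
Let X2 w := ln (B / s2) + ln (J w).
Let kappa := s2 `^ (a1 + a2) /
  ((A * b1) `^ a1 * GammaR m1 * (B * b2) `^ a2 * GammaR m2).

Let b10 : 0 < b1. Proof. exact: amu_beta_gt0 HG. Qed.
Let b20 : 0 < b2. Proof. exact: amu_beta_gt0 HJ. Qed.
Let G10 : 0 < GammaR m1. Proof. exact: GammaR_gt0 HG. Qed.
Let G20 : 0 < GammaR m2. Proof. exact: GammaR_gt0 HJ. Qed.

Let kappaC : kappa%:C != 0 :> C.
Proof. by rewrite fmorph_eq0; exact: kappa_neq0. Qed.

Let pi2C : (2 * pi)%:C != 0 :> C.
Proof. by rewrite fmorph_eq0 gt_eqF// mulr_gt0// pi_gt0. Qed.

(** [cs] and [cu] are the real parts of s and u on the contours: c2 < 0 gives cu < a2, the lower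
    bound on c1 gives cs < 1, and its upper bound gives cu < cs. *)
Let contours : [/\ 0 < cu, cu < a2, cu < cs & cs < 1].
Proof.
case: Hc; rewrite -/a1 -/a2 lt_min => h1 /andP[h2 h3] h4 h5; rewrite /cu /cs.
by split; lra.
Qed.

Let cu0 : 0 < cu. Proof. by case: contours. Qed.
Let cua : cu < a2. Proof. by case: contours. Qed.
Let cucs : cu < cs. Proof. by case: contours. Qed.
Let cs1 : cs < 1. Proof. by case: contours. Qed.
Let cs0 : 0 < cs. Proof. exact: lt_trans cucs. Qed.

Let mX1 : measurable_fun setT X1.
Proof.
apply: measurable_funD => //; apply: measurableT_comp; first exact: measurable_ln.
exact: alpha_mu_measurable HG.
Qed.

Let mX2 : measurable_fun setT X2.
Proof.
apply: measurable_funD => //; apply: measurableT_comp; first exact: measurable_ln.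
exact: alpha_mu_measurable HJ.
Qed.

Let mL2 : measurable_fun setT (fun w => ln (1 + expR (X2 w))).
Proof.
apply: (measurableT_comp (f := fun v : R => ln (1 + expR v))) => //.
by apply: continuous_measurable_fun; exact: continuous_ln1expR.
Qed.

Let shift_mean (z : C) (q : R) (Y : T -> R) : cintegrable P (fun w => cexp (z * (Y w)%:C)) ->
  cintegrable P (fun w => cexp (z * (q + Y w)%:C)) /\
  cintegral P (fun w => cexp (z * (q + Y w)%:C)) =
    cexp (z * q%:C) * cintegral P (fun w => cexp (z * (Y w)%:C)).
Proof.
move=> IY; have E w : cexp (z * q%:C) * cexp (z * (Y w)%:C) = cexp (z * (q + Y w)%:C).
  by rewrite -cexpD -mulrDr -rmorphD.
split; first exact: eq_cintegrable (cintegrableZl (cexp (z * q%:C)) IY).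
by rewrite -cintegralZl//; apply: eq_cintegral => w; rewrite E.
Qed.

Let G_moment (s : C) : 0 < Re s ->
  cintegrable P (fun w => cexp (s * (X1 w)%:C)) /\
  cintegral P (fun w => cexp (s * (X1 w)%:C)) = cexp (s * (ln (A / s2))%:C) *
    (cexp (s * (ln b1)%:C) * cGamma (m1%:C + (2 / al1)%:C * s) / (GammaR m1)%:C).
Proof.
move=> s0; have [|I E] := alpha_mu_moment al10 m10 g10 HG (z := s).
  by rewrite addr_gt0// mulr_gt0// divr_gt0.
by have [I' E'] := shift_mean (ln (A / s2)) I; split => //; rewrite E' E.
Qed.

Let J_moment (u : C) : Re u < a2 ->
  cintegral P (fun w => cexp (- u * (X2 w)%:C)) = cexp (- u * (ln (B / s2))%:C) *
    (cexp (- u * (ln b2)%:C) * cGamma (m2%:C + (2 / al2)%:C * - u) / (GammaR m2)%:C).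
Proof.
move=> ua; have [|I E] := alpha_mu_moment al20 m20 g20 HJ (z := - u).
  rewrite (cReN u) mulrN subr_gt0 mulrAC ltr_pdivrMr// mulrC -ltr_pdivlMr//.
  by move: ua; rewrite /a2 (mulrC al2).
by have [I' E'] := shift_mean (ln (B / s2)) I; rewrite E' E.
Qed.

(** Almost surely the logarithm of A G / (s2 + B J), since s2 + B J = s2 (1 + B J / s2). *)
Let zeta w := X1 w - ln (1 + expR (X2 w)).

Let mzeta : measurable_fun setT zeta.
Proof. exact: measurable_funB. Qed.

Let integrable_expR_zeta : P.-integrable setT (EFin \o (fun w => expR (cs * zeta w))).
Proof.
have I : P.-integrable setT (EFin \o (fun w => expR (cs * ln (G w)))).
  by apply: (alpha_mu_integrable al10 m10 g10 HG); rewrite addr_gt0// mulr_gt0// divr_gt0.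
have := integrableZl measurableT (expR (cs * ln (A / s2))) I.
apply: le_integrable => //.
  apply/measurable_EFinP; apply: measurableT_comp => //.
  exact: measurable_funM.
move=> w _ /=; rewrite lee_fin -expRD -mulrDr !ger0_norm ?expR_ge0// ler_expR.
by rewrite ler_pM2l// /zeta gerBl ln1expR_ge0.
Qed.

Let joint_mean (s : C) : 0 < Re s ->
  cintegral P (fun w => cexp (s * (zeta w)%:C)) =
  cintegral P (fun w => cexp (s * (X1 w)%:C)) *
  cintegral P (fun w => cexp (- (s * (ln (1 + expR (X2 w)))%:C))).
Proof.
move=> s0; have [I1 _] := G_moment s0.
pose F (g : R) := cexp (s * (ln (A / s2) + ln g)%:C).
pose H (j : R) := cexp (- (s * (ln (1 + expR (ln (B / s2) + ln j)))%:C)).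
have mF : cmeasurable F.
  apply: cmeasurable_exp; apply: cmeasurableM; first exact: cmeasurable_cst.
  apply: cmeasurable_real; apply: measurable_funD => //; exact: measurable_ln.
have mH : cmeasurable H.
  apply: cmeasurable_exp; apply: cmeasurableN; apply: cmeasurableM.
    exact: cmeasurable_cst.
  apply: cmeasurable_real; apply: (measurableT_comp (f := fun v : R => ln (1 + expR v))).
    by apply: continuous_measurable_fun; exact: continuous_ln1expR.
  by apply: measurable_funD => //; exact: measurable_ln.
have IH : cintegrable P (fun w => H (J w)).
  apply: (@le_cintegrable _ _ R P _ (fun=> 1)).
  - exact: (cmeasurable_comp (alpha_mu_measurable HJ) mH).
  - move=> w; rewrite normc_cexp (cReN (s * _)) (cReMr s) -[leRHS]expR0 ler_expR oppr_le0.
    by rewrite mulr_ge0 ?(ltW s0)// ln1expR_ge0.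
  - exact: finite_measure_integrable_cst.
rewrite -(indep2_cintegralM (alpha_mu_measurable HG) (alpha_mu_measurable HJ) GJ mF mH)//.
apply: eq_cintegral => w; rewrite /F /H -cexpD; congr cexp.
by rewrite /zeta /X1 rmorphB mulrBr.
Qed.

Let refl_kernel (s : C) := cGamma s * cGamma (1 - s) / s.

(** For fixed s, only the Beta factor and the moment of J depend on the inner variable. Inverting
    the Beta kernel replaces them by the mean of (1 + B J / s2)^(- s), which independence merges
    with the moment of G into the s-moment of exp [zeta]. *)
Let inner (y : R) : let s := cs%:C - 'i * y%:C in
  kappa%:C * mb_line c2
    (fun t2 => Lambda_integrand A B s2 al1 m1 b1 al2 m2 b2 (c1%:C + 'i * y%:C) t2) =
  refl_kernel s * cintegral P (fun w => cexp (s * (zeta w)%:C)).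
Proof.
move=> s.
have rs : Re s = cs by exact: Re_lineN.
have s0 : 0 < Re s by rewrite rs.
have t1E : c1%:C + 'i * y%:C = - a1%:C - s by rewrite /s /cs rmorphB rmorphN /=; ring.
have IX : P.-integrable setT (EFin \o (fun w => expR (- cu * X2 w))).
  have I : P.-integrable setT (EFin \o (fun w => expR (- cu * ln (J w)))).
    apply: (alpha_mu_integrable al20 m20 g20 HJ).
    rewrite mulrN subr_gt0 mulrAC ltr_pdivrMr// mulrC -ltr_pdivlMr//.
    by move: cua; rewrite /a2 (mulrC al2).
  have := integrableZl measurableT (expR (- cu * ln (B / s2))) I.
  by congr (_.-integrable _ _); apply/funext => w /=; rewrite -EFinM -expRD -mulrDr.
have cus : cu < Re s by rewrite rs.
have [IN EN] := mellin_inv_beta cu0 cus mX2 IX.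
have E (v : R) : Lambda_integrand A B s2 al1 m1 b1 al2 m2 b2 (c1%:C + 'i * y%:C)
      (c2%:C + 'i * v%:C) =
    (kappa%:C^-1 * (refl_kernel s * cintegral P (fun w => cexp (s * (X1 w)%:C)))) *
    (cBeta (cu%:C + 'i * v%:C) (s - (cu%:C + 'i * v%:C)) *
     cintegral P (fun w => cexp (- (cu%:C + 'i * v%:C) * (X2 w)%:C))).
  set u := cu%:C + 'i * v%:C.
  have ru : Re u = cu by exact: Re_line.
  have t2E : c2%:C + 'i * v%:C = u - a2%:C by rewrite /u /cu rmorphD /=; ring.
  apply: (mulfI kappaC); rewrite t1E t2E.
  rewrite Lambda_integrandE ?ru ?rs//.
  rewrite J_moment ?ru// (G_moment s0).2 -/b1 -/b2 /refl_kernel.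
  by rewrite !mulrA mulfV// mul1r.
rewrite mb_lineE; last first.
  by apply: eq_cintegrable (cintegrableZl _ IN) => v; rewrite E.
transitivity (kappa%:C * ((2 * pi)%:C^-1 *
  ((kappa%:C^-1 * (refl_kernel s * cintegral P (fun w => cexp (s * (X1 w)%:C)))) *
  ((2 * pi)%:C * cintegral P (fun w => cexp (- (s * (ln (1 + expR (X2 w)))%:C))))))).
  rewrite -EN; congr (_ * (_ * _)); rewrite -[RHS]cintegralZl//.
  by apply: eq_cintegral => v; exact: E.
rewrite joint_mean//.
have cancel (k p x x' z : C) : k != 0 -> p != 0 ->
    k * (p^-1 * (k^-1 * (x * x') * (p * z))) = x * (x' * z).
  by move=> k0 p0; field; rewrite k0 p0.
exact: cancel.
Qed.

(** The two logarithms are compared only where G and J are positive, hence almost surely; the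
    integrals agree all the same. *)
Let ratioE : {ae P, forall w, ln (1 + expR (zeta w)) = ln (1 + A * G w / (s2 + B * J w))}.
Proof.
have := alpha_mu_gt0 HG; have := alpha_mu_gt0 HJ.
apply: filterS2 => w J0 G0; congr (ln (1 + _)).
have Bs : 0 < B / s2 * J w by rewrite mulr_gt0// divr_gt0.
have E1 : expR (X1 w) = A / s2 * G w by rewrite expRD !lnK ?posrE// divr_gt0.
have E2 : expR (X2 w) = B / s2 * J w by rewrite expRD !lnK ?posrE// divr_gt0.
rewrite /zeta expRD expRN E1 E2 lnK ?posrE ?addr_gt0//.
by field; rewrite !gt_eqF// addr_gt0// mulr_gt0.
Qed.

Lemma channel_expectation :
  P.-integrable setT (EFin \o (fun w => ln (1 + A * G w / (s2 + B * J w)))) /\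
  Lambda c1 c2 A B s2 al1 m1 b1 al2 m2 b2 =
    (\int[P]_w ln (1 + A * G w / (s2 + B * J w)))%:C.
Proof.
have [IN IL EN] := mellin_inv_log cs0 cs1 mzeta integrable_expR_zeta.
have mL : measurable_fun setT (fun w => ln (1 + A * G w / (s2 + B * J w))).
  apply: measurableT_comp; first exact: measurable_ln.
  apply: measurable_funD => //; apply: measurable_funM.
    by apply: measurable_funM => //; exact: alpha_mu_measurable HG.
  apply: measurableT_comp; first exact: measurable_inv.
  apply: measurable_funD => //; apply: measurable_funM => //.
  exact: alpha_mu_measurable HJ.
have mz : measurable_fun setT (fun w => ln (1 + expR (zeta w))).
  by have /integrableP[/measurable_EFinP] := IL.
split; first exact: (ae_eq_integrable mL ratioE IL).
have -> : \int[P]_w ln (1 + A * G w / (s2 + B * J w)) = \int[P]_w ln (1 + expR (zeta w)).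
  congr fine; apply: ae_eq_integral => //; try exact/measurable_EFinP.
  by apply: filterS ratioE => w E _ /=; rewrite E.
have E (y : R) : mb_line c2 (fun t2 =>
     Lambda_integrand A B s2 al1 m1 b1 al2 m2 b2 (c1%:C + 'i * y%:C) t2) =
   kappa%:C^-1 * (refl_kernel (cs%:C - 'i * y%:C) *
     cintegral P (fun w => cexp ((cs%:C - 'i * y%:C) * (zeta w)%:C))).
  by rewrite -inner mulKf.
rewrite /Lambda -/a1 -/a2 -/kappa mb_lineE; last first.
  by apply: eq_cintegrable (cintegrableZl (kappa%:C^-1) IN) => y; rewrite E.
transitivity (kappa%:C * ((2 * pi)%:C^-1 * (kappa%:C^-1 *
    (2 * pi * \int[P]_w ln (1 + expR (zeta w)))%:C))).
  rewrite -EN; congr (_ * (_ * _)); rewrite -[RHS]cintegralZl//.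
  by apply: eq_cintegral => y; exact: E.
have cancel (k p z : C) : k != 0 -> p != 0 -> k * (p^-1 * (k^-1 * (p * z))) = z.
  by move=> k0 p0; field; rewrite k0 p0.
by rewrite (rmorphM _ (2 * pi)); exact: cancel.
Qed.

End channel_expectation.

Theorem theorem3 (R : realType) (d : measure_display) (T : measurableType d)
  (P : probability T R) (Mc : nat)
  (df Tpri sr2 : R) (Dbi Dgi alpha_bi alpha_gi pJ : R) (pT : 'I_Mc -> R)
  (al_rm mu_rm gb_rm : 'I_Mc -> R) (al_rg mu_rg gb_rg : R)
  (G J : 'I_Mc -> T -> R) (c1 c2 : 'I_Mc -> R) :
  0 < df -> 0 < Tpri -> 0 < sr2 ->
  0 < Dbi -> 0 < Dgi -> 0 < pJ -> (forall m, 0 < pT m) ->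
  (forall m, [/\ 0 < al_rm m, 0 < mu_rm m & 0 < gb_rm m]) ->
  [/\ 0 < al_rg, 0 < mu_rg & 0 < gb_rg] ->
  (forall m, is_alpha_mu P (G m) (al_rm m) (mu_rm m) (gb_rm m)) ->
  (forall m, is_alpha_mu P (J m) al_rg mu_rg gb_rg) ->
  (forall m, indep2 P (G m) (J m)) ->
  (forall m, Lambda_contours (c1 m) (c2 m) (al_rm m) (mu_rm m) al_rg mu_rg) ->
  let C3 := fun m : 'I_Mc => Tpri * Dbi `^ (- alpha_bi) * pT m in
  let C4 := Dgi `^ (- alpha_gi) * pJ in
  let Iij := fun w : T =>
    df * Tpri / 2 * \sum_(m < Mc) log2 (1 + C3 m * G m w / (sr2 + C4 * J m w)) in
  let S := \sum_(m < Mc)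
    ((df * Tpri / (2 * ln 2))%:C%C
     * Lambda (c1 m) (c2 m) (C3 m) C4 sr2
         (al_rm m) (mu_rm m) (amu_beta (al_rm m) (mu_rm m) (gb_rm m))
         al_rg mu_rg (amu_beta al_rg mu_rg gb_rg)) in
  'E_P[Iij]%E = (complex.Re S)%:E /\ complex.Im S = 0.
Proof.
move=> df0 Tpri0 sr20 Dbi0 Dgi0 pJ0 pT0 Hrm [al0 mu0 gb0] HG HJ GJ Hc C3 C4 Iij S.
have C30 m : 0 < C3 m by rewrite mulr_gt0// mulr_gt0// powR_gt0.
have C40 : 0 < C4 by rewrite mulr_gt0// powR_gt0.
pose L m w := ln (1 + C3 m * G m w / (sr2 + C4 * J m w)).
pose K := df * Tpri / (2 * ln 2).
have HL m : P.-integrable setT (EFin \o L m) /\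
    Lambda (c1 m) (c2 m) (C3 m) C4 sr2
      (al_rm m) (mu_rm m) (amu_beta (al_rm m) (mu_rm m) (gb_rm m))
      al_rg mu_rg (amu_beta al_rg mu_rg gb_rg) = (\int[P]_w L m w)%:C%C.
  by have [? ? ?] := Hrm m; exact: channel_expectation.
(* Every [Lambda] in the sum is the embedding of a real mean, so this identity gives the value of
   the real part and the vanishing of the imaginary part together. *)
have SE : S = (\sum_(m < Mc) K * \int[P]_w L m w)%:C%C.
  by rewrite rmorph_sum; apply: eq_bigr => m _; rewrite (HL m).2; exact/esym/rmorphM.
rewrite SE; split => //=.
have IK m : P.-integrable setT (fun w => (K * L m w)%:E).
  exact: (integrableZl measurableT K (HL m).1).
rewrite unlock -sumEFin.
transitivity (\int[P]_w \sum_(m < Mc) (K * L m w)%:E)%E.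
  apply: eq_integral => w _; rewrite sumEFin /Iij -mulr_sumr; congr (_%:E).
  rewrite /log2 -mulr_suml /K invfM; ring.
rewrite integral_sum//; apply: eq_bigr => m _.
under eq_integral do rewrite EFinM.
rewrite integralZl//; last exact: (HL m).1.
by rewrite /Rintegral [RHS]EFinM fineK// integrable_fin_num//; exact: (HL m).1.
Qed.
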